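(* Let $C^\ast(R_{punc})$ be the reduced $C^\ast$-algebra of the translational equivalence relation $R_{punc}$ on the discrete hull $\Omega_{punc}$ of a tiling satisfying the standing assumptions given in the context, and let $$\mathcal{E}=\{z^k\cdot e(P,t,t') : P \text{ a patch in some tiling in } \Omega_{punc},\ t,t'\in P,\ k\in\mathbb{Z}\}.$$ Then the complex linear span of the functions in $\mathcal{E}$ is a uniformly dense $\ast$-subalgebra of $C^\ast(R_{punc})$.
   Context: **Tilings.** A tiling of $\mathbb{R}^2$ is a countable collection of closed polygonal subsets (tiles) covering $\mathbb{R}^2$ such that distinct tiles have disjoint interiors. A patch in a tiling is a finite subset of its tiles; $T\cap B(x,r)$ denotes the patch of tiles of $T$ completely contained in the open ball $B(x,r)$. $\Gamma=\mathbb{R}^2\rtimes \mathcal{S}^1$ is the group of orientation preserving isometries of $\mathbb{R}^2$, where $\mathcal{S}^1=SO(2,\mathbb{R})$ consists of the rotations $R_\theta$ about the origin; $(x,R_\theta)\in\Gamma$ acts on a tiling $T$ by $R_\theta(T+x)$. Put $d((x,R_\theta),(y,R_\phi))=|x-y|+\|R_\theta-R_\phi\|_{F}$ (Frobenius norm of the matrix difference). **Tiling metric.** For $0<\varepsilon<1$, say $T,T'$ are within $\varepsilon$ if there are $(x,R_\theta),(x',R_{\theta'})\in\Gamma$, each at $d$-distance $<\varepsilon$ from the identity, with $R_\theta(T+x)\cap B(0,\varepsilon^{-1})=R_{\theta'}(T'+x')\cap B(0,\varepsilon^{-1})$. Then $d_\Gamma(T,T')$ is the infimum of all such $\varepsilon$,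 or $1$ if there are none. The continuous hull $\Omega_T$ of a tiling $T$ is the completion of $\{T+x:x\in\mathbb{R}^2\}$ in $d_\Gamma$; its elements are tilings. **Proto-tiles.** $\{p_1,\dots,p_n\}$ is a finite nonempty set of closed polygons (proto-tiles) such that each tile of each tiling in $\Omega_T$ is $\gamma(p_i)$ for some $\gamma\in\Gamma$ and some $i$. **Standing assumptions.** (a) $\Gamma$ is the full group of orientation preserving isometries of $\mathbb{R}^2$; that is, for every $\gamma\in\Gamma$ and every proto-tile $p$ there is a tiling in $\Omega_T$ containing the tile $\gamma(p)$. (b) $\Omega_T$ has finite local complexity with respect to $\Gamma$: for every $r>0$ the set $\{T'\cap B(x,r):T'\in\Omega_T,\ x\in\mathbb{R}^2\}$ is finite modulo $\Gamma$. (c) $\Omega_T$ is strongly aperiodic: $T'+x\ne T'$ for all $T'\in\Omega_T$ and $x\neq 0$. **Punctures.** Each proto-tile $p_i$ has a chosen point $x(p_i)$ in its interior (its puncture) such that the pointed polygon $(p_i,x(p_i))$ has trivial symmetry group; proto-tiles are placed in a fixed standard orientation with $x(p_i)=0$. Every tile $t=\gamma(p_i)$ gets the puncture $x(t)=\gamma(x(p_i))$. The discrete hull is $\Omega_{punc}=\{T'\in\Omega_T : \text{some tile } t\in T' \text{ has } x(t)=0\}$ with metric $d_\Gamma$; for $T'\in\Omega_{punc}$, $T'(0)$ is the tile of $T'$ containing the origin, and $\angle T'(0)=\theta$ is the angle such that $R_\theta(p_i)=T'(0)$ for some $i$. **Equivalence relation.** $R_{punc}=\{(T',T'-x(t)):T'\in\Omega_{punc},\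 t\in T'\}$ has the topology of the metric $d_R((T_1,T_1-x(t_1)),(T_2,T_2-x(t_2)))=d_\Gamma(T_1,T_2)+|x(t_1)-x(t_2)|$; $[T']$ is the equivalence class of $T'$. **$C^\ast$-algebra.** $C_c(R_{punc})$ (continuous compactly supported complex functions) is a $\ast$-algebra with $f\cdot g(T_1,T_2)=\sum_{T_3\in[T_1]}f(T_1,T_3)g(T_3,T_2)$ and $f^\ast(T_1,T_2)=\overline{f(T_2,T_1)}$. For $T_0\in\Omega_{punc}$ the induced representation $\pi_{T_0}$ on $\ell^2([T_0])$ is $(\pi_{T_0}(f)\xi)(T_1)=\sum_{T_2\in[T_0]}f(T_1,T_2)\xi(T_2)$. The reduced norm is $\|f\|_{red}=\sup_{T_0\in\Omega_{punc}}\|\pi_{T_0}(f)\|$, and $C^\ast(R_{punc})$ is the completion of $C_c(R_{punc})$ in this norm. **The functions.** For a patch $P$ and $t,t'\in P$, $e(P,t,t')$ is the characteristic function of $$V(P,t,t')=\{(T_1,T_1-R_\theta(x(t')-x(t)))\in R_{punc} : R_\theta(P-x(t))\subset T_1 \text{ for some } R_\theta\in\mathcal{S}^1\}.$$ The function $z$ is $z(T_1,T_2)=e^{i\angle T_1(0)}$ if $T_1=T_2$ and $0$ otherwise; $z^k$ ($k\in\mathbb{Z}$) is its $k$-th power (as a unitary). *)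

(* Defs.v *)
From HB Require Import structures.
From mathcomp Require Import all_boot all_order all_algebra.
From mathcomp Require Import all_classical all_reals all_analysis.
From mathcomp Require Export complex.

Set Implicit Arguments.
Unset Strict Implicit.
Unset Printing Implicit Defensive.

Import Order.TTheory GRing.Theory Num.Theory.
Import numFieldNormedType.Exports.

Local Open Scope classical_set_scope.
Local Open Scope ring_scope.

Section Plane.
Context {R : realType}.
Local Notation plane := 'cV[R]_2.

(* On column vectors this is the Euclidean norm; the library norm on matrices
   is the sup norm. *)
Definition frobenius m n (A : 'M[R]_(m, n)) : R :=
  Num.sqrt (\sum_i \sum_j A i j ^+ 2).

Definition eball (x : plane) (r : R) : set plane :=
  [set y | frobenius (y - x) < r].

Definition rotation (theta : R) : 'M[R]_2 :=
  \matrix_(i < 2, j < 2)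
    (if i == j then cos theta else if (i < j)%N then - sin theta else sin theta).

(* (x, theta) stands for the isometry (x, R_theta). *)
Definition isometry_dist (g h : plane * R) : R :=
  frobenius (g.1 - h.1) + frobenius (rotation g.2 - rotation h.2).

Definition isometry_id : plane * R := (0, 0).

Definition segment (a b : plane) : set plane :=
  [set y | exists2 s : R, 0 <= s <= 1 & y = a + s *: (b - a)].

(* The edges are the segments from v i to v (ordS i), indices being cyclic. *)
Definition simple_closed_chain n (v : 'I_n -> plane) : Prop :=
  [/\ (3 <= n)%N, injective v &
      forall (i j : 'I_n) (y : plane), i != j ->
        segment (v i) (v (ordS i)) y -> segment (v j) (v (ordS j)) y ->
        (j = ordS i /\ y = v j) \/ (i = ordS j /\ y = v i)].

(* A closed polygon is a simple closed polygonal chain together with the region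
   it encloses: the only nonempty bounded regular closed set whose frontier is
   the chain. *)
Definition closed_polygon (S : set plane) : Prop :=
  [/\ (exists r : R, S `<=` eball 0 r), closure (interior S) = S &
      exists n (v : 'I_n -> plane), simple_closed_chain v /\
        S `\` interior S = \bigcup_i segment (v i) (v (ordS i))].

(* A tile is a polygon carrying its puncture. The puncture is part of the tile
   because a polygon with rotational symmetry (for instance a square punctured
   off its centre) does not determine it. *)
Definition tile : Type := (set plane * plane)%type.
Definition tile_support (t : tile) : set plane := t.1.
Definition puncture (t : tile) : plane := t.2.

Definition tile_map (f : plane -> plane) (t : tile) : tile :=
  (f @` tile_support t, f (puncture t)).

Definition translate (P : set tile) (x : plane) : set tile :=
  tile_map (fun y => y + x) @` P.
Definition rotate (theta : R) (P : set tile) : set tile :=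
  tile_map (mulmx (rotation theta)) @` P.
Definition isometry_act (g : plane * R) (P : set tile) : set tile :=
  rotate g.2 (translate P g.1).
Definition act_tile (g : plane * R) (t : tile) : tile :=
  tile_map (mulmx (rotation g.2)) (tile_map (fun y => y + g.1) t).

Definition is_tiling (T : set tile) : Prop :=
  [/\ countable T,
      forall t, T t -> closed_polygon (tile_support t),
      \bigcup_(t in T) tile_support t = setT &
      forall t u, T t -> T u -> t <> u ->
        interior (tile_support t) `&` interior (tile_support u) = set0].

Definition is_patch_of (P T : set tile) : Prop := finite_set P /\ P `<=` T.

Definition patch_in_ball (T : set tile) (x : plane) (r : R) : set tile :=
  [set t | T t /\ tile_support t `<=` eball x r].

Definition within (eps : R) (T T' : set tile) : Prop :=
  exists g g' : plane * R,
    [/\ isometry_dist g isometry_id < eps,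
        isometry_dist g' isometry_id < eps &
        patch_in_ball (isometry_act g T) 0 eps^-1 = patch_in_ball (isometry_act g' T') 0 eps^-1].

Definition tiling_dist (T T' : set tile) : R :=
  let A := [set eps : R | 0 < eps < 1 /\ within eps T T'] in
  if `[< A !=set0 >] then inf A else 1.

(* The completion of the translates of T, realised as their closure among all
   tilings. *)
Definition hull (T : set tile) : set (set tile) :=
  [set T' | is_tiling T' /\
     forall eps : R, 0 < eps -> exists x, tiling_dist T' (translate T x) < eps].

Definition discrete_hull (T : set tile) : set (set tile) :=
  [set T' | hull T T' /\ exists2 t, T' t & puncture t = 0].

Definition Rpunc (T : set tile) : set (set tile * set tile) :=
  [set p | discrete_hull T p.1 /\
     exists2 t, p.1 t & p.2 = translate p.1 (- puncture t)].

Definition eq_class (T T' : set tile) : set (set tile) :=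
  [set T'' | Rpunc T (T', T'')].

(* The vector x(t) of the pair (T', T' - x(t)); it is unique when T' has no
   translational period. *)
Definition displacement (p : set tile * set tile) : plane :=
  xget 0 [set v | exists t,
    [/\ p.1 t, v = puncture t & p.2 = translate p.1 (- v)]].

Definition Rpunc_dist (p q : set tile * set tile) : R :=
  tiling_dist p.1 q.1 + frobenius (displacement p - displacement q).

Definition Rpunc_space (T : set tile) : Type := {p | Rpunc T p}.

Definition Rpunc_open (T : set tile) : set (set (Rpunc_space T)) :=
  [set U | forall p, U p -> exists2 eps : R, 0 < eps &
     forall q, Rpunc_dist (sval p) (sval q) < eps -> U q].

End Plane.

HB.instance Definition _ (R : realType) (T : set (@tile R)) :=
  gen_eqMixin (Rpunc_space T).
HB.instance Definition _ (R : realType) (T : set (@tile R)) :=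
  gen_choiceMixin (Rpunc_space T).

Section RpuncTopology.
Context {R : realType} (T : set (@tile R)).

Lemma Rpunc_openT : Rpunc_open (setT : set (Rpunc_space T)).
Proof. by move=> p _; exists 1. Qed.

Lemma Rpunc_openI : setI_closed (@Rpunc_open R T).
Proof.
move=> U V oU oV p [Up Vp].
have [e e0 He] := oU p Up; have [d d0 Hd] := oV p Vp.
exists (Num.min e d); first by rewrite lt_min e0 d0.
move=> q; rewrite lt_min => /andP[qe qd].
by split; [apply: He | apply: Hd].
Qed.

Lemma Rpunc_open_bigU (I : Type) (f : I -> set (Rpunc_space T)) :
  (forall i, Rpunc_open (f i)) -> Rpunc_open (\bigcup_i f i).
Proof.
move=> of_ p [i _ fip]; have [e e0 He] := of_ i p fip.
by exists e => // q qe; exists i => //; apply: He.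
Qed.

End RpuncTopology.

HB.instance Definition _ (R : realType) (T : set (@tile R)) :=
  isOpenTopological.Build (Rpunc_space T) (@Rpunc_openT R T) (@Rpunc_openI R T)
    (@Rpunc_open_bigU R T).

(* Completion of a set D of a type V for dist, by classes of Cauchy sequences;
   a point of the completion is a class, that is a set of sequences. *)
Section Completion.
Context {R : realType} {V : Type} (D : set V) (dist : V -> V -> \bar R).

Definition cauchy_seq (u : nat -> V) : Prop :=
  (forall n, D (u n)) /\
  forall eps : R, 0 < eps -> exists N : nat, forall m n : nat,
    (N <= m)%N -> (N <= n)%N -> (dist (u m) (u n) < eps%:E)%E.

Definition same_limit (u v : nat -> V) : Prop :=
  dist (u n) (v n) @[n --> \oo] --> 0%E.

Definition limit_class (u : nat -> V) : set (nat -> V) :=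
  [set v | cauchy_seq v /\ same_limit u v].

Definition completion : set (set (nat -> V)) :=
  [set a | exists2 u, cauchy_seq u & a = limit_class u].

Definition completion_embed (f : V) : set (nat -> V) := limit_class (fun=> f).

Definition completion_lift1 (op : V -> V) (a : set (nat -> V)) :
    set (nat -> V) :=
  [set w | cauchy_seq w /\
     exists2 u, a u & same_limit (fun n => op (u n)) w].

Definition completion_lift2 (op : V -> V -> V) (a b : set (nat -> V)) :
    set (nat -> V) :=
  [set w | cauchy_seq w /\ exists u v,
     [/\ a u, b v & same_limit (fun n => op (u n) (v n)) w]].

Definition completion_norm (norm : V -> \bar R) (a : set (nat -> V)) : \bar R :=
  xget +oo%E [set r | exists2 u, a u & norm (u n) @[n --> \oo] --> r].

End Completion.

(* Functions on Rpunc T are represented by their extension by zero to all pairs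
   of sets of tiles. *)
Section Algebra.
Context {R : realType}.
Variable T : set (@tile R).
Local Notation fn := (set (@tile R) -> set (@tile R) -> R[i]).

Definition Cc : set fn :=
  [set f : fn |
    [/\ forall T1 T2, ~ Rpunc T (T1, T2) -> f T1 T2 = 0,
        continuous
          (fun p : Rpunc_space T => f (sval p).1 (sval p).2 : R[i]^o) &
        compact (closure
          [set p : Rpunc_space T | f (sval p).1 (sval p).2 != 0])]].

Definition fn_zero : fn := fun _ _ => 0.
Definition fn_add (f g : fn) : fn := fun T1 T2 => f T1 T2 + g T1 T2.
Definition fn_scale (c : R[i]) (f : fn) : fn := fun T1 T2 => c * f T1 T2.
Definition fn_sub (f g : fn) : fn := fn_add f (fn_scale (-1) g).

(* The sums over equivalence classes have finitely many nonzero terms as soon as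
   f is compactly supported. *)
Definition fn_mul (f g : fn) : fn := fun T1 T2 =>
  \sum_(T3 \in eq_class T T1) (f T1 T3 * g T3 T2).
Definition fn_star (f : fn) : fn := fun T1 T2 => conjc (f T2 T1).

Definition l2norm (T0 : set (@tile R)) (xi : set (@tile R) -> R[i]) : \bar R :=
  sqrte (\esum_(T1 in eq_class T T0)
    (complex.Re (xi T1) ^+ 2 + complex.Im (xi T1) ^+ 2)%R%:E)%E.

Definition induced_rep (T0 : set (@tile R)) (f : fn)
    (xi : set (@tile R) -> R[i]) : set (@tile R) -> R[i] :=
  fun T1 => \sum_(T2 \in eq_class T T0) (f T1 T2 * xi T2).

Definition induced_rep_norm (T0 : set (@tile R)) (f : fn) : \bar R :=
  ereal_sup [set l2norm T0 (induced_rep T0 f xi) |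
              xi in [set xi | (l2norm T0 xi <= 1)%E]].

Definition reduced_norm (f : fn) : \bar R :=
  ereal_sup [set induced_rep_norm T0 f | T0 in discrete_hull T].

Definition reduced_dist (f g : fn) : \bar R := reduced_norm (fn_sub f g).

Definition Cstar : set (set (nat -> fn)) := completion Cc reduced_dist.
Definition Cstar_of : fn -> set (nat -> fn) := completion_embed Cc reduced_dist.
Definition Cstar_zero : set (nat -> fn) := Cstar_of fn_zero.
Definition Cstar_add := completion_lift2 Cc reduced_dist fn_add.
Definition Cstar_scale (c : R[i]) :=
  completion_lift1 Cc reduced_dist (fn_scale c).
Definition Cstar_mul := completion_lift2 Cc reduced_dist fn_mul.
Definition Cstar_star := completion_lift1 Cc reduced_dist fn_star.
Definition Cstar_norm : set (nat -> fn) -> \bar R :=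
  completion_norm reduced_norm.

Definition star_subalgebra (A : set (set (nat -> fn))) : Prop :=
  [/\ A `<=` Cstar /\ A Cstar_zero,
      forall a b, A a -> A b -> A (Cstar_add a b),
      forall c a, A a -> A (Cstar_scale c a),
      forall a b, A a -> A b -> A (Cstar_mul a b) &
      forall a, A a -> A (Cstar_star a)].

Definition dense_in_Cstar (A : set (set (nat -> fn))) : Prop :=
  forall a, Cstar a -> forall eps : R, 0 < eps -> exists2 b, A b &
    (Cstar_norm (Cstar_add a (Cstar_scale (-1)%R b)) < eps%:E)%E.

Definition linear_span (E : set fn) : set fn :=
  [set f : fn | exists n (c : 'I_n -> R[i]) (e : 'I_n -> fn),
     (forall i, E (e i)) /\
     f = fun T1 T2 => \sum_(i < n) c i * e i T1 T2].

Variables (n : nat) (p : 'I_n -> set 'cV[R]_2).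

(* Proto-tiles are placed with their puncture at the origin. *)
Definition proto (i : 'I_n) : @tile R := (p i, 0).

Definition central_tile (T' : set (@tile R)) : @tile R :=
  xget (set0, 0) [set t | T' t /\ tile_support t 0].

Definition central_angle (T' : set (@tile R)) : R :=
  xget 0 [set theta | exists i, central_tile T' = act_tile (0, theta) (proto i)].

Definition fn_unit : fn := fun T1 T2 =>
  if `[< discrete_hull T T1 /\ T1 = T2 >] then 1 else 0.

Definition fn_z : fn := fun T1 T2 =>
  if `[< discrete_hull T T1 /\ T1 = T2 >]
  then Complex (cos (central_angle T1)) (sin (central_angle T1)) else 0.

(* The inverse of the unitary z is its adjoint. *)
Definition fn_zpow (k : int) : fn :=
  match k with
  | Posz m => iter m (fn_mul fn_z) fn_unit
  | Negz m => iter m.+1 (fn_mul (fn_star fn_z)) fn_unit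
  end.

Definition Vset (P : set (@tile R)) (t t' : @tile R) :
    set (set (@tile R) * set (@tile R)) :=
  [set q | Rpunc T q /\ exists theta : R,
     rotate theta (translate P (- puncture t)) `<=` q.1 /\
     q.2 = translate q.1 (- (rotation theta *m (puncture t' - puncture t)))].

Definition fn_e (P : set (@tile R)) (t t' : @tile R) : fn := fun T1 T2 =>
  if `[< Vset P t t' (T1, T2) >] then 1 else 0.

Definition generators : set fn :=
  [set f : fn | exists k P t t',
     [/\ exists2 T', discrete_hull T T' & is_patch_of P T', P t, P t' &
         f = fn_mul (fn_zpow k) (fn_e P t t')]].

End Algebra.

Section Assumptions.
Context {R : realType}.
Variables (T : set (@tile R)) (n : nat) (p : 'I_n -> set 'cV[R]_2).

Definition prototiles_of : Prop :=
  forall T' t, hull T T' -> T' t -> exists g i, t = act_tile g (proto p i).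

Definition trivial_symmetry : Prop :=
  forall i g, act_tile g (proto p i) = proto p i -> g.1 = 0 /\ rotation g.2 = 1%:M.

Definition inequivalent_prototiles : Prop :=
  forall i j g, act_tile g (proto p i) = proto p j -> i = j.

Definition full_isometry_group : Prop :=
  forall g i, exists2 T', hull T T' & T' (act_tile g (proto p i)).

Definition finite_local_complexity : Prop :=
  forall r : R, 0 < r -> exists2 F : set (set (@tile R)), finite_set F &
    forall T' x, hull T T' ->
      exists2 Q, F Q & exists g, patch_in_ball T' x r = isometry_act g Q.

Definition strongly_aperiodic : Prop :=
  forall T' x, hull T T' -> x != 0 -> translate T' x <> T'.

End Assumptions.

(* Main.v *)
Require Import Defs.
From HB Require Import structures.
From mathcomp Require Import all_boot all_order all_algebra.
From mathcomp Require Import all_classical all_reals all_analysis.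
From mathcomp Require Import ring lra.

(** Turn every tiling of the discrete hull so that its central tile is a
    proto-tile in standard position. An element of the equivalence relation is
    then given by a normalised tiling, a normalised displacement and an angle,
    and e(P, t, t') becomes the indicator of the pairs whose normalised tiling
    contains a fixed patch Q and whose normalised displacement is a fixed vector w.
    Two elements are close when their normalised tilings agree on a large ball,
    their normalised displacements are equal and their angles are close; finite
    local complexity leaves finitely many normalised patches of each radius, so
    ultrafilter limits exist and the set of fixed normalised displacement is
    compact. A product of two indicators is the indicator of a union of two
    patches (or zero), and commuting z past it costs a scalar, which gives the
    *-algebra structure.

    For density, a compactly supported f has bounded displacement and is uniformly
    continuous, so on each of the finitely many classes of equal large normalised
    patch and equal normalised displacement it is nearly a function of the angle,
    which is approximated by a trigonometric polynomial. As displacements are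
    bounded, the Schur test turns uniform closeness into closeness for the reduced
    norm. The norm is handled through the compressions of f to finite subsets of
    the equivalence classes. *)

Set Implicit Arguments.
Unset Strict Implicit.
Unset Printing Implicit Defensive.

Import Order.TTheory GRing.Theory Num.Theory.
Import numFieldNormedType.Exports.

Local Open Scope classical_set_scope.
Local Open Scope ring_scope.

(** * The Euclidean plane and its isometries *)

(** The number [central_angle] is an arbitrary choice modulo 2π and may jump, so closeness of
    central angles is measured on [rotation], and z is written through the periodic [ez]. Trivial
    symmetry and inequivalence of the proto-tiles make the frame of a tile (translation part and
    rotation matrix) unique, so that angles can be read off from tiles. Aperiodicity turns the
    displacement into a function of the pair, and the uniform separation of punctures makes the
    normalised displacement locally constant; hence the indicators are continuous.

    Compression to a finite set is not multiplicative. A finite set is therefore enlarged by the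
    rows that start in it, which are finite for functions of bounded displacement. This property,
    unlike continuity, passes visibly to convolutions, and it carries all norm estimates.

    The trigonometric polynomials come from a nonnegative kernel summed at equidistant nodes. The
    quadrature is exact for the kernel, so no integral occurs, and a polynomial lower bound for its
    mass is enough against geometric decay away from the diagonal. *)

Section Plane.
Context {R : realType}.
Local Notation plane := 'cV[R]_2.
Implicit Types (u v w x y : plane) (a b c r : R).

Lemma frobenius2 v : frobenius v = Num.sqrt (v 0 0 ^+ 2 + v 1 0 ^+ 2).
Proof.
by rewrite /frobenius big_ord_recl big_ord1 !big_ord1;
  congr (Num.sqrt (v _ _ ^+ 2 + v _ _ ^+ 2)); apply/val_inj.
Qed.

Lemma frobenius_ge0 m n (A : 'M[R]_(m, n)) : 0 <= frobenius A.
Proof. exact: sqrtr_ge0. Qed.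

Lemma sqr_frobenius2 v : frobenius v ^+ 2 = v 0 0 ^+ 2 + v 1 0 ^+ 2.
Proof. by rewrite frobenius2 sqr_sqrtr// addr_ge0 ?sqr_ge0. Qed.

Lemma frobenius0 m n : frobenius (0 : 'M[R]_(m, n)) = 0.
Proof.
by rewrite /frobenius big1 ?sqrtr0// => i _; rewrite big1// => j _; rewrite mxE expr0n.
Qed.

Lemma frobeniusN m n (A : 'M[R]_(m, n)) : frobenius (- A) = frobenius A.
Proof.
by congr Num.sqrt; apply: eq_bigr => i _; apply: eq_bigr => j _; rewrite mxE sqrrN.
Qed.

Lemma frobeniusB m n (A B : 'M[R]_(m, n)) : frobenius (A - B) = frobenius (B - A).
Proof. by rewrite -frobeniusN opprB. Qed.

Lemma frobenius_triangle v w : frobenius (v + w) <= frobenius v + frobenius w.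
Proof.
rewrite -(@ler_pXn2r _ 2)// ?nnegrE ?addr_ge0 ?frobenius_ge0//.
rewrite sqrrD !sqr_frobenius2 !mxE.
set p := frobenius v; set q := frobenius w.
have pq : p * q = Num.sqrt ((v 0 0 ^+ 2 + v 1 0 ^+ 2) * (w 0 0 ^+ 2 + w 1 0 ^+ 2)).
  by rewrite sqrtrM ?addr_ge0 ?sqr_ge0// -!frobenius2.
suff : v 0 0 * w 0 0 + v 1 0 * w 1 0 <= p * q by lra.
rewrite pq; apply: (le_trans (ler_norm _)); rewrite -sqrtr_sqr ler_wsqrtr//.
rewrite -subr_ge0.
have -> : (v 0 0 ^+ 2 + v 1 0 ^+ 2) * (w 0 0 ^+ 2 + w 1 0 ^+ 2) -
   (v 0 0 * w 0 0 + v 1 0 * w 1 0) ^+ 2 = (v 0 0 * w 1 0 - v 1 0 * w 0 0) ^+ 2 by ring.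
exact: sqr_ge0.
Qed.

Lemma rotation_vec a v :
  ((rotation a *m v) 0 0 = cos a * v 0 0 - sin a * v 1 0) *
  ((rotation a *m v) 1 0 = sin a * v 0 0 + cos a * v 1 0).
Proof.
by split; rewrite mxE big_ord_recl big_ord1 !mxE/= ?mulNr;
  congr (_ + _); rewrite -?mulNr; congr (_ * v _ _); apply/val_inj.
Qed.

Lemma rotation_eq a b : cos a = cos b -> sin a = sin b -> rotation a = rotation b.
Proof. by move=> hc hs; apply/matrixP => i j; rewrite !mxE hc hs. Qed.

Lemma rotation_inj a b : rotation a = rotation b -> cos a = cos b /\ sin a = sin b.
Proof.
move=> /matrixP h; split; first by move: (h 0 0); rewrite !mxE.
by move: (h 1 0); rewrite !mxE.
Qed.

Lemma rotationD a b : rotation (a + b) = rotation a *m rotation b.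
Proof.
apply/matrixP => i j; rewrite mxE [RHS]mxE big_ord_recl big_ord1 !mxE cosD sinD.
case: i => -[|[|//]]//= ?; case: j => -[|[|//]]//= ?; ring.
Qed.

Lemma rotation0 : rotation (0 : R) = 1%:M.
Proof.
apply/matrixP => i j; rewrite !mxE cos0 sin0 oppr0.
by case: eqP => //= _; case: ifP.
Qed.

Lemma rotationDv a b v : rotation (a + b) *m v = rotation a *m (rotation b *m v).
Proof. by rewrite rotationD mulmxA. Qed.

Lemma rotation0v v : rotation 0 *m v = v.
Proof. by rewrite rotation0 mul1mx. Qed.

Lemma rotationNK a v : rotation (- a) *m (rotation a *m v) = v.
Proof. by rewrite -rotationDv addNr rotation0v. Qed.

Lemma rotationKN a v : rotation a *m (rotation (- a) *m v) = v.
Proof. by rewrite -rotationDv addrN rotation0v. Qed.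

Lemma rotation_opp a b : rotation a = rotation b -> rotation (- a) = rotation (- b).
Proof. by move=> /rotation_inj[hc hs]; apply: rotation_eq; rewrite ?cosN ?sinN ?hc ?hs. Qed.

Lemma frobenius_rotation a v : frobenius (rotation a *m v) = frobenius v.
Proof.
rewrite !frobenius2 !rotation_vec; congr Num.sqrt.
have := cos2Dsin2 a; set c := cos a; set s := sin a => h.
transitivity ((c ^+ 2 + s ^+ 2) * (v 0 0 ^+ 2 + v 1 0 ^+ 2)); first by ring.
by rewrite h mul1r.
Qed.

Lemma frobenius_rotationB a b :
  frobenius (rotation a - rotation b) =
  Num.sqrt 2 * Num.sqrt ((cos a - cos b) ^+ 2 + (sin a - sin b) ^+ 2).
Proof.
rewrite -sqrtrM// /frobenius; congr Num.sqrt.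
rewrite !big_ord_recl !big_ord0 !mxE/=; ring.
Qed.

Lemma frobenius_rotationB_vec a b v :
  Num.sqrt 2 * frobenius (rotation a *m v - rotation b *m v) =
  frobenius (rotation a - rotation b) * frobenius v.
Proof.
rewrite frobenius_rotationB -mulrA; congr (_ * _).
rewrite !frobenius2 -sqrtrM ?addr_ge0 ?sqr_ge0//; congr Num.sqrt.
rewrite [X in X ^+ 2 + _]mxE [X in _ + X ^+ 2]mxE.
rewrite [(- (rotation b *m v)) 0 0]mxE [(- (rotation b *m v)) 1 0]mxE !rotation_vec; ring.
Qed.

(** A difference of two plane rotations is a scalar multiple of a rotation, so it stretches all
    vectors equally. Its Frobenius norm is √2 times that factor. *)
Lemma frobenius_rotationB_le a b v :
  frobenius (rotation a *m v - rotation b *m v) <=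
  frobenius (rotation a - rotation b) * frobenius v.
Proof.
rewrite -frobenius_rotationB_vec -[leLHS]mul1r ler_wpM2r ?frobenius_ge0//.
by rewrite -[leLHS]sqrtr1 ler_wsqrtr// ler1n.
Qed.

(** Evaluation at a unit vector reduces this to the triangle inequality for vectors, by
    [frobenius_rotationB_vec]. *)
Lemma rotation_triangle a b c : frobenius (rotation a - rotation c) <=
  frobenius (rotation a - rotation b) + frobenius (rotation b - rotation c).
Proof.
pose e : plane := \col_i (i == 0)%:R.
have e1 : frobenius e = 1 by rewrite frobenius2 !mxE/= expr0n addr0 expr1n sqrtr1.
have E s t : frobenius (rotation s - rotation t) =
    Num.sqrt 2 * frobenius (rotation s *m e - rotation t *m e).
  by rewrite frobenius_rotationB_vec e1 mulr1.
rewrite !E -mulrDr ler_wpM2l ?sqrtr_ge0//.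
apply: le_trans (frobenius_triangle _ _); rewrite le_eqVlt; apply/orP; left; apply/eqP.
by congr frobenius; rewrite addrA subrK.
Qed.

Lemma rotation_shift a b c :
  frobenius (rotation (a + c) - rotation (b + c)) = frobenius (rotation a - rotation b).
Proof.
rewrite !frobenius_rotationB; congr (_ * Num.sqrt _); rewrite !cosD !sinD.
have := cos2Dsin2 c; move: (cos c) (sin c) (cos a) (cos b) (sin a) (sin b) => x y p q s t h.
transitivity ((x ^+ 2 + y ^+ 2) * ((p - q) ^+ 2 + (s - t) ^+ 2)); first by ring.
by rewrite h mul1r.
Qed.

Lemma rotation_angle (z1 z2 : R) : z1 ^+ 2 + z2 ^+ 2 = 1 ->
  exists2 a, - pi <= a <= pi & cos a = z1 /\ sin a = z2.
Proof.
move=> h; have hz : -1 <= z1 <= 1 by apply/andP; split; nra.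
have p0 := acos_ge0 hz; have p1 := acos_lepi hz.
have s1 : Num.sqrt (1 - z1 ^+ 2) = `|z2| by rewrite -h addrAC subrr add0r sqrtr_sqr.
have [z20|z20] := leP 0 z2.
  exists (acos z1); first by rewrite p1 andbT (le_trans _ p0)// oppr_le0 pi_ge0.
  by rewrite acosK// sin_acos// s1 ger0_norm.
exists (- acos z1); first by rewrite lerN2 p1/= (le_trans _ (pi_ge0 _))// oppr_le0.
by rewrite cosN acosK// sinN sin_acos// s1 ltr0_norm// opprK.
Qed.

(** The topology on matrices comes from the sup norm, whereas isometries preserve Euclidean balls.
    This passes between the two. *)
Lemma nbhs_eball x (S : set plane) :
  nbhs x S <-> exists2 r, 0 < r & eball x r `<=` S.
Proof.
split=> [/nbhs_ballP[e /= e0 xeS]|[r r0 xrS]].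
  exists e => // y yr; apply: xeS; split=> // i j.
  rewrite /ball/= distrC (_ : y i j - x i j = (y - x) i j); last by rewrite !mxE.
  apply: le_lt_trans yr; rewrite -sqrtr_sqr /eball/=; apply: ler_wsqrtr.
  rewrite (bigD1 i)//= (bigD1 j)//= -addrA lerDl addr_ge0// ?sumr_ge0// => k _.
    exact: sqr_ge0.
  by rewrite sumr_ge0// => l _; exact: sqr_ge0.
(* The Euclidean norm is at most √2 times the sup norm, and √2 / 2 < 1. *)
apply/nbhs_ballP; exists (r / 2) => /=; first by rewrite divr_gt0.
move=> y [_ xy]; apply: xrS; rewrite /eball/= frobenius2 !mxE.
have h i : `|y i 0 - x i 0| < r / 2 by rewrite distrC; exact: xy.
have /ltr_normlP[h1 h2] := h 0; have /ltr_normlP[h3 h4] := h 1.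
rewrite -(gtr0_norm r0) -sqrtr_sqr ltr_sqrt ?exprn_gt0//.
move: h1 h2 h3 h4; move: (y 0 0 - x 0 0) (y 1 0 - x 1 0) => s t; nra.
Qed.

Lemma eball_center x r : 0 < r -> eball x r x.
Proof. by move=> r0; rewrite /eball/= subrr frobenius0. Qed.

Lemma open_eball x y r : eball x r y -> nbhs y (eball x r).
Proof.
move=> xy; apply/nbhs_eball; exists (r - frobenius (y - x)); first by rewrite subr_gt0.
move=> z; rewrite /eball/= ltrBrDr => h; apply: le_lt_trans h.
by rewrite (le_trans _ (frobenius_triangle _ _))// addrA subrK.
Qed.

(** The translation acts before the rotation, as in [isometry_act]. This is why translation parts
    are rotated in [isom_inv] and [isom_comp]. *)
Definition isom (g : plane * R) (y : plane) : plane := rotation g.2 *m (y + g.1).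
Definition isom_inv (g : plane * R) : plane * R := (- (rotation g.2 *m g.1), - g.2).
Definition isom_comp (g h : plane * R) : plane * R :=
  (h.1 + rotation (- h.2) *m g.1, g.2 + h.2).

Lemma isom_compE g h y : isom g (isom h y) = isom (isom_comp g h) y.
Proof.
by rewrite /isom/= rotationDv; congr (_ *m _); rewrite addrA [RHS]mulmxDr rotationKN.
Qed.

Lemma isomK g : cancel (isom g) (isom (isom_inv g)).
Proof. by move=> y; rewrite /isom/= mulmxBr !rotationNK addrK. Qed.

Lemma isomVK g : cancel (isom (isom_inv g)) (isom g).
Proof. by move=> y; rewrite /isom/= mulmxDr rotationKN subrK. Qed.

Lemma isom_invK g : isom_inv (isom_inv g) = g.
Proof. by case: g => x a; rewrite /isom_inv/= mulmxN rotationNK !opprK. Qed.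

Lemma isomB g x y : isom g x - isom g y = rotation g.2 *m (x - y).
Proof. by rewrite /isom -mulmxBr opprD addrACA subrr addr0. Qed.

Lemma isom_dist g x y : frobenius (isom g x - isom g y) = frobenius (x - y).
Proof. by rewrite isomB frobenius_rotation. Qed.

Lemma isom_image_eball g x r : isom g @` eball x r = eball (isom g x) r.
Proof.
apply/seteqP; split=> [_ [y xy <-]|y xy]; first by rewrite /eball/= isom_dist.
exists (isom (isom_inv g) y); last by rewrite isomVK.
by rewrite /eball/= -(isom_dist g) isomVK.
Qed.

Lemma nbhs_isom g x (S : set plane) : nbhs (isom g x) (isom g @` S) <-> nbhs x S.
Proof.
split=> /nbhs_eball[r r0 h]; apply/nbhs_eball; exists r => //.
  move=> y xy; have /h[z Sz] : eball (isom g x) r (isom g y) by rewrite /eball/= isom_dist.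
  by move=> /(can_inj (isomK g)) <-.
by rewrite -isom_image_eball; exact: image_subset.
Qed.

Lemma interior_isom g (S : set plane) : interior (isom g @` S) = isom g @` interior S.
Proof.
apply/seteqP; split=> [y|_ [x Sx <-]]; last by apply/nbhs_isom.
rewrite -{1}(isomVK g y) => /nbhs_isom h; exists (isom (isom_inv g) y) => //.
exact: isomVK.
Qed.

Lemma closure_isom g (S : set plane) : closure (isom g @` S) = isom g @` closure S.
Proof.
apply/seteqP; split=> [y cy|_ [x cx <-] B nB].
  exists (isom (isom_inv g) y); last exact: isomVK.
  move=> B nB; have [|_ [[z Sz <-]]] := cy (isom g @` B).
    by rewrite -{1}(isomVK g y); apply/nbhs_isom.
  by move=> [z' Bz' /(can_inj (isomK g)) e]; exists z; split=> //; rewrite -e.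
have [|z [Sz [w Bw e]]] := cx (isom (isom_inv g) @` B).
  by rewrite -(isomK g x); apply/nbhs_isom.
exists w; split=> //; exists z => //; by rewrite -e isomVK.
Qed.

Lemma segment_isom g (a b : plane) y :
  segment (isom g a) (isom g b) (isom g y) <-> segment a b y.
Proof.
have E s : isom g (a + s *: (b - a)) = isom g a + s *: (isom g b - isom g a).
  by rewrite isomB scalemxAr /isom -mulmxDr addrAC.
split=> -[s s01].
  by rewrite -E => /(can_inj (isomK g)) ->; exists s.
by move=> ->; exists s.
Qed.

Lemma closed_polygon_isom g (S : set plane) :
  closed_polygon S -> closed_polygon (isom g @` S).
Proof.
move=> [[r Sr] cS [n [v [[n3 vi vs] bS]]]]; split.
- exists (frobenius (isom g 0) + r) => _ [y /Sr yr <-]; rewrite /eball/= subr0.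
  have -> : isom g y = isom g 0 + (isom g y - isom g 0) by rewrite addrC subrK.
  apply: le_lt_trans (frobenius_triangle _ _) _.
  by rewrite isom_dist ltrD2l.
- by rewrite interior_isom closure_isom cS.
exists n, (isom g \o v); split; first split=> //.
- by move=> i j /(can_inj (isomK g)) /vi.
- move=> i j y ij; rewrite -(isomVK g y) => /segment_isom h1 /segment_isom h2.
  by have [[-> ->]|[-> ->]] := vs _ _ _ ij h1 h2; [left|right].
rewrite interior_isom; apply/seteqP; split=> [_ [[y Sy <-] nI]|y [i _]].
  have : (S `\` interior S) y by split=> // Iy; apply: nI; exists y.
  by rewrite bS => -[i _ h]; exists i => //; apply/segment_isom.
rewrite -(isomVK g y) => /segment_isom h.
have [Sy nI] : (S `\` interior S) (isom (isom_inv g) y) by rewrite bS; exists i.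
split; first by exists (isom (isom_inv g) y).
by move=> [z Iz /(can_inj (isomK g)) e]; apply: nI; rewrite -e.
Qed.

End Plane.

(** * Tiles and tilings *)

Section Tiles.
Context {R : realType}.
Local Notation plane := 'cV[R]_2.
Implicit Types (t u : @tile R) (P Q : set (@tile R)) (g h : plane * R) (x y : plane) (r : R).

Lemma act_tileE g t : act_tile g t = tile_map (isom g) t.
Proof. by rewrite /act_tile /tile_map/= image_comp. Qed.

Lemma isometry_actE g P : isometry_act g P = act_tile g @` P.
Proof. by rewrite /isometry_act /rotate /translate image_comp. Qed.

Lemma puncture_act g t : puncture (act_tile g t) = isom g (puncture t).
Proof. by []. Qed.

Lemma support_act g t : tile_support (act_tile g t) = isom g @` tile_support t.
Proof. by rewrite act_tileE. Qed.

Lemma act_tile_comp g h t : act_tile g (act_tile h t) = act_tile (isom_comp g h) t.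
Proof.
rewrite !act_tileE /tile_map/= image_comp isom_compE; congr pair.
by apply: eq_imagel => y _ /=; rewrite isom_compE.
Qed.

Lemma act_tileK g : cancel (act_tile g) (act_tile (isom_inv g)).
Proof.
move=> [S x]; rewrite !act_tileE /tile_map/= isomK image_comp; congr pair.
by rewrite -[RHS]image_id; apply: eq_imagel => y _ /=; rewrite isomK.
Qed.

Lemma act_tileVK g : cancel (act_tile (isom_inv g)) (act_tile g).
Proof.
move=> [S x]; rewrite !act_tileE /tile_map/= isomVK image_comp; congr pair.
by rewrite -[RHS]image_id; apply: eq_imagel => y _ /=; rewrite isomVK.
Qed.

Lemma act_tile_eq g h t : g.1 = h.1 -> rotation g.2 = rotation h.2 ->
  act_tile g t = act_tile h t.
Proof. by rewrite /act_tile => -> ->. Qed.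

Lemma isometry_act_eq g h P : g.1 = h.1 -> rotation g.2 = rotation h.2 ->
  isometry_act g P = isometry_act h P.
Proof. by rewrite /isometry_act /rotate => -> ->. Qed.

Lemma isometry_act_comp g h P :
  isometry_act g (isometry_act h P) = isometry_act (isom_comp g h) P.
Proof.
by rewrite !isometry_actE image_comp; apply: eq_imagel => t _ /=; exact: act_tile_comp.
Qed.

Lemma isometry_actP g P t : isometry_act g P t <-> P (act_tile (isom_inv g) t).
Proof.
rewrite isometry_actE; split=> [[u Pu <-]|Pt]; first by rewrite act_tileK.
by exists (act_tile (isom_inv g) t) => //; rewrite act_tileVK.
Qed.

Lemma isometry_act_tile g P t : isometry_act g P (act_tile g t) <-> P t.
Proof. by rewrite isometry_actP act_tileK. Qed.

Lemma isometry_actK g P : isometry_act (isom_inv g) (isometry_act g P) = P.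
Proof.
rewrite isometry_actE; apply/seteqP; split=> [_ [t /isometry_actP Pt <-]//|t Pt].
by exists (act_tile g t); [exact/isometry_act_tile | exact: act_tileK].
Qed.

Lemma isometry_actVK g P : isometry_act g (isometry_act (isom_inv g) P) = P.
Proof.
apply/seteqP; split=> t; first by move=> /isometry_actP/isometry_act_tile.
by move=> Pt; apply/isometry_actP/isometry_act_tile.
Qed.

Lemma isometry_act_subset g P Q : P `<=` Q -> isometry_act g P `<=` isometry_act g Q.
Proof. by move=> PQ; rewrite !isometry_actE; exact: image_subset. Qed.

Lemma isometry_act_finite g P : finite_set P -> finite_set (isometry_act g P).
Proof. by move=> fP; rewrite isometry_actE; exact: finite_image. Qed.

Lemma translateE P x : translate P x = isometry_act (x, 0) P.
Proof.
rewrite isometry_actE /translate; apply: eq_imagel => t _.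
rewrite /act_tile/= rotation0 /tile_map/= mul1mx; congr pair.
by rewrite -[LHS]image_id; apply: eq_imagel => y _; rewrite mul1mx.
Qed.

Lemma rotateE P (a : R) : rotate a P = isometry_act (0, a) P.
Proof.
rewrite isometry_actE /rotate; apply: eq_imagel => -[S y] _.
rewrite /act_tile/= /tile_map/= addr0; congr pair.
by rewrite image_comp; apply: eq_imagel => z _ /=; rewrite addr0.
Qed.

Lemma translateD P x y : translate (translate P x) y = translate P (x + y).
Proof.
rewrite !translateE isometry_act_comp; apply: isometry_act_eq => //=; last by rewrite addr0.
by rewrite oppr0 rotation0v.
Qed.

Lemma translate0 P : translate P 0 = P.
Proof.
rewrite translateE isometry_actE -[RHS]image_id; apply: eq_imagel => -[S y] _.
rewrite act_tileE /tile_map/= /isom/= addr0 rotation0v; congr pair.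
by rewrite -[RHS]image_id; apply: eq_imagel => z _; rewrite /isom/= addr0 rotation0v.
Qed.

Definition agree r P Q := forall t, tile_support t `<=` eball 0 r -> P t <-> Q t.

Lemma agreeP r P Q : agree r P Q <-> patch_in_ball P 0 r = patch_in_ball Q 0 r.
Proof.
split=> [h|e t tr]; last first.
  by split=> h; [have : patch_in_ball P 0 r t by []|have : patch_in_ball Q 0 r t by []];
    [rewrite e|rewrite -e]; case.
by apply/seteqP; split=> t [tP tr]; split=> //; apply/(h t tr).
Qed.

Lemma agree_sym r P Q : agree r P Q -> agree r Q P.
Proof. by move=> h t /h []. Qed.

Lemma agree_trans r P Q S : agree r P Q -> agree r Q S -> agree r P S.
Proof. by move=> h1 h2 t tr; rewrite h1// h2. Qed.

Lemma eball_subset x r r' : r <= r' -> eball x r `<=` eball x r'.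
Proof. by move=> rr y; rewrite /eball/= => /lt_le_trans; apply. Qed.

Lemma agree_le r r' P Q : r' <= r -> agree r P Q -> agree r' P Q.
Proof. by move=> rr h t tr; apply: h; apply: subset_trans tr (eball_subset rr). Qed.

(** Pulling a tile back along [g] moves it away from the origin by at most the length of [g.1]; the
    rotation costs nothing. *)
Lemma agree_isom g r r' P Q : r' + frobenius g.1 <= r -> agree r P Q ->
  agree r' (isometry_act g P) (isometry_act g Q).
Proof.
move=> rr h t tr; rewrite !isometry_actP; apply: h.
rewrite support_act => _ [y /tr yr <-]; rewrite /eball/= subr0 /isom/= mulmxBr rotationNK.
apply: lt_le_trans rr; apply: le_lt_trans (frobenius_triangle _ _) _.
by rewrite frobeniusN frobenius_rotation ltrD2r; move: yr; rewrite /eball/= subr0.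
Qed.

Lemma agree_rotate (a : R) r P Q : agree r P Q ->
  agree r (isometry_act (0, a) P) (isometry_act (0, a) Q).
Proof. by apply: agree_isom; rewrite /= frobenius0 addr0. Qed.

Lemma tiling_dist_lt P Q e : tiling_dist P Q < e -> e <= 1 ->
  exists2 d : R, 0 < d < e & Defs.within d P Q.
Proof.
rewrite /tiling_dist; case: ifPn => [/asboolP A0 lte _|_ /lt_le_trans h /h]; last by rewrite ltxx.
have [d [/andP[d0 d1] wd] de] := inf_lt A0 lte.
by exists d => //; rewrite d0.
Qed.

Lemma tiling_dist_le P Q e : 0 < e < 1 -> Defs.within e P Q -> tiling_dist P Q <= e.
Proof.
move=> e01 w; rewrite /tiling_dist; case: ifPn => [_|/asboolP[]]; last by exists e.
by apply: ge_inf => //; exists 0 => d [/andP[/ltW]].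
Qed.

Lemma tiling_dist_ge0 P Q : 0 <= tiling_dist P Q.
Proof.
rewrite /tiling_dist; case: ifPn => [/asboolP A0|_]; last exact: ler01.
by apply: lb_le_inf => // d [/andP[/ltW]].
Qed.

(** A polygon is the closure of its interior, so a point of [u] inside [t] is approached by interior
    points of [u], and the two interiors meet. *)
Lemma tile_overlap P t u : is_tiling P -> P t -> P u ->
  interior (tile_support t) `&` tile_support u !=set0 -> t = u.
Proof.
move=> [_ cP _ iP] Pt Pu [x [tx ux]]; apply: contrapT => /(iP _ _ Pt Pu) tu0.
have [_ cu _] := cP _ Pu.
move: ux; rewrite -cu => /(_ _ (nbhs_interior tx)).
by rewrite setIC tu0 => -[].
Qed.

Lemma tiling_cover P x : is_tiling P -> exists2 t, P t & tile_support t x.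
Proof. by case=> _ _ cP _; have : [set: plane] x by []; rewrite -cP => -[t]; exists t. Qed.

Lemma is_tiling_act g P : is_tiling P -> is_tiling (isometry_act g P).
Proof.
move=> [cP pP vP iP]; rewrite isometry_actE; split.
- exact: sub_countable (card_image_le _ _) _.
- by move=> _ [t Pt <-]; rewrite support_act; apply/closed_polygon_isom/pP.
- apply/seteqP; split=> // x _.
  have : [set: plane] (isom (isom_inv g) x) by [].
  rewrite -vP => -[t Pt tx]; exists (act_tile g t); first by exists t.
  by rewrite support_act; exists (isom (isom_inv g) x) => //; exact: isomVK.
move=> _ _ [t Pt <-] [u Pu <-] tu; rewrite !support_act !interior_isom.
rewrite -subset0 => _ [[y ty <-] [z uz /(can_inj (isomK g)) e]].
have : (interior (tile_support t) `&` interior (tile_support u)) y by split=> //; rewrite -e.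
by rewrite iP// => e'; apply: tu; rewrite e'.
Qed.

Definition hits r P : set (@tile R) := [set t | P t /\ tile_support t `&` eball 0 r !=set0].

(* The tiles meeting a ball cover it, so a tiling containing them has no other
   tile meeting that ball. *)
Lemma hits_tiling r P Q : is_tiling P -> is_tiling Q -> hits r P `<=` Q ->
  hits r P = hits r Q.
Proof.
move=> tP tQ PQ; apply/seteqP; split=> [t Pt|t [Qt [x [tx xr]]]].
  by split; [exact: PQ | case: Pt].
have [_ ct _] : closed_polygon (tile_support t) by case: tQ => _ + _ _; exact.
move: tx; rewrite -ct => /(_ _ (open_eball xr))[y [ty yr]].
have [u Pu uy] := tiling_cover y tP.
have Hu : hits r P u by split=> //; exists y.
by rewrite (tile_overlap tQ Qt (PQ _ Hu))//; exists y.
Qed.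

End Tiles.

Class standing {R : realType} (T : set (@tile R)) (n : nat) (p : 'I_n -> set 'cV[R]_2) : Prop :=
  Standing {
    std_n_gt0 : (0 < n)%N;
    std_polygon : forall i, closed_polygon (p i);
    std_puncture : forall i, interior (p i) 0;
    std_symmetry : trivial_symmetry p;
    std_inequivalent : inequivalent_prototiles p;
    std_prototiles : prototiles_of T p;
    std_full : full_isometry_group T p;
    std_flc : finite_local_complexity T;
    std_aperiodic : strongly_aperiodic T }.

(** * The hull and normalised tilings *)

Section Hull.
Context {R : realType} {T : set (@tile R)} {n : nat} {p : 'I_n -> set 'cV[R]_2}.
Context {std : standing T p}.
Local Notation plane := 'cV[R]_2.
Local Notation tile := (@tile R).
Implicit Types (t u : tile) (P Q : set tile) (g h : plane * R) (x y : plane) (r : R).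

Lemma hull_tiling P : hull T P -> is_tiling P.
Proof. by case. Qed.

Lemma hull_prototile P t : hull T P -> P t -> exists g i, t = act_tile g (proto p i).
Proof. exact: std_prototiles. Qed.

Lemma hull_translate P y : hull T P -> hull T (translate P y).
Proof.
move=> [tP cP]; split; first by rewrite translateE; exact: is_tiling_act.
move=> e e0; pose m := Num.min (e / 2) (2^-1).
have m0 : 0 < m by rewrite lt_min divr_gt0//= invr_gt0 ltr0n.
have m1 : m < 1 by rewrite gt_min; apply/orP; right; rewrite invf_lt1// ltr1n.
have me : m < e by rewrite gt_min ltr_pdivrMr// ltr_pMr// ltr1n.
(* Agreement is needed on a ball larger by the length of [y], since translating by [y] shifts the
   origin by that much. *)
pose d := Num.min m (m^-1 + frobenius y)^-1.
have y0 := frobenius_ge0 y.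
have my0 : 0 < m^-1 + frobenius y by rewrite ltr_wpDr// invr_gt0.
have d0 : 0 < d by rewrite lt_min m0 invr_gt0.
have d1 : d <= 1 by rewrite ge_min ltW.
have [z /tiling_dist_lt/(_ d1)[s /andP[s0 sd] [g [g' [gs g's /agreeP E]]]]] := cP d d0.
have sm : s < m by apply: lt_le_trans sd _; rewrite ge_min lexx.
have sy : m^-1 + frobenius y <= s^-1.
  rewrite -[leLHS]invrK lef_pV2 ?posrE ?invr_gt0//; apply: ltW.
  by apply: lt_le_trans sd _; rewrite ge_min lexx orbT.
(* Translating by [y] before [g] is translating by [rotation g.2 *m y] after it. Pulling that vector
   back through [g'] gives the translate of [T] to compare with. *)
exists (z + rotation (g.2 - g'.2) *m y).
apply: le_lt_trans me; apply: tiling_dist_le; first by rewrite m0.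
exists g, g'; split; [exact: lt_trans sm| exact: lt_trans sm|apply/agreeP].
pose k : plane * R := (rotation g.2 *m y, 0).
have kf : frobenius k.1 = frobenius y by rewrite frobenius_rotation.
rewrite (_ : isometry_act g _ = isometry_act k (isometry_act g P)); last first.
  rewrite translateE !isometry_act_comp; apply: isometry_act_eq => /=.
    by rewrite oppr0 rotation0v rotationNK addrC.
  by rewrite addr0 add0r.
rewrite (_ : isometry_act g' _ = isometry_act k (isometry_act g' (translate T z))); last first.
  rewrite !translateE !isometry_act_comp; apply: isometry_act_eq => /=.
    by rewrite oppr0 !rotation0v -rotationDv [- g'.2 + _]addrC -!addrA [g'.1 + _]addrC.
  by rewrite !addr0 add0r.
by apply: agree_isom E; rewrite kf.
Qed.

Lemma inradius : exists2 r, 0 < r &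
  forall P t, hull T P -> P t -> eball (puncture t) r `<=` interior (tile_support t).
Proof.
have /choice[f hf] : forall i, exists r, 0 < r /\ eball 0 r `<=` p i.
  move=> i; have /(nbhs_eball 0)[r r0 h] : nbhs (0 : plane) (p i) by exact: std_puncture.
  by exists r.
pose m := \big[Num.min/1]_(i < n) f i.
have m0 : 0 < m by apply: lt_bigmin => // i _; case: (hf i).
exists m => // P t hP Pt; have [g [i ->]] := hull_prototile hP Pt.
rewrite support_act interior_isom puncture_act -isom_image_eball.
apply: image_subset => y yr; apply/nbhs_eball.
have h : eball 0 (f i) y.
  by apply: eball_subset yr; apply: bigmin_le_cond.
have /nbhs_eball[d d0 hd] := open_eball h.
by exists d => // z /hd; case: (hf i) => _; exact.
Qed.

Lemma outradius : exists2 r, 0 < r &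
  forall P t, hull T P -> P t -> tile_support t `<=` eball (puncture t) r.
Proof.
have /choice[f hf] : forall i, exists r, p i `<=` eball 0 r.
  by move=> i; have [[r h] _ _] := std_polygon i; exists r.
pose m := \big[Num.max/1]_(i < n) f i.
have m0 : 1 <= m by exact: bigmax_ge_id.
exists m; first exact: lt_le_trans m0.
move=> P t hP Pt; have [g [i ->]] := hull_prototile hP Pt.
rewrite support_act puncture_act -isom_image_eball.
apply: image_subset => y /hf; apply: eball_subset; exact: le_bigmax_cond.
Qed.

Lemma puncture_interior P t : hull T P -> P t -> interior (tile_support t) (puncture t).
Proof.
have [r r0 h] := inradius => hP Pt; apply: h hP Pt _ _; exact: eball_center.
Qed.

Lemma puncture_support P t : hull T P -> P t -> tile_support t (puncture t).
Proof. by move=> hP Pt; exact: interior_subset (puncture_interior hP Pt). Qed.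

(** A puncture closer than the common inradius to another one lies in the interior of the other
    tile. *)
Lemma puncture_separated : exists2 r, 0 < r & forall P t u, hull T P -> P t -> P u ->
  frobenius (puncture t - puncture u) < r -> t = u.
Proof.
have [r r0 h] := inradius; exists r => // P t u hP Pt Pu tu.
apply: (tile_overlap (hull_tiling hP) Pt Pu); exists (puncture u); split.
  by apply: h hP Pt _ _; rewrite /eball/= frobeniusB.
exact: puncture_support hP Pu.
Qed.

Lemma puncture_inj P t u : hull T P -> P t -> P u -> puncture t = puncture u -> t = u.
Proof.
have [r r0 h] := puncture_separated => hP Pt Pu e; apply: (h _ _ _ hP Pt Pu).
by rewrite e subrr frobenius0.
Qed.

(** The composite of one isometry with the inverse of the other is a symmetry of a proto-tile.
    Angles are recovered only modulo 2π, hence the conclusion on [rotation]. *)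
Lemma proto_act_inj g h i j : act_tile g (proto p i) = act_tile h (proto p j) ->
  [/\ i = j, g.1 = h.1 & rotation g.2 = rotation h.2].
Proof.
move=> /(congr1 (act_tile (isom_inv h))); rewrite act_tileK act_tile_comp => e.
have ij : i = j by exact: std_inequivalent e.
rewrite -ij in e.
have [/= e1 e2] := std_symmetry e.
have e3 : rotation g.2 = rotation h.2.
  by rewrite -[g.2](addNKr h.2) rotationD e2 mulmx1.
split=> //; apply/eqP; rewrite -subr_eq0; apply/eqP; rewrite -[RHS]e1 mulmxN.
by rewrite -e3 rotationNK.
Qed.

Local Notation dh := (discrete_hull T).
Local Notation al := (central_angle p).

(** The origin is a puncture, hence interior to its tile, so the choice in [central_tile] is forced.
    An isometry taking puncture 0 to puncture 0 is a pure rotation, so the default angle is never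
    taken. *)
Lemma central_tileP P : dh P ->
  [/\ P (central_tile P), puncture (central_tile P) = 0 &
      exists i, central_tile P = act_tile (0, al P) (proto p i)].
Proof.
move=> [hP [t Pt t0]].
have [g [i e]] := hull_prototile hP Pt.
have t00 : tile_support t 0 by rewrite -t0; exact: puncture_support hP Pt.
have tc : central_tile P = t.
  apply: xget_unique; first by split.
  move=> u [Pu u0]; apply/esym; apply: (tile_overlap (hull_tiling hP) Pt Pu).
  by exists 0; split=> //; rewrite -t0; exact: puncture_interior hP Pt.
rewrite tc; split=> //.
have g0 : g.1 = 0.
  have : rotation g.2 *m g.1 = 0 by rewrite -t0 e puncture_act /isom add0r.
  by move=> /(congr1 (mulmx (rotation (- g.2)))); rewrite rotationNK mulmx0.
rewrite /central_angle; case: xgetP => [a _ [j]|/(_ g.2)].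
  by rewrite tc => ->; exists j.
by case; exists i; rewrite tc e; apply: act_tile_eq.
Qed.

Lemma central_angle_unique P a i : dh P -> P (act_tile (0, a) (proto p i)) ->
  rotation a = rotation (al P).
Proof.
move=> dP Pa; have [Pc c0 [j e]] := central_tileP dP; have [hP _] := dP.
suff /proto_act_inj[_ _ //] : act_tile (0, a) (proto p i) = act_tile (0, al P) (proto p j).
by rewrite -e; apply: (puncture_inj hP) => //; rewrite c0 puncture_act /isom add0r mulmx0.
Qed.

Definition nrm P : set tile := isometry_act (0, - al P) P.

Lemma nrmP P t : nrm P t <-> P (act_tile (0, al P) t).
Proof.
rewrite /nrm isometry_actP (_ : act_tile _ t = act_tile (0, al P) t)//.
by apply: act_tile_eq => /=; rewrite ?mulmx0 ?oppr0 ?opprK.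
Qed.

Lemma nrmVE P : P = isometry_act (0, al P) (nrm P).
Proof.
rewrite -[LHS](isometry_actVK (0, al P)); congr isometry_act.
by apply: isometry_act_eq; rewrite //= mulmx0 oppr0.
Qed.

Lemma nrm_tiling P : hull T P -> is_tiling (nrm P).
Proof. by move=> hP; apply/is_tiling_act/hull_tiling. Qed.

Lemma nrm_central P : dh P -> exists i, nrm P (proto p i).
Proof. by move=> dP; have [Pc _ [i e]] := central_tileP dP; exists i; apply/nrmP; rewrite -e. Qed.

Lemma isom_rot (a : R) x : isom (0, a) x = rotation a *m x.
Proof. by rewrite /isom addr0. Qed.

Lemma nrm_outradius : exists2 r, 0 < r & forall P t, hull T P -> nrm P t ->
  tile_support t `<=` eball (puncture t) r.
Proof.
have [r r0 h] := outradius; exists r => // P t hP /nrmP Pt y ty.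
have /(h _ _ hP Pt) : tile_support (act_tile (0, al P) t) (isom (0, al P) y).
  by rewrite support_act; exists y.
by rewrite puncture_act /eball/= isom_dist.
Qed.

Lemma nrm_puncture_support P t : hull T P -> nrm P t -> tile_support t (puncture t).
Proof.
move=> hP /nrmP Pt; have := puncture_support hP Pt.
by rewrite support_act puncture_act => -[y ty /(can_inj (isomK _)) <-].
Qed.

(** Two vectors giving the same translate would differ by a period. *)
Lemma displacementE P t : hull T P -> P t ->
  displacement (P, translate P (- puncture t)) = puncture t.
Proof.
move=> hP Pt; apply: xget_unique; first by exists t.
move=> y [u [/= Pu -> e]]; apply/eqP; rewrite -subr_eq0; apply: contraT => uy0.
exfalso; apply: (std_aperiodic hP uy0).
by rewrite addrC -translateD e translateD addNr translate0.
Qed.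

Lemma RpuncP P Q : Rpunc T (P, Q) <->
  exists t, [/\ dh P, P t, displacement (P, Q) = puncture t & Q = translate P (- puncture t)].
Proof.
split=> [[/= dP [t Pt e]]|[t [dP Pt _ ->]]]; last by split=> //; exists t.
by exists t; rewrite e; split=> //; apply: displacementE => //; case: dP.
Qed.

Lemma dh_translate P t : dh P -> P t -> dh (translate P (- puncture t)).
Proof.
move=> [hP _] Pt; split; first exact: hull_translate.
exists (act_tile (- puncture t, 0) t); first by rewrite translateE; exact/isometry_act_tile.
by rewrite puncture_act /isom subrr mulmx0.
Qed.

Lemma Rpunc_dh1 P Q : Rpunc T (P, Q) -> dh P.
Proof. by case. Qed.

Lemma Rpunc_dh2 P Q : Rpunc T (P, Q) -> dh Q.
Proof. by move=> /RpuncP[t [dP Pt _ ->]]; exact: dh_translate. Qed.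

Lemma Rpunc_refl P : dh P -> Rpunc T (P, P) /\ displacement (P, P) = 0.
Proof.
move=> dP; have [hP [t Pt t0]] := dP; have e : P = translate P (- puncture t).
  by rewrite t0 oppr0 translate0.
split; first by split=> //; exists t.
by rewrite {2}e displacementE.
Qed.

Lemma Rpunc_displacement P Q : Rpunc T (P, Q) -> Q = translate P (- displacement (P, Q)).
Proof. by move=> /RpuncP[t [dP Pt -> ->]]. Qed.

Lemma Rpunc_trans P Q S : Rpunc T (P, Q) -> Rpunc T (Q, S) ->
  Rpunc T (P, S) /\ displacement (P, S) = displacement (P, Q) + displacement (Q, S).
Proof.
move=> /RpuncP[t [dP Pt -> ->]] /RpuncP[u [dQ Qu -> ->]]; have [hP _] := dP.
move: Qu; rewrite translateE isometry_actP => Pu.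
have eu : puncture (act_tile (isom_inv (- puncture t, 0)) u) = puncture t + puncture u.
  by rewrite puncture_act /isom/= oppr0 !rotation0v opprK addrC.
have e : isometry_act (- puncture t, 0) P = translate P (- puncture t) by rewrite translateE.
rewrite e translateD -opprD -eu; split; last exact: displacementE.
by split=> //; eexists; first exact: Pu.
Qed.

Lemma Rpunc_sym P Q : Rpunc T (P, Q) ->
  Rpunc T (Q, P) /\ displacement (Q, P) = - displacement (P, Q).
Proof.
move=> PQ; move: (PQ) => /RpuncP[t [dP Pt -> eQ]].
have dQ := Rpunc_dh2 PQ; have [hQ _] := dQ.
have [hP [c Pc c0]] := dP.
pose u := act_tile (- puncture t, 0) c.
have Qu : Q u by rewrite eQ translateE; exact/isometry_act_tile.
have eu : puncture u = - puncture t by rewrite puncture_act /isom rotation0v c0 add0r.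
have eP : P = translate Q (- puncture u).
  by rewrite eu eQ translateD opprK addNr translate0.
split; first by split=> //; exists u.
by rewrite [in LHS]eP displacementE.
Qed.

(** Turning a pair turns its displacement and its central angle alike, so this vector is rotation
    invariant: it is a puncture of [nrm q.1]. *)
Definition ndisp (q : set tile * set tile) : plane :=
  rotation (- al q.1) *m displacement q.

Lemma ndispK q : rotation (al q.1) *m ndisp q = displacement q.
Proof. by rewrite rotationKN. Qed.

Lemma nrm_ndisp P Q : Rpunc T (P, Q) -> exists2 t, nrm P t & puncture t = ndisp (P, Q).
Proof.
move=> /RpuncP[t [dP Pt e _]].
exists (act_tile (0, - al P) t); first by apply/isometry_act_tile.
by rewrite puncture_act isom_rot /ndisp/= e.
Qed.

Lemma Rpunc_nrm P t : dh P -> nrm P t ->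
  exists2 Q, Rpunc T (P, Q) & ndisp (P, Q) = puncture t.
Proof.
move=> dP /nrmP Pt; have [hP _] := dP.
exists (translate P (- puncture (act_tile (0, al P) t))); first by split=> //; eexists; first
  exact: Pt.
by rewrite /ndisp (displacementE hP Pt) puncture_act isom_rot rotationNK.
Qed.

Lemma ndisp_inj P Q S : Rpunc T (P, Q) -> Rpunc T (P, S) -> ndisp (P, Q) = ndisp (P, S) -> Q = S.
Proof.
move=> PQ PS /(congr1 (mulmx (rotation (al P)))); rewrite !(ndispK (P, _)) => e.
by rewrite (Rpunc_displacement PQ) e -Rpunc_displacement.
Qed.

(** Change of base tile: [Q] is [P] seen from the tile with frame [h], whose puncture is the
    normalised displacement. The shift of the angle by [h.2] produces the scalars met when z moves
    past an indicator. *)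
Lemma nrm_shift P Q h i : Rpunc T (P, Q) -> nrm P (act_tile h (proto p i)) ->
  ndisp (P, Q) = isom h 0 ->
  rotation (al Q) = rotation (al P + h.2) /\ nrm Q = isometry_act (isom_inv h) (nrm P).
Proof.
move=> PQ /nrmP Ph e; have dQ := Rpunc_dh2 PQ.
have ed : displacement (P, Q) = rotation (al P) *m isom h 0 by rewrite -e (ndispK (P, Q)).
have eQ : Q = isometry_act (- displacement (P, Q), 0) P.
  by rewrite -translateE -Rpunc_displacement.
have ea : rotation (al Q) = rotation (al P + h.2).
  apply/esym/(@central_angle_unique _ _ i) => //.
  rewrite [X in X _]eQ isometry_actP; move: Ph; rewrite !act_tile_comp.
  congr (P _); apply: act_tile_eq => /=; last by rewrite oppr0 add0r.
  rewrite mulmx0 addr0 add0r rotation0v opprK ed /isom add0r -(rotationDv (al P)).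
  by rewrite rotationNK.
split=> //; rewrite /nrm [X in isometry_act _ X]eQ !isometry_act_comp.
apply: isometry_act_eq => /=.
  rewrite mulmx0 addr0 add0r mulmxN opprK ed; congr (- _).
  by rewrite /isom add0r.
by rewrite addr0 (rotation_opp ea) opprD addrC.
Qed.

Lemma ndisp_trans P Q S h i : Rpunc T (P, Q) -> Rpunc T (Q, S) ->
  nrm P (act_tile h (proto p i)) -> ndisp (P, Q) = isom h 0 ->
  ndisp (P, S) = isom h (ndisp (Q, S)).
Proof.
move=> PQ QS Ph e; have [ea _] := nrm_shift PQ Ph e.
have [_ ed] := Rpunc_trans PQ QS.
rewrite {1}/ndisp/= ed mulmxDr -[_ *m displacement (P, Q)]/(ndisp (P, Q)) e.
rewrite -(ndispK (Q, S))/= ea rotationDv rotationNK.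
by rewrite /isom add0r -mulmxDr addrC.
Qed.

Lemma ndisp_sym P Q h i : Rpunc T (P, Q) -> nrm P (act_tile h (proto p i)) ->
  ndisp (P, Q) = isom h 0 -> ndisp (Q, P) = isom (isom_inv h) 0.
Proof.
move=> PQ Ph e; have [QP _] := Rpunc_sym PQ.
have := ndisp_trans PQ QP Ph e.
rewrite {1}/ndisp (Rpunc_refl (Rpunc_dh1 PQ)).2 mulmx0 => ->.
by rewrite isomK.
Qed.

End Hull.

(** * The topology of the equivalence relation *)

Section Topology.
Context {R : realType} {T : set (@tile R)} {n : nat} {p : 'I_n -> set 'cV[R]_2}.
Context {std : standing T p}.
Local Notation plane := 'cV[R]_2.
Local Notation tile := (@tile R).
Local Notation dh := (discrete_hull T).
Local Notation al := (central_angle p).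
Local Notation nrm := (nrm (p := p)).
Local Notation ndisp := (ndisp (p := p)).
Implicit Types (t u : tile) (P Q : set tile) (g h : plane * R) (x y w : plane) (r e : R).
Implicit Types (q : set tile * set tile).

(** Unlike [tiling_dist], this allows no small motion of the tilings: after normalisation the
    patches agree exactly. *)
Definition nclose e P Q : Prop :=
  agree e^-1 (nrm P) (nrm Q) /\ frobenius (rotation (al P) - rotation (al Q)) < e.

Definition pclose e q q' : Prop := nclose e q.1 q'.1 /\ ndisp q = ndisp q'.

Lemma nclose_sym e P Q : nclose e P Q -> nclose e Q P.
Proof. by case=> h h'; split; [exact: agree_sym | rewrite frobeniusB]. Qed.

Lemma pclose_sym e q q' : pclose e q q' -> pclose e q' q.
Proof. by case=> h h'; split; [exact: nclose_sym | ]. Qed.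

Lemma pclose_refl e q : 0 < e -> pclose e q q.
Proof. by move=> e0; split=> //; split=> //; rewrite subrr frobenius0. Qed.

Lemma pclose_trans e d q q' q'' : 0 < e -> 0 < d ->
  pclose e q q' -> pclose d q' q'' -> pclose (e + d) q q''.
Proof.
move=> e0 d0 [[h1 h2] h3] [[k1 k2] k3]; split; last by rewrite h3.
split.
  apply: agree_trans; [apply: agree_le h1|apply: agree_le k1];
    by rewrite lef_pV2 ?posrE ?addr_gt0// ?lerDl ?lerDr ltW.
by apply: le_lt_trans (rotation_triangle _ (al q'.1) _) _; exact: ltrD.
Qed.

Lemma pclose_le e d q q' : 0 < e -> e <= d -> pclose e q q' -> pclose d q q'.
Proof.
move=> e0 ed [[h1 h2] h3]; split=> //; split; last exact: lt_le_trans ed.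
by apply: agree_le h1; rewrite lef_pV2// posrE (lt_le_trans e0).
Qed.

(** The moved central tile of [P] lies in the ball of agreement, so it is the image of a tile of [Q]
    with puncture near 0. By separation this is the central tile of [Q]. Uniqueness of frames then
    ties the two motions to the two central angles. *)
Lemma tiling_dist_nclose e : 0 < e ->
  exists2 d, 0 < d & forall P Q, dh P -> dh Q -> tiling_dist P Q < d -> nclose e P Q.
Proof.
move=> e0; have [r r0 rP] := puncture_separated; have [D D0 DP] := outradius.
(* Each halved bound pays for two motions: [e / 2] for the rotations, [r / 2] for the translations.
   The radius [D + 1] contains the moved central tile, and [e^-1 + 1] allows for a translation
   shorter than 1. *)
pose d := Num.min (Num.min 1 (e / 2)) (Num.min (r / 2) (Num.min (D + 1)^-1 (e^-1 + 1)^-1)).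
have D1 : 0 < D + 1 by rewrite addr_gt0.
have e1 : 0 < e^-1 + 1 by rewrite addr_gt0// invr_gt0.
have d0 : 0 < d by rewrite !lt_min !divr_gt0// !invr_gt0 D1 e1 ltr01.
exists d => // P Q dP dQ /tiling_dist_lt[|s /andP[s0]]; first by rewrite !ge_min lexx.
rewrite !lt_min => /andP[/andP[s1 se] /andP[sr /andP[sD se']]] [g [g' [gs g's /agreeP E]]].
have sDV : D + 1 < s^-1 by rewrite -[X in X < _]invrK ltf_pV2 ?posrE ?invr_gt0.
have seV : e^-1 + 1 < s^-1 by rewrite -[X in X < _]invrK ltf_pV2 ?posrE ?invr_gt0.
have isoE k : isometry_dist k isometry_id < s ->
    frobenius k.1 < s /\ frobenius (rotation k.2 - rotation 0) < s.
  by rewrite /isometry_dist/= subr0; have := frobenius_ge0 k.1;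
    have := frobenius_ge0 (rotation k.2 - rotation 0) => ? ? ?; split; lra.
have [g1 g2] := isoE _ gs; have [g'1 g'2] := isoE _ g's.
have [hP _] := dP; have [hQ _] := dQ.
have [Pc c0 [i ci]] := central_tileP dP; have [Qc c0' [j cj]] := central_tileP dQ.
set c := central_tile P in Pc c0 ci; set c' := central_tile Q in Qc c0' cj.
have gPc : isometry_act g P (act_tile g c) by exact/isometry_act_tile.
have gQc : isometry_act g' Q (act_tile g c).
  apply/E => //; rewrite support_act => _ [y cy <-].
  have := DP _ _ hP Pc _ cy; rewrite c0 /eball/= !subr0 => yD.
  rewrite /isom frobenius_rotation; apply: le_lt_trans (frobenius_triangle _ _) _; lra.
have [u Qu eu] : exists2 u, Q u & act_tile g' u = act_tile g c.
  by move: gQc; rewrite isometry_actE => -[u Qu eu]; exists u.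
have uc : u = c'.
  apply: (rP _ _ _ hQ Qu Qc); rewrite c0' subr0.
  have : isom g' (puncture u) = isom g 0 by rewrite -c0 -!puncture_act eu.
  rewrite /isom add0r mulmxDr => e'.
  rewrite -(frobenius_rotation g'.2) -[_ *m _](addrK (rotation g'.2 *m g'.1)) e'.
  apply: le_lt_trans (frobenius_triangle _ _) _.
  rewrite frobeniusN !frobenius_rotation; lra.
rewrite uc cj ci !act_tile_comp in eu.
have [_ /= eu1 eu2] := proto_act_inj eu.
rewrite !add0r in eu1.
have ea : frobenius (rotation (al P) - rotation (al Q)) < e.
  have <- : frobenius (rotation g'.2 - rotation g.2) =
            frobenius (rotation (al P) - rotation (al Q)).
    by rewrite -(rotation_shift _ _ (al Q)) eu2 ![g.2 + _]addrC rotation_shift.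
  apply: le_lt_trans (rotation_triangle _ 0 _) _; rewrite [X in _ + X]frobeniusB; lra.
split=> //.
(* Both normalisations are images of the moved tilings under the same isometry. *)
pose k := isom_inv (isom_comp g (0, al P)).
have kP : nrm P = isometry_act k (isometry_act g P).
  apply: (can_inj (isometry_actK (isom_comp g (0, al P)))).
  by rewrite isometry_actVK -isometry_act_comp -nrmVE.
have kQ : nrm Q = isometry_act k (isometry_act g' Q).
  apply: (can_inj (isometry_actK (isom_comp g (0, al P)))).
  rewrite isometry_actVK {2}(nrmVE (p := p) Q) isometry_act_comp.
  by apply: isometry_act_eq => /=; rewrite ?add0r.
rewrite kP kQ; apply: agree_isom E; rewrite /k /= frobeniusN frobenius_rotation add0r.
by rewrite frobenius_rotation; lra.
Qed.

(** Turning [P] by the difference of the central angles, a rotation close to the identity, makes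
    both tilings the image of their normalisations under one rotation. *)
Lemma nclose_tiling_dist e P Q : 0 < e < 1 -> nclose e P Q -> tiling_dist P Q <= e.
Proof.
move=> /andP[e0 e1] [h1 h2]; apply: tiling_dist_le; first by rewrite e0.
exists (0, al Q - al P), (0, 0); rewrite /isometry_dist/= !subrr !frobenius0 !add0r; split=> //.
  by rewrite -(rotation_shift _ _ (al P)) subrK add0r frobeniusB.
apply/agreeP.
have -> : isometry_act (0, al Q - al P) P = isometry_act (0, al Q) (nrm P).
  by rewrite isometry_act_comp; apply: isometry_act_eq; rewrite //= mulmx0 addr0.
have -> : isometry_act (0, 0) Q = isometry_act (0, al Q) (nrm Q).
  by rewrite -nrmVE -translateE translate0.
exact: agree_rotate.
Qed.

(** The normalised displacement is locally constant: the tile that realises it lies in both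
    normalised tilings, and the tile realising the other displacement is too near to it to be
    different. *)
Lemma Rpunc_dist_close e q : 0 < e -> Rpunc T q ->
  exists2 d, 0 < d & forall q', Rpunc T q' -> Rpunc_dist q q' < d -> pclose e q q'.
Proof.
move=> e0 Rq; have [r r0 rP] := puncture_separated; have [D D0 DP] := nrm_outradius.
pose M := frobenius (displacement q); have M0 : 0 <= M by exact: frobenius_ge0.
(* The ball of radius [M + D + 1] contains the tile at the displacement. The last bound keeps a
   vector of length [M] within [r / 2] when the angle changes. *)
pose e' := Num.min e (Num.min (M + D + 1)^-1 (r / 2 / (M + 1))).
have MD : 0 < M + D + 1 by lra.
have M1 : 0 < M + 1 by lra.
have e'0 : 0 < e' by rewrite !lt_min e0 invr_gt0 MD !divr_gt0.
have [d d0 dP] := tiling_dist_nclose e'0.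
exists (Num.min d (r / 2)); first by rewrite lt_min d0 divr_gt0.
case: q Rq @M M0 @e' MD M1 e'0 dP => [P S] PS M M0 e' MD M1 e'0 dP [P' S'] PS'.
rewrite lt_min /Rpunc_dist/= => /andP[lt1 lt2].
have t0 := tiling_dist_ge0 P P'.
have f0 := frobenius_ge0 (displacement (P, S) - displacement (P', S')).
have [dhP dhP'] := (Rpunc_dh1 PS, Rpunc_dh1 PS').
have nc : nclose e' P P' by apply: dP => //; lra.
suff nd : ndisp (P, S) = ndisp (P', S').
  by apply: (pclose_le e'0); [rewrite ge_min lexx|split].
have [a1 a2] := nc; have [[hP _] [hP' _]] := (dhP, dhP').
have [t Pt et] := nrm_ndisp PS; have [t' Pt' et'] := nrm_ndisp PS'.
have nM : frobenius (ndisp (P, S)) = M by rewrite /ndisp frobenius_rotation.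
have P't : nrm P' t.
  apply/a1 => // y /(DP _ _ hP Pt); rewrite /eball/= subr0 et => yD.
  have -> : y = (y - ndisp (P, S)) + ndisp (P, S) by rewrite subrK.
  apply: le_lt_trans (frobenius_triangle _ _) _; rewrite nM.
  apply: (@lt_le_trans _ _ (M + D + 1)); first by lra.
  by rewrite -[leLHS]invrK lef_pV2 ?posrE ?invr_gt0// /e' !ge_min lexx !orbT.
suff : t = t' by move=> tt'; rewrite -et -et' tt'.
apply: (can_inj (act_tileK (0, al P'))).
apply: (rP _ _ _ hP'); [exact/nrmP|exact/nrmP|rewrite !puncture_act !isom_rot et et'].
rewrite (ndispK (P', S')) -[X in frobenius (X - _)](subrK (displacement (P, S))) -addrA.
apply: le_lt_trans (frobenius_triangle _ _) _.
rewrite -(ndispK (p := p) (P, S)) [X in X + _]frobeniusB/=.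
have h1 := frobenius_rotationB_le (al P) (al P') (ndisp (P, S)); rewrite nM in h1.
have h2 : frobenius (rotation (al P) - rotation (al P')) * M <= r / 2.
  apply: (@le_trans _ _ (r / 2 / (M + 1) * (M + 1))); last by rewrite divfK// gt_eqF.
  apply: ler_pM => //; [exact: frobenius_ge0| |by rewrite lerDl].
  by apply/ltW/(lt_le_trans a2); rewrite /e' !ge_min lexx !orbT.
have lt3 : frobenius (displacement (P, S) - displacement (P', S')) < r / 2 by lra.
rewrite -(ndispK (p := p) (P, S))/= in lt3; lra.
Qed.

Lemma close_Rpunc_dist d q : 0 < d ->
  exists2 e, 0 < e & forall q', pclose e q q' -> Rpunc_dist q q' < d.
Proof.
move=> d0; pose M := frobenius (displacement q); have M0 : 0 <= M by exact: frobenius_ge0.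
have M1 : 0 < M + 2 by rewrite ltr_wpDl.
(* The tilings contribute at most [e] and the turned displacement at most [e * M]; [M + 2] makes the
   sum strictly less than [d]. *)
pose e := Num.min 2^-1 (d / (M + 2)).
have e0 : 0 < e by rewrite lt_min divr_gt0// invr_gt0 ltr0n.
have e1 : e < 1 by rewrite gt_min; apply/orP; left; rewrite invf_lt1// ltr1n.
have ed : e * (M + 2) <= d by rewrite -ler_pdivlMr// ge_min lexx orbT.
exists e => // q' [nc nd]; rewrite /Rpunc_dist.
have h1 := nclose_tiling_dist (introT andP (conj e0 e1)) nc.
have [_ a2] := nc.
have h2 := frobenius_rotationB_le (al q.1) (al q'.1) (ndisp q).
have nM : frobenius (ndisp q) = M by rewrite /ndisp frobenius_rotation.
rewrite ndispK {1}nd ndispK nM in h2.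
have h3 : frobenius (rotation (al q.1) - rotation (al q'.1)) * M <= e * M.
  by rewrite ler_wpM2r// ltW.
lra.
Qed.

(** The witness set is open by [pclose_trans], which serves as the triangle inequality, combined
    with the two comparisons of [pclose] and [Rpunc_dist]. *)
Lemma nbhs_pclose (q : Rpunc_space T) (S : set (Rpunc_space T)) :
  nbhs q S <-> exists2 e, 0 < e & forall q' : Rpunc_space T, pclose e (sval q) (sval q') -> S q'.
Proof.
have openE (U : set (Rpunc_space T)) : open U = Rpunc_open U by [].
split.
  rewrite nbhsE => -[U [oU Uq] US]; have [d d0 dU] := oU _ Uq.
  have [e e0 eP] := close_Rpunc_dist (sval q) d0.
  by exists e => // q' /eP/dU/US.
move=> [e e0 eS]; rewrite nbhsE.
exists [set q' : Rpunc_space T | exists2 d, 0 < d & forall q'' : Rpunc_space T, pclose d (sval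
  q') (sval q'') -> S q'']; last first.
  by move=> q' [d d0]; apply; exact: pclose_refl.
split; last by exists e.
rewrite openE => q' [d d0 dS].
have d20 : 0 < d / 2 by rewrite divr_gt0.
have [s s0 sP] := Rpunc_dist_close d20 (svalP q').
exists s => // q'' /(sP _ (svalP q'')) c; exists (d / 2) => // q3 c'.
by apply: dS; rewrite [d]splitr; exact: pclose_trans c c'.
Qed.

(** The hull is closed under limits in which the tilings are also turned slightly, as [tiling_dist]
    absorbs small rotations. This is the form in which the limit tiling below is obtained. *)
Lemma hull_closure P : is_tiling P ->
  (forall e, 0 < e -> exists Q a, [/\ hull T Q, agree e^-1 P (isometry_act (0, a) Q) &
     frobenius (rotation a - rotation 0) < e]) -> hull T P.
Proof.
move=> tP lP; split=> // e e0; pose m := Num.min (e / 2) (2^-1).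
have m0 : 0 < m by rewrite lt_min divr_gt0//= invr_gt0 ltr0n.
have m1 : m < 1 by rewrite gt_min; apply/orP; right; rewrite invf_lt1// ltr1n.
have me : m < e by rewrite gt_min ltr_pdivrMr// ltr_pMr// ltr1n.
(* With [m / 4] the two small motions add up to less than [m], and the radius 4 / m exceeds 1 / m by
   more than the translation. *)
have m40 : 0 < m / 4 by rewrite divr_gt0.
have [Q [a [hQ PQ a0]]] := lP _ m40.
have [z zlt] := hQ.2 _ m40.
have [|s /andP[s0 sm] [g [g' [gs g's /agreeP E]]]] := tiling_dist_lt zlt; first by lra.
exists z; apply: le_lt_trans me; apply: tiling_dist_le; first by rewrite m0.
have g1 : frobenius g.1 < s.
  move: gs; rewrite /isometry_dist/= subr0; apply: le_lt_trans.
  by rewrite lerDl frobenius_ge0.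
pose k := isom_comp g (0, - a).
have k1 : frobenius k.1 = frobenius g.1 by rewrite /= add0r frobenius_rotation.
exists k, g'; split.
- rewrite /isometry_dist subr0 k1; move: gs; rewrite /isometry_dist subr0/= => gs.
  have := rotation_triangle (g.2 - a) g.2 0.
  have -> : frobenius (rotation (g.2 - a) - rotation g.2) = frobenius (rotation a - rotation 0).
    rewrite -(rotation_shift _ _ (a - g.2)) (_ : g.2 - a + _ = 0); last by ring.
    by rewrite (_ : g.2 + _ = a) 1?frobeniusB//; ring.
  lra.
- lra.
apply/agreeP; apply: agree_trans (agree_le _ E); last first.
  by rewrite lef_pV2 ?posrE//; lra.
rewrite (_ : isometry_act g Q = isometry_act k (isometry_act (0, a) Q)); last first.
  rewrite isometry_act_comp; apply: isometry_act_eq => /=; last by rewrite subrK.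
  by rewrite !add0r opprK rotationNK.
apply: agree_isom PQ; rewrite k1.
have -> : (m / 4)^-1 = 4 * m^-1 by rewrite invfM invrK mulrC.
have : 1 < m^-1 by rewrite invf_gt1.
lra.
Qed.

End Topology.

(** * Finite local complexity and compactness *)

Section Compactness.
Context {R : realType} {T : set (@tile R)} {n : nat} {p : 'I_n -> set 'cV[R]_2}.
Context {std : standing T p}.
Local Notation plane := 'cV[R]_2.
Local Notation tile := (@tile R).
Local Notation dh := (discrete_hull T).
Local Notation al := (central_angle p).
Local Notation nrm := (nrm (p := p)).
Local Notation ndisp := (ndisp (p := p)).
Local Notation pclose := (pclose (p := p)).
Implicit Types (t u : tile) (P Q : set tile) (g h : plane * R) (x y w : plane) (r e : R).

Lemma truncn_close (a b : R) : 0 <= a -> 0 <= b -> Num.trunc a = Num.trunc b -> `|a - b| < 1.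
Proof.
move=> a0 b0 e; have /andP[a1 a2] := truncn_itv a0; have /andP[b1 b2] := truncn_itv b0.
rewrite e in a1 a2; rewrite -natr1 in a2 b2; rewrite ltr_norml; apply/andP; split; lra.
Qed.

Lemma coord_le_frobenius (v : plane) i : `|v i 0| <= frobenius v.
Proof.
rewrite frobenius2 -sqrtr_sqr; apply: ler_wsqrtr.
case: (unliftP 0 i) => [k|] ->; last by rewrite lerDl sqr_ge0.
by rewrite (_ : lift 0 k = 1) ?lerDr ?sqr_ge0//; apply/val_inj; rewrite /= ord1.
Qed.

(* Pigeonhole on a grid finer than the separation of the punctures. *)
Lemma puncture_count M : exists N : nat, forall P (s : seq tile), hull T P -> uniq s ->
  {in s, forall t, P t /\ frobenius (puncture t) < M} -> (size s <= N)%N.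
Proof.
have [r r0 rP] := puncture_separated.
(* In one cell of side [r / 2] two points are at Euclidean distance less than [r]. *)
have r20 : 0 < r / 2 by rewrite divr_gt0.
pose c (v : R) : nat := Num.trunc ((v + M) / (r / 2)).
pose N := (Num.trunc (2 * M / (r / 2))).+1.
pose f t : 'I_N * 'I_N := (inord (c (puncture t 0 0)), inord (c (puncture t 1 0))).
exists #|{: 'I_N * 'I_N}| => P s hP us sP.
have bnd t i : t \in s -> - M < puncture t i 0 < M.
  by move=> /sP[_ h]; rewrite -ltr_norml (le_lt_trans (coord_le_frobenius _ _) h).
have cN t i : t \in s -> (c (puncture t i 0%R) < N)%N.
  move=> /(bnd _ i)/andP[h1 h2]; rewrite ltnS; apply: le_truncn.
  by rewrite ler_pM2r ?invr_gt0//; lra.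
have fin : {in s &, injective f}.
  move=> t u ts us' [/(congr1 val)/= + /(congr1 val)/=].
  rewrite !inordK ?cN// => e0 e1.
  have [Pt _] := sP _ ts; have [Pu _] := sP _ us'.
  apply: (rP _ _ _ hP Pt Pu); rewrite frobenius2 !mxE.
  have cl i : c (puncture t i 0) = c (puncture u i 0) ->
      `|puncture t i 0 - puncture u i 0| < r / 2.
    have /andP[h1 h2] := bnd _ i ts; have /andP[h3 h4] := bnd _ i us'.
    move=> /truncn_close; rewrite -mulrBl opprD addrACA subrr addr0 normrM [`|(r /
      2)^-1|]gtr0_norm ?invr_gt0//.
    by rewrite ltr_pdivrMr// mul1r; apply; apply: divr_ge0; lra.
  have /ltr_normlP[h1 h2] := cl _ e0; have /ltr_normlP[h3 h4] := cl _ e1.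
  rewrite -(gtr0_norm r0) -sqrtr_sqr ltr_sqrt ?exprn_gt0//.
  move: h1 h2 h3 h4; move: (puncture t 0 0 - _) (puncture t 1 0 - _) => a b; nra.
have uf : uniq (map f s) by rewrite map_inj_in_uniq.
by rewrite -(size_map f) -(card_uniqP uf) max_card.
Qed.

Lemma puncture_finite P r : hull T P -> finite_set [set t | P t /\ frobenius (puncture t) < r].
Proof.
move=> hP; apply: contrapT => infP; have [N NP] := puncture_count r.
have [B BP] := infinite_set_fset N.+1 infP.
apply/negP; rewrite -leqNgt; apply: (NP P) => //; exact: finmap.fset_uniq.
Qed.

Lemma patch_finite P r : hull T P -> finite_set (patch_in_ball P 0 r).
Proof.
move=> hP; apply: sub_finite_set (puncture_finite r hP) => t [Pt tr]; split=> //.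
by rewrite -[puncture t]subr0; exact: tr (puncture_support hP Pt).
Qed.

Lemma nrm_agree_patch P r : patch_in_ball (nrm P) 0 r = isometry_act (0, - al P) (patch_in_ball
  P 0 r).
Proof.
apply/seteqP; split=> t.
  move=> [/isometry_actP Pt tr]; apply/isometry_actP; split=> //.
  rewrite support_act => _ [y /tr yr <-]; move: yr.
  by rewrite /eball/= !subr0 /isom/= mulmx0 oppr0 addr0 frobenius_rotation.
move=> /isometry_actP[Pt tr]; split; first exact/isometry_actP.
move=> y ty.
have h : tile_support (act_tile (isom_inv (0, - al P)) t) (isom (isom_inv (0, - al P)) y).
  by rewrite support_act; exists y.
by have := tr _ h; rewrite /eball/= !subr0 /isom/= mulmx0 oppr0 addr0 frobenius_rotation.
Qed.

Lemma nrm_patch_finite P r : hull T P -> finite_set (patch_in_ball (nrm P) 0 r).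
Proof. by move=> hP; rewrite nrm_agree_patch; apply/isometry_act_finite/patch_finite. Qed.

(* A patch of F and a tile of it determine at most one isometry carrying that
   tile to a proto-tile in standard position. *)
Lemma nrm_patches_finite_large : exists2 D, 0 < D & forall r, D <= r ->
  finite_set [set patch_in_ball (nrm P) 0 r | P in dh].
Proof.
have [D D0 DP] := nrm_outradius; exists D => // r Dr.
have [F finF FP] := std_flc (lt_le_trans D0 Dr).
pose cand (Q : set tile) (u : tile) : set tile := xget set0
  [set S | exists g i, act_tile g u = proto p i /\ S = isometry_act g Q].
(* A member of [F] that represents no patch may be infinite and would spoil the finite union. *)
pose F' := [set Q | F Q /\ finite_set Q].
have finF' : finite_set F' by apply: sub_finite_set finF => Q [].
apply: (@sub_finite_set _ _ (\bigcup_(Q in F') (cand Q @` Q))); last first.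
  by apply: bigcup_finite => // Q [_ fQ]; exact: finite_image.
move=> _ [P dP <-]; have [hP _] := dP.
have [Q FQ [g eQ]] := FP P 0 hP.
have fQ : finite_set Q.
  by rewrite -(isometry_actK g Q) -eQ; apply/isometry_act_finite/patch_finite.
exists Q => //; have [i ci] := nrm_central dP.
have Npc : patch_in_ball (nrm P) 0 r (proto p i).
  by split=> // y /(DP _ _ hP ci); exact: eball_subset.
pose k := isom_comp (0, - al P) g.
have eN : patch_in_ball (nrm P) 0 r = isometry_act k Q.
  by rewrite nrm_agree_patch eQ isometry_act_comp.
move: Npc; rewrite eN isometry_actE => -[u Qu eu]; rewrite -isometry_actE.
exists u => //; apply: xget_unique; first by exists k, i.
move=> _ [g' [j [e ->]]].
have eu' : u = act_tile (isom_inv k) (proto p i) by rewrite -eu act_tileK.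
have : act_tile (isom_comp g' (isom_inv k)) (proto p i) = act_tile (0, 0) (proto p j).
  rewrite -act_tile_comp -eu' e /proto act_tileE /tile_map/= /isom/= addr0 rotation0v.
  by congr pair; rewrite -[LHS]image_id; apply: eq_imagel => z _; rewrite addr0 rotation0v.
move=> /proto_act_inj[ij /= e1 e2].
rewrite -[in LHS](isometry_actK k Q) isometry_act_comp.
rewrite (isometry_act_eq (h := (0, 0)))//; first by rewrite -translateE translate0.
Qed.

(** A small patch is the restriction of one large enough to contain the central tile. *)
Lemma nrm_patches_finite r : finite_set [set patch_in_ball (nrm P) 0 r | P in dh].
Proof.
have [D D0 DP] := nrm_patches_finite_large.
have := DP (Num.max D r); rewrite le_max lexx => /(_ isT) fin.
apply: sub_finite_set (finite_image (fun S => patch_in_ball S 0 r) fin) => _ [P dP <-].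
exists (patch_in_ball (nrm P) 0 (Num.max D r)); first by exists P.
apply/seteqP; split=> [t [[]]//|t [Pt tr]]; split=> //; split=> //.
by apply: subset_trans tr (eball_subset _); rewrite le_max lexx orbT.
Qed.

Lemma ultra_finite (X : Type) (Y : eqType) (F : set_system X) (f : X -> Y) (C : set Y) :
  UltraFilter F -> finite_set C -> F [set x | C (f x)] -> exists c, F [set x | f x = c].
Proof.
move=> UF /finite_seqP[s ->]; elim: s => [F0|c s IH].
  by have /filter_ex[x] := F0; rewrite /= in_nil.
move=> Fs; have [Fc|Fc] := in_ultra_setVsetC [set x | f x = c] UF; first by exists c.
apply: IH; apply: filterS (filterI Fs Fc) => x []/=.
by rewrite inE => /orP[/eqP|].
Qed.

Lemma rotation_continuous (a e : R) : 0 < e ->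
  exists2 d, 0 < d & forall b, `|a - b| < d -> frobenius (rotation a - rotation b) < e.
Proof.
move=> e0; have e20 : 0 < e / 2 by rewrite divr_gt0.
have cc : \forall b \near a, `|cos a - cos b| < e / 2.
  by have /cvgrPdist_lt := @continuous_cos R a; exact.
have cs : \forall b \near a, `|sin a - sin b| < e / 2.
  by have /cvgrPdist_lt := @continuous_sin R a; exact.
have /nbhs_ballP[d d0 dP] : nbhs a [set b | `|cos a - cos b| < e / 2 /\ `|sin a - sin b| < e / 2].
  by apply: filterS (filterI cc cs).
exists d => // b ab; have [] := dP _ ab => /ltr_normlP[h1 h2] /ltr_normlP[h3 h4].
rewrite frobenius_rotationB -sqrtrM//.
rewrite -(gtr0_norm e0) -sqrtr_sqr ltr_sqrt ?exprn_gt0//.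
move: h1 h2 h3 h4; move: (cos a - cos b) (sin a - sin b) => s t; nra.
Qed.

Lemma rotation_reduced (a : R) : exists2 b, - pi <= b <= pi & rotation b = rotation a.
Proof.
have [b bpi [bc bs]] := rotation_angle (cos2Dsin2 a).
by exists b => //; exact: rotation_eq.
Qed.

(* The limit tiling consists of the tiles lying in ultrafilter-almost all
   normalised tilings, turned by the limit of the central angles. *)
Lemma compact_ndisp w : compact [set q : Rpunc_space T | ndisp (sval q) = w].
Proof.
rewrite compact_ultra => F UF Fw.
have PF : ProperFilter F by exact: ultra_proper.
pose N (q : Rpunc_space T) := nrm (sval q).1.
have hN (q : Rpunc_space T) : hull T (sval q).1 by case: q => -[P Q] /= /Rpunc_dh1[].
have dN (q : Rpunc_space T) : dh (sval q).1 by case: q => -[P Q] /= /Rpunc_dh1.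
pose L := [set t | F [set q | N q t]].
(* Finitely many normalised patches of radius [r] exist, so the ultrafilter selects one of them, and
   it is the patch of [L]. *)
have FL r : F [set q | agree r L (N q)].
  have [|c Fc] := ultra_finite (f := fun q => patch_in_ball (N q) 0 r) UF (nrm_patches_finite r).
    by apply: filterE => q; exists (sval q).1.
  apply: filterS (Fc) => q qc t tr.
  have cE q' : patch_in_ball (N q') 0 r = c -> N q' t <-> c t.
    by move=> <-; split=> [|[]].
  rewrite (cE q qc); split=> [Lt|ct].
    by have [q' [q't q'c]] := filter_ex (filterI Lt Fc); apply/(cE q').
  by apply: filterS Fc => q' q'c; apply/(cE q').
have [D D0 DP] := nrm_outradius.
have L_N (t : tile) : L t -> exists q, N q t by exact: filter_ex.
(* Tiles have diameter at most [2 * D], so a tile through [x] lies in a ball that depends only on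
   [x]. *)
have boundN q t x : N q t -> tile_support t x ->
    tile_support t `<=` eball 0 (frobenius x + 2 * D).
  move=> qt tx y ty; have := DP _ _ (hN q) qt _ ty; have := DP _ _ (hN q) qt _ tx.
  rewrite /eball/= subr0 => h1 h2.
  have -> : y = (y - puncture t) + (- (x - puncture t) + x) by rewrite opprB !subrK.
  apply: le_lt_trans (frobenius_triangle _ _) _.
  have := frobenius_triangle (- (x - puncture t)) x; rewrite frobeniusN; lra.
have tL : is_tiling L.
  split.
  - have -> : L = \bigcup_k patch_in_ball L 0 k%:R.
      apply/seteqP; split=> [t Lt|t [k _ []]//].
      have [q qt] := L_N _ Lt.
      have h := boundN _ _ _ qt (nrm_puncture_support (hN q) qt).
      exists (Num.trunc (frobenius (puncture t) + 2 * D)).+1 => //; split=> //.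
      by move=> y /h; apply: eball_subset; apply: ltW; exact: truncnS_gt.
    apply: bigcup_countable => // k _; apply: finite_set_countable.
    have [q /agreeP ->] := filter_ex (FL k%:R); exact: nrm_patch_finite.
  - by move=> t /L_N[q qt]; have [_ + _ _] := nrm_tiling (p := p) (hN q); exact.
  - apply/seteqP; split=> // x _; have [q qL] := filter_ex (FL (frobenius x + 2 * D)).
    have [t qt tx] := tiling_cover x (nrm_tiling (p := p) (hN q)).
    exists t => //; apply/qL => //; exact: boundN qt tx.
  - move=> t u Lt Lu tu; have [q [qt qu]] := filter_ex (filterI Lt Lu).
    by have [_ _ _] := nrm_tiling (p := p) (hN q); exact.
(* Angles are reduced to a compact interval so that the ultrafilter has a limit angle. *)
have /choice[a aP] : forall q : Rpunc_space T, exists b, (- pi <= b <= pi) /\ rotation b =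
  rotation (al (sval q).1).
  by move=> q; have [b] := rotation_reduced (al (sval q).1); exists b.
have [th thP] : exists th : R, forall e, 0 < e -> F [set q | `|th - a q| < e].
  have [|th [_ th_cl]] := @segment_compact R (- pi) pi (a @ F) (fmap_proper_filter a PF).
    suff : F (a @^-1` `[- pi, pi]) by [].
    by apply: filterE => q; have [h _] := aP q; rewrite /= in_itv.
  (* If closeness to [th] failed on a large set, that set would contradict [th] being a cluster
     point. *)
  exists th => e e0; have [//|Fn] := in_ultra_setVsetC [set q | `|th - a q| < e] UF.
  have [|b [/= nb bb]] := th_cl [set b | ~ `|th - b| < e] (ball th e) Fn.
    exact: nbhsx_ballx.
  by have := nb bb.
have FA e : 0 < e -> F [set q | frobenius (rotation th - rotation (al (sval q).1)) < e].
  move=> e0; have [d d0 dP] := rotation_continuous th e0.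
  by apply: filterS (thP _ d0) => q /dP; have [_ ->] := aP q.
pose P := isometry_act (0, th) L.
have hP : hull T P.
  apply: hull_closure; first exact: is_tiling_act.
  move=> e e0; have [q [q1 q2]] := filter_ex (filterI (FL e^-1) (FA _ e0)).
  exists (sval q).1, (th - al (sval q).1); split; first exact: hN.
    rewrite (_ : isometry_act _ (sval q).1 = isometry_act (0, th) (N q)); first exact: agree_rotate.
    by rewrite isometry_act_comp; apply: isometry_act_eq; rewrite //= mulmx0 addr0.
  by rewrite -(rotation_shift _ _ (al (sval q).1)) subrK add0r.
have [i Li] : exists i, L (proto p i).
  have [q qL] := filter_ex (FL (2 * D)); have [i qi] := nrm_central (dN q).
  exists i; apply/qL => //; have pi0 : tile_support (proto p i) 0 by exact:
    nrm_puncture_support (hN q) qi.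
  by have := boundN _ _ _ qi pi0; rewrite frobenius0 add0r; exact: id.
have Pi : P (act_tile (0, th) (proto p i)) by exact/isometry_act_tile.
have dP : dh P.
  split=> //; exists (act_tile (0, th) (proto p i)) => //.
  by rewrite puncture_act isom_rot mulmx0.
have ea : rotation th = rotation (al P) by exact: central_angle_unique Pi.
have nP : nrm P = L.
  rewrite /nrm isometry_act_comp (isometry_act_eq (h := (0, 0)))//=.
  - by rewrite -translateE translate0.
  - by rewrite mulmx0 addr0.
  - by rewrite rotationD -(rotation_opp ea) -rotationD addNr.
have [u Lu uw] : exists2 u, L u & puncture u = w.
  have [q [qL qw]] := filter_ex (filterI (FL (frobenius w + 2 * D)) Fw).
  have [u qu uw] : exists2 u, N q u & puncture u = w.
    have := @nrm_ndisp _ _ _ _ std (sval q).1 (sval q).2; rewrite -surjective_pairing qw.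
    by apply; case: (q).
  exists u => //; apply/qL => //; rewrite -uw; apply: (boundN _ _ _ qu).
  exact: nrm_puncture_support (hN q) qu.
have [Q PQ ew] : exists2 Q, Rpunc T (P, Q) & ndisp (P, Q) = w.
  by rewrite -uw; apply: Rpunc_nrm => //; rewrite nP.
exists (exist _ (P, Q) PQ); split=> //= S /nbhs_pclose[e e0 eS].
apply: filterS (filterI (FL e^-1) (filterI (FA _ e0) Fw)) => q [q1 [q2 q3]].
by apply: eS; split; [split|]; rewrite //= ?nP -?ea// ew.
Qed.

Lemma closed_ndisp w : closed [set q : Rpunc_space T | ndisp (sval q) = w].
Proof.
move=> q /(_ [set q' | pclose 1 (sval q) (sval q')])[|q' [/= <- [_ ->]]]//.
by apply/nbhs_pclose; exists 1.
Qed.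

End Compactness.

(** * The character a ↦ e^{ia} and its integer powers *)

Section UnitCircle.
Context {R : realType}.
Implicit Types (a b : R).

Definition ez (a : R) : R[i] := Complex (cos a) (sin a).

Lemma ezD a b : ez (a + b) = ez a * ez b.
Proof. by apply/eqP; rewrite /ez cosD sinD eq_complex/= eqxx/= addrC mulrC [sin b * _]mulrC. Qed.

Lemma ez0 : ez 0 = 1.
Proof. by rewrite /ez cos0 sin0. Qed.

Lemma ez_unit a : ez a \is a GRing.unit.
Proof.
apply/unitrPr; exists (ez (- a)); by rewrite -ezD addrN ez0.
Qed.

Lemma ezXD a (k l : int) : ez a ^ (k + l) = ez a ^ k * ez a ^ l.
Proof. by apply: expfzDr; rewrite -unitfE ez_unit. Qed.

Lemma ezN a : ez (- a) = (ez a)^-1.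
Proof. by apply: (mulrI (ez_unit a)); rewrite divrr ?ez_unit// -ezD addrN ez0. Qed.

Lemma ez_conj a : conjc (ez a) = (ez a)^-1.
Proof. by rewrite -ezN /ez cosN sinN. Qed.

Lemma ez_rotation a b : rotation a = rotation b -> ez a = ez b.
Proof. by move=> /rotation_inj[ec es]; rewrite /ez ec es. Qed.

Lemma ez_conjX a (k : int) : conjc (ez a ^ k) = ez a ^ (- k).
Proof.
by rewrite -exprz_inv -ez_conj; exact: fmorphXz.
Qed.

Lemma ez_norm a : `|ez a| = 1.
Proof. by rewrite normc_def/= cos2Dsin2 sqrtr1. Qed.

Lemma ez_normX a (k : int) : `|ez a ^ k| = 1.
Proof. by case: k => m; rewrite ?NegzE -?exprnN ?normfV -?exprnP normrX ez_norm expr1n ?invr1. Qed.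

End UnitCircle.

(** Convolution sums range over whole equivalence classes; any list in the class that contains the
    support may replace the class. *)
Lemma fsum_seq (C : nmodType) (X : choiceType) (A : set X) (F : X -> C) (s : seq X) :
  uniq s -> (forall x, x \in s -> A x) -> (forall x, A x -> F x != 0 -> x \in s) ->
  \sum_(x \in A) F x = \sum_(x <- s) F x.
Proof.
move=> us sA As; have As' x : A x -> x \notin s -> F x = 0.
  by move=> Ax; apply: contraNeq => /(As _ Ax).
rewrite (fsbigE s F us sA As') [RHS]big_seq [LHS]big_seq_cond; apply: eq_bigl => x.
by case: (boolP (x \in s)) => //= /sA Ax; apply/asboolP.
Qed.

(** * Linear spans of sets of functions *)

Section Span.
Context {R : realType}.
Local Notation fn := (set (@tile R) -> set (@tile R) -> R[i]).
Implicit Types (f g : fn) (E : set fn).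

Lemma linear_span_zero E : linear_span E (@fn_zero R).
Proof.
exists 0%N, (fun=> 0), (fun=> fn_zero); split; first by case.
by apply/funext => P; apply/funext => S; rewrite big_ord0.
Qed.

Lemma linear_span_add E f g : linear_span E f -> linear_span E g -> linear_span E (fn_add f g).
Proof.
move=> [m [c [e [Ee ->]]]] [m' [c' [e' [Ee' ->]]]].
exists (m + m')%N, (fun i => match fintype.split i with inl j => c j | inr j => c' j end),
  (fun i => match fintype.split i with inl j => e j | inr j => e' j end); split.
  by move=> i; case: fintype.split.
apply/funext => P; apply/funext => S; rewrite /fn_add big_split_ord/=.
congr (_ + _); apply: eq_bigr => i _.
  by rewrite -[lshift _ _]/(unsplit (inl _)) unsplitK.
by rewrite -[rshift _ _]/(unsplit (inr _)) unsplitK.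
Qed.

Lemma linear_span_scale E c f : linear_span E f -> linear_span E (fn_scale c f).
Proof.
move=> [m [d [e [Ee ->]]]]; exists m, (fun i => c * d i), e; split=> //.
apply/funext => P; apply/funext => S; rewrite /fn_scale mulr_sumr.
by apply: eq_bigr => i _; rewrite mulrA.
Qed.

Lemma linear_span_gen E f : E f -> linear_span E f.
Proof.
move=> Ef; exists 1%N, (fun=> 1), (fun=> f); split=> //.
by apply/funext => P; apply/funext => S; rewrite big_ord1 mul1r.
Qed.

Lemma linear_span_sum E (X : Type) (s : seq X) (F : X -> fn) :
  (forall x, linear_span E (F x)) ->
  linear_span E (fun P S => \sum_(x <- s) F x P S).
Proof.
move=> EF; elim: s => [|x s IH].
  rewrite (_ : (fun _ => _) = fn_zero); first exact: linear_span_zero.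
  by apply/funext => P; apply/funext => S; rewrite big_nil.
rewrite (_ : (fun _ => _) = fn_add (F x) (fun P S => \sum_(x <- s) F x P S)).
  exact: linear_span_add.
by apply/funext => P; apply/funext => S; rewrite big_cons.
Qed.

Lemma linear_span_ind E (K : set fn) : K fn_zero ->
  (forall f g, K f -> K g -> K (fn_add f g)) -> (forall c f, E f -> K (fn_scale c f)) ->
  linear_span E `<=` K.
Proof.
move=> K0 KD KE _ [m [c [e [Ee ->]]]].
elim: m c e Ee => [|m IH] c e Ee.
  rewrite (_ : (fun _ => _) = fn_zero)//.
  by apply/funext => P; apply/funext => S; rewrite big_ord0.
rewrite (_ : (fun _ => _) = fn_add (fn_scale (c ord0) (e ord0))
   (fun P S => \sum_(i < m) c (lift ord0 i) * e (lift ord0 i) P S)); last first.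
  by apply/funext => P; apply/funext => S; rewrite big_ord_recl.
by apply: KD; [exact: KE | exact: IH].
Qed.

End Span.

(** * Convolution *)

Section Convolution.
Context {R : realType} {T : set (@tile R)} {n : nat} {p : 'I_n -> set 'cV[R]_2}.
Context {std : standing T p}.
Local Notation plane := 'cV[R]_2.
Local Notation tile := (@tile R).
Local Notation fn := (set tile -> set tile -> R[i]).
Local Notation dh := (discrete_hull T).
Local Notation al := (central_angle p).
Local Notation nrm := (nrm (p := p)).
Local Notation ndisp := (ndisp (p := p)).
Implicit Types (t u : tile) (P Q S : set tile) (f g : fn) (M : R).

Definition prow M P : set (set tile) :=
  [set S | Rpunc T (P, S) /\ frobenius (displacement (P, S)) < M].

Definition rowseq M P : seq (set tile) := finmap.enum_fset (fset_set (prow M P)).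

Lemma row_finite M P : finite_set (prow M P).
Proof.
have [dP|ndP] := pselect (dh P); last first.
  by rewrite (_ : prow M P = set0)// -subset0 => S [/Rpunc_dh1].
have [hP _] := dP.
apply: sub_finite_set (finite_image (fun t => translate P (- puncture t)) (puncture_finite M hP)).
by move=> S [/RpuncP[t [_ Pt -> ->]] tM]; exists t.
Qed.

Lemma rowseq_uniq M P : uniq (rowseq M P).
Proof. exact: finmap.fset_uniq. Qed.

Lemma rowseqP M P S : S \in rowseq M P <-> prow M P S.
Proof.
split=> [|h]; last by rewrite in_fset_set ?inE//; exact: row_finite.
by rewrite in_fset_set ?inE//; exact: row_finite.
Qed.

(** Distinct members of a row come from distinct tiles, so the puncture count applies, uniformly in
    [P] as the Schur test requires. *)
Lemma row_count M : exists N : nat, forall P (s : seq (set tile)), uniq s ->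
  {in s, forall S, prow M P S} -> (size s <= N)%N.
Proof.
have [N NP] := puncture_count M; exists N => P s us sP.
have [dP|ndP] := pselect (dh P); last first.
  by case: s us sP => // S s _ /(_ S); rewrite inE eqxx => /(_ isT)[/Rpunc_dh1].
have [hP _] := dP.
have /choice[F FP] : forall S, exists t, S \in s ->
    [/\ P t, frobenius (puncture t) < M & S = translate P (- puncture t)].
  move=> S; case: (boolP (S \in s)) => [Ss|]; last by exists (set0, 0).
  by have [/RpuncP[t [_ Pt e1 e2]]] := sP _ Ss; rewrite e1 => tM; exists t.
rewrite -(size_map F); apply: (NP P) => //.
  rewrite map_inj_in_uniq// => S S' /FP[_ _ e] /FP[_ _ e'] ee.
  by rewrite e e' ee.
by move=> _ /mapP[S Ss ->]; have [] := FP _ Ss.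
Qed.

(** Bounded displacement: it follows from compact support, makes every convolution sum finite, and
    is preserved by all the operations. *)
Definition row_bounded M f : Prop := forall P S, f P S != 0 -> prow M P S.

Lemma row_bounded_le M M' f : M <= M' -> row_bounded M f -> row_bounded M' f.
Proof. by move=> MM fM P S /fM[? h]; split=> //; exact: lt_le_trans MM. Qed.

Lemma row_bounded_add M M' f g : row_bounded M f -> row_bounded M' g ->
  row_bounded (Num.max M M') (fn_add f g).
Proof.
move=> fM gM P S; rewrite /fn_add; have [->|f0 _] := eqVneq (f P S) 0.
  by rewrite add0r => /(row_bounded_le _ gM); apply; rewrite le_max lexx orbT.
by apply: (row_bounded_le _ fM) => //; rewrite le_max lexx.
Qed.

Lemma row_bounded_scale M c f : row_bounded M f -> row_bounded M (fn_scale c f).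
Proof. by move=> fM P S; rewrite /fn_scale mulf_eq0 negb_or => /andP[_ /fM]. Qed.

Lemma row_bounded_star M f : row_bounded M f -> row_bounded M (fn_star f).
Proof.
move=> fM P S; rewrite /fn_star conjc_eq0 => /fM[SP SPM].
by have [PS e] := Rpunc_sym SP; split=> //; rewrite e frobeniusN.
Qed.

Lemma fn_mulE M f g P S : row_bounded M f ->
  fn_mul T f g P S = \sum_(Q <- rowseq M P) f P Q * g Q S.
Proof.
move=> fM; apply: fsum_seq; first exact: rowseq_uniq.
- by move=> Q /rowseqP[].
- by move=> Q _; rewrite mulf_eq0 negb_or => /andP[/fM/rowseqP].
Qed.

Lemma row_bounded_mul M M' f g : row_bounded M f -> row_bounded M' g ->
  row_bounded (M + M') (fn_mul T f g).
Proof.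
move=> fM gM P S; rewrite (fn_mulE _ _ _ fM) => /eqP h.
have [Q /andP[_]] : exists Q, (Q \in rowseq M P) && (f P Q * g Q S != 0).
  apply: contra_notP h => /forallNP h; rewrite big_seq big1// => Q Qr.
  by have /negP := h Q; rewrite Qr/= negbK => /eqP.
rewrite mulf_eq0 negb_or => /andP[/fM[PQ PQM] /gM[QS QSM]].
have [PS e] := Rpunc_trans PQ QS; split=> //; rewrite e.
by apply: le_lt_trans (frobenius_triangle _ _) _; exact: ltrD.
Qed.

Lemma fn_mulDl M M' f g h : row_bounded M f -> row_bounded M' g ->
  fn_mul T (fn_add f g) h = fn_add (fn_mul T f h) (fn_mul T g h).
Proof.
move=> fM gM; apply/funext => P; apply/funext => S.
have fM2 : row_bounded (Num.max M M') f by apply: row_bounded_le fM; rewrite le_max lexx.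
have gM2 : row_bounded (Num.max M M') g by apply: row_bounded_le gM; rewrite le_max lexx orbT.
rewrite /fn_add (fn_mulE _ _ _ (row_bounded_add fM gM)) (fn_mulE _ _ _ fM2) (fn_mulE _ _ _ gM2).
by rewrite -big_split; apply: eq_bigr => Q _; rewrite /= mulrDl.
Qed.

Lemma fn_mulDr M f g h : row_bounded M f ->
  fn_mul T f (fn_add g h) = fn_add (fn_mul T f g) (fn_mul T f h).
Proof.
move=> fM; apply/funext => P; apply/funext => S.
rewrite /fn_add !(fn_mulE _ _ _ fM) -big_split.
by apply: eq_bigr => Q _; rewrite /= mulrDr.
Qed.

Lemma fn_mulZl M c f g : row_bounded M f ->
  fn_mul T (fn_scale c f) g = fn_scale c (fn_mul T f g).
Proof.
move=> fM; apply/funext => P; apply/funext => S.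
rewrite (fn_mulE _ _ _ (row_bounded_scale (c := c) fM)) /fn_scale (fn_mulE _ _ _ fM) mulr_sumr.
by apply: eq_bigr => Q _; rewrite mulrA.
Qed.

Lemma fn_mulZr M c f g : row_bounded M f ->
  fn_mul T f (fn_scale c g) = fn_scale c (fn_mul T f g).
Proof.
move=> fM; apply/funext => P; apply/funext => S.
rewrite /fn_scale !(fn_mulE _ _ _ fM) mulr_sumr.
by apply: eq_bigr => Q _; rewrite mulrCA.
Qed.

Lemma fn_mul_single f g P Q S : Rpunc T (P, Q) -> (forall Q', f P Q' != 0 -> Q' = Q) ->
  fn_mul T f g P S = f P Q * g Q S.
Proof.
move=> PQ fQ; rewrite /fn_mul (@fsum_seq _ _ _ _ [:: Q]) ?big_seq1//.
  by move=> x; rewrite inE => /eqP ->.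
by move=> x _; rewrite mulf_eq0 negb_or inE => /andP[/fQ ->].
Qed.

Lemma fn_mul_zero f g P S : (forall Q, f P Q * g Q S = 0) -> fn_mul T f g P S = 0.
Proof. by move=> h; rewrite /fn_mul fsbig1. Qed.

(* In terms of the tiling turned so that its central tile is a proto-tile in
   standard position, the rotation in the definition of [Vset] disappears:
   see [Vset_Wset]. *)
Definition Wset (Q : set tile) (w : plane) : set (set tile * set tile) :=
  [set q | [/\ Rpunc T q, Q `<=` nrm q.1 & ndisp q = w]].

Definition wfun (k : int) (Q : set tile) (w : plane) : fn := fun P S =>
  if `[< Wset Q w (P, S) >] then ez (al P) ^ k else 0.

Lemma wfun_row_bounded k Q w : row_bounded (frobenius w + 1) (wfun k Q w).
Proof.
move=> P S; rewrite /wfun; case: ifPn => [/asboolP[PS _ e] _|]; last by rewrite eqxx.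
by split=> //; rewrite -(ndispK (p := p)) frobenius_rotation e ltrDl.
Qed.

Lemma fn_zpowE k P S : fn_zpow T p k P S =
  if `[< dh P /\ P = S >] then ez (al P) ^ k else 0.
Proof.
(* Convolving on the left with a function carried by the diagonal is multiplication by its value at
   the first argument. *)
have diag f g (c : R[i]) P' S' : (forall Q, f P' Q = if `[< dh P' /\ P' = Q >] then c else 0) ->
    fn_mul T f g P' S' = if `[< dh P' >] then c * g P' S' else 0.
  move=> fE; case: asboolP => [dP|ndP].
    rewrite (@fn_mul_single _ _ _ P'); first by rewrite fE; case: asboolP => // -[].
      by have [] := Rpunc_refl dP.
    by move=> Q; rewrite fE; case: asboolP => [[_ ->]//|_]; rewrite eqxx.
  by apply: fn_mul_zero => Q; rewrite fE; case: asboolP => [[]//|_]; rewrite mul0r.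
case: k => m.
  elim: m => [|m IH].
    by rewrite /fn_zpow/= /fn_unit expr0z.
  rewrite /fn_zpow iterS -[iter _ _ _]/(fn_zpow T p m) (diag _ _ (ez (al P)))//.
  rewrite IH; case: (asboolP (dh P)) => dP; last by case: asboolP => // -[].
  by case: asboolP => _; rewrite ?mulr0// exprSz.
have starE P' Q : fn_star (fn_z T p) P' Q =
    if `[< dh P' /\ P' = Q >] then (ez (al P'))^-1 else 0.
  rewrite /fn_star /fn_z; case: asboolP => [[dQ <-]|nQ].
    by case: asboolP => [_|[]//]; rewrite -/(ez _) ez_conj.
  by case: asboolP => [[dP e]|_]; [case: nQ; rewrite -e|rewrite conjc0].
rewrite /fn_zpow NegzE -exprz_inv.
elim: m.+1 => [|m' IH]; first by rewrite /= /fn_unit expr0z.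
rewrite iterS (diag _ _ (ez (al P))^-1)// IH.
case: (asboolP (dh P)) => dP; last by case: asboolP => // -[].
by case: asboolP => _; rewrite ?mulr0// exprSz.
Qed.

End Convolution.

(** * The generators in normalised form *)

Section Generators.
Context {R : realType} {T : set (@tile R)} {n : nat} {p : 'I_n -> set 'cV[R]_2}.
Context {std : standing T p}.
Local Notation plane := 'cV[R]_2.
Local Notation tile := (@tile R).
Local Notation fn := (set tile -> set tile -> R[i]).
Local Notation dh := (discrete_hull T).
Local Notation al := (central_angle p).
Local Notation nrm := (nrm (p := p)).
Local Notation ndisp := (ndisp (p := p)).
Local Notation Wset := (Wset (T := T) (p := p)).
Local Notation wfun := (wfun (T := T) (p := p)).
Local Notation span := (linear_span (generators T p)).
Implicit Types (t u : tile) (P Q S : set tile) (f g : fn) (k l : int) (w : plane).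

(** Only the tiling at normalised displacement [w] can be the intermediate point, and it exists once
    [Q] occurs, because [Q] has a tile there. Seen from the first tiling, the patch [Q'] is moved by
    the frame [h], and the angle of the intermediate tiling exceeds the first by [h.2]. *)
Lemma wfun_mul k Q w l Q' w' h i : Q (act_tile h (proto p i)) -> w = isom h 0 ->
  fn_mul T (wfun k Q w) (wfun l Q' w') =
  fn_scale (ez h.2 ^ l) (wfun (k + l) (Q `|` isometry_act h Q') (isom h w')).
Proof.
move=> Qh ew; apply/funext => P; apply/funext => S; rewrite /fn_scale {3}/wfun.
have [[S3 [PS3 QP e3]]|nS3] :=
    pselect (exists S3, [/\ Rpunc T (P, S3), Q `<=` nrm P & ndisp (P, S3) = w]); last first.
  rewrite fn_mul_zero; last first.
    move=> S3; rewrite {1}/wfun; case: asboolP => [W|_]; last by rewrite mul0r.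
    by case: nS3; exists S3.
  case: asboolP => [[PS QP e]|_]; last by rewrite mulr0.
  case: nS3; have QP' : Q `<=` nrm P by move=> t Qt; apply: QP; left.
  have [S3 PS3 e3] := Rpunc_nrm (Rpunc_dh1 PS) (QP' _ Qh).
  by exists S3; split=> //; rewrite e3 ew puncture_act.
rewrite (fn_mul_single _ _ PS3); last first.
  move=> S3'; rewrite /wfun; case: asboolP => [[PS3' _ e3'] _|_]; last by rewrite eqxx.
  by apply: (ndisp_inj PS3' PS3); rewrite e3 e3'.
have Ph := QP _ Qh; have e3h : ndisp (P, S3) = isom h 0 by rewrite e3.
have [ea eN] := nrm_shift PS3 Ph e3h.
have -> : wfun k Q w P S3 = ez (al P) ^ k by rewrite /wfun; case: asboolP => // -[].
have WW : Wset Q' w' (S3, S) <-> Wset (Q `|` isometry_act h Q') (isom h w') (P, S).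
  split=> [[S3S Q'S e]|[PS QQ' e]].
    have [PS _] := Rpunc_trans PS3 S3S; split=> //=; last first.
      by rewrite (ndisp_trans PS3 S3S Ph e3h) e.
    move=> t [/QP//|]; rewrite isometry_actE => -[u Q'u <-].
    have := Q'S _ Q'u; rewrite /= eN isometry_actE => -[v Pv <-].
    by rewrite act_tileVK.
  have [S3P _] := Rpunc_sym PS3; have [S3S _] := Rpunc_trans S3P PS.
  split=> //=; last first.
    by apply: (can_inj (isomK h)); rewrite -(ndisp_trans PS3 S3S Ph e3h).
  move=> t Q't; rewrite eN isometry_actE; exists (act_tile h t); last exact: act_tileK.
  by apply: QQ'; right; exact/isometry_act_tile.
rewrite /wfun; case: asboolP => [/WW W|nW].
  case: asboolP => // _; rewrite (ez_rotation ea) ezD exprzMl ?ez_unit//.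
  by rewrite ezXD mulrA mulrC.
by case: asboolP => [/WW//|_]; rewrite !mulr0.
Qed.

Lemma Wset_sym Q w h i P S : Q (act_tile h (proto p i)) -> w = isom h 0 ->
  Wset Q w (S, P) ->
  Wset (isometry_act (isom_inv h) Q) (isom (isom_inv h) 0) (P, S) /\
  rotation (al P) = rotation (al S + h.2).
Proof.
move=> Qh ew [SP QS e]; have [PS _] := Rpunc_sym SP; have Sh := QS _ Qh.
have eh : ndisp (S, P) = isom h 0 by rewrite e.
have [ea eN] := nrm_shift SP Sh eh; split=> //; split=> //=; last exact: ndisp_sym SP Sh eh.
by rewrite eN; exact: isometry_act_subset.
Qed.

Lemma wfun_star k Q w h i j : Q (act_tile h (proto p i)) -> Q (proto p j) -> w = isom h 0 ->
  fn_star (wfun k Q w) =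
  fn_scale (ez h.2 ^ k) (wfun (- k) (isometry_act (isom_inv h) Q) (isom (isom_inv h) 0)).
Proof.
move=> Qh Qj ew; apply/funext => P; apply/funext => S; rewrite /fn_scale /fn_star.
rewrite /wfun; case: asboolP => [/(Wset_sym Qh ew)[W ea]|nW].
  case: asboolP => // _; rewrite ez_conjX (ez_rotation ea) ezD exprzMl ?ez_unit//.
  by rewrite mulrCA -ezXD subrr expr0z mulr1.
case: asboolP => [W|_]; last by rewrite conjc0 mulr0.
case: nW; set Q' := isometry_act _ Q in W.
(* For the converse [Wset_sym] is applied in the inverse frame, where the former central proto-tile
   is the tile at the displacement. *)
have Q'j : Q' (act_tile (isom_inv h) (proto p j)).
  by rewrite /Q' isometry_actE; exists (proto p j).
have [+ _] := Wset_sym Q'j erefl W.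
by rewrite isom_invK /Q' isometry_actVK -ew.
Qed.

(** The rotation in [Vset] is forced: it makes [t] the central tile, so [th + h.2] is the central
    angle modulo 2π. *)
Lemma Vset_Wset P0 t t' h i : P0 t -> P0 t' -> t = act_tile h (proto p i) ->
  Vset T P0 t t' = Wset (isometry_act (isom_inv h) P0) (isom (isom_inv h) (puncture t')).
Proof.
move=> P0t P0t' et; set Q := isometry_act _ _; set w := isom _ _.
have QE th : rotate th (translate P0 (- puncture t)) = isometry_act (0, th + h.2) Q.
  rewrite rotateE translateE /Q !isometry_act_comp; apply: isometry_act_eq => /=; last first.
    by rewrite addr0 addrK.
  rewrite oppr0 rotation0v addr0 opprK mulmx0 addr0 et puncture_act.
  by rewrite /isom add0r.
have wE th : rotation th *m (puncture t' - puncture t) = rotation (th + h.2) *m w.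
  rewrite /w /isom/= rotationDv rotationKN; congr (_ *m (_ - _)).
  by rewrite et puncture_act /isom add0r.
have Qi : Q (proto p i).
  by rewrite /Q isometry_actE; exists t => //; rewrite et act_tileK.
have [u Qu uw] : exists2 u, Q u & puncture u = w.
  by rewrite /Q isometry_actE; exists (act_tile (isom_inv h) t') => //; exists t'.
apply/seteqP; split=> -[P S] [PS].
  move=> /= [th []]; rewrite QE wE => QP eS; have dP := Rpunc_dh1 PS; have [hP _] := dP.
  have ea : rotation (th + h.2) = rotation (al P).
    by apply: (central_angle_unique (i := i) dP); apply: QP; exact/isometry_act_tile.
  have QP' : isometry_act (0, al P) Q `<=` P.
    by rewrite -(isometry_act_eq (g := (0, th + h.2))).
  split=> //=; first by move=> v Qv; apply/nrmP/QP'/isometry_act_tile.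
  have Pu : P (act_tile (0, al P) u) by apply/QP'/isometry_act_tile.
  rewrite /ndisp/= eS ea (_ : _ *m w = puncture (act_tile (0, al P) u)); last first.
    by rewrite puncture_act isom_rot uw.
  by rewrite displacementE// puncture_act isom_rot rotationNK.
move=> /= QP e; split=> //; exists (al P - h.2); rewrite QE wE subrK /=; split.
  by move=> v /isometry_actP/QP/nrmP; rewrite act_tileVK.
by rewrite -e (ndispK (P, S)); exact: Rpunc_displacement.
Qed.

Lemma fn_zpow_e k P0 t t' h i : P0 t -> P0 t' -> t = act_tile h (proto p i) ->
  fn_mul T (fn_zpow T p k) (fn_e T P0 t t') =
  wfun k (isometry_act (isom_inv h) P0) (isom (isom_inv h) (puncture t')).
Proof.
move=> P0t P0t' et; apply/funext => P; apply/funext => S.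
rewrite /wfun -(Vset_Wset P0t P0t' et) /fn_e.
have [dP|ndP] := pselect (dh P); last first.
  case: asboolP => [[/Rpunc_dh1]//|_]; apply: fn_mul_zero => Q.
  by rewrite fn_zpowE; case: asboolP => [[]//|_]; rewrite mul0r.
rewrite (fn_mul_single _ _ (Rpunc_refl dP).1); last first.
  by move=> Q; rewrite fn_zpowE; case: asboolP => [[]//|_]; rewrite eqxx.
rewrite fn_zpowE; case: asboolP => [_|[]//].
by case: asboolP; rewrite ?mulr1 ?mulr0.
Qed.

(* The case where [Wset Q w] is empty, so that [wfun k Q w] need not be one of
   the generators, is covered because the function then vanishes. *)
Lemma wfun_span k Q w u i : finite_set Q -> Q (proto p i) -> Q u -> puncture u = w ->
  span (wfun k Q w).
Proof.
move=> fQ Qi Qu uw; have [[[P S] W]|nW] := pselect (exists q, Wset Q w q); last first.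
  rewrite (_ : wfun k Q w = fn_zero); first exact: linear_span_zero.
  apply/funext => P; apply/funext => S; rewrite /wfun; case: asboolP => // W.
  by case: nW; exists (P, S).
have [PS QP e] := W; have dP := Rpunc_dh1 PS; rewrite /= in QP.
apply: linear_span_gen.
exists k, (isometry_act (0, al P) Q), (act_tile (0, al P) (proto p i)), (act_tile (0, al P) u).
split; first 1 last.
- exact/isometry_act_tile.
- exact/isometry_act_tile.
- rewrite (fn_zpow_e _ (h := (0, al P)) (i := i))//; first last.
  + exact/isometry_act_tile.
  + exact/isometry_act_tile.
  by rewrite isometry_actK puncture_act isomK uw.
exists P => //; split; first exact: isometry_act_finite.
by move=> t /isometry_actP/QP/nrmP; rewrite act_tileVK.
Qed.

(** [Q] is not asked to occur in a tiling, so that the unions arising from products stay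
    admissible. *)
Definition admissible (Q : set tile) (w : plane) : Prop := exists h i j,
  [/\ finite_set Q, Q (proto p j), Q (act_tile h (proto p i)) & w = isom h 0].

Lemma admissible_span k Q w : admissible Q w -> span (wfun k Q w).
Proof. by move=> [h [i [j [fQ Qj Qh ->]]]]; exact: (wfun_span k fQ Qj Qh). Qed.

Lemma generators_wfun f : generators T p f -> exists k Q w, admissible Q w /\ f = wfun k Q w.
Proof.
move=> [k [P0 [t [t' [[P dP [fP0 P0P]] P0t P0t' ->]]]]]; have [hP _] := dP.
have [h [i et]] := hull_prototile hP (P0P _ P0t).
have [h' [j et']] := hull_prototile hP (P0P _ P0t').
rewrite (fn_zpow_e k P0t P0t' et).
eexists; eexists; eexists; split; last reflexivity.
exists (isom_comp (isom_inv h) h'), j, i; split.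
- exact: isometry_act_finite.
- by rewrite isometry_actE; exists t => //; rewrite et act_tileK.
- by rewrite isometry_actE; exists t' => //; rewrite et' act_tile_comp.
- by rewrite -isom_compE et' puncture_act.
Qed.

Lemma span_row_bounded f : span f -> exists M, row_bounded (T := T) M f.
Proof.
apply: (linear_span_ind (K := fun f => exists M, row_bounded (T := T) M f)).
- by exists 0 => P S; rewrite eqxx.
- by move=> {}f g [M fM] [M' gM]; eexists; exact: row_bounded_add fM gM.
- move=> c {}f /generators_wfun[k [Q [w [_ ->]]]]; eexists.
  by apply: row_bounded_scale; exact: wfun_row_bounded.
Qed.

Lemma span_mul f g : span f -> span g -> span (fn_mul T f g).
Proof.
move=> Sf Sg; suff [] : span f /\ span (fn_mul T f g) by [].
(* Membership of [f] itself is carried along because distributivity on the left needs row bounds for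
   the summands. *)
apply: (linear_span_ind (K := fun f => span f /\ span (fn_mul T f g)) _ _ _ Sf).
- split; first exact: linear_span_zero.
  rewrite (_ : fn_mul T _ g = fn_zero); first exact: linear_span_zero.
  by apply/funext => P; apply/funext => S; apply: fn_mul_zero => Q; rewrite mul0r.
- move=> f1 f2 [S1 S1g] [S2 S2g]; split; first exact: linear_span_add.
  have [M1 b1] := span_row_bounded S1; have [M2 b2] := span_row_bounded S2.
  by rewrite (fn_mulDl _ b1 b2); exact: linear_span_add.
move=> c e /generators_wfun[k [Q [w [adm ->]]]]; split.
  exact: linear_span_scale (admissible_span k adm).
rewrite (fn_mulZl _ _ (wfun_row_bounded (k := k) (Q := Q) (w := w))); apply: linear_span_scale.
move: g Sg; apply: (linear_span_ind (K := fun g => span (fn_mul T (wfun k Q w) g))).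
- rewrite (_ : fn_mul T _ _ = fn_zero); first exact: linear_span_zero.
  by apply/funext => P; apply/funext => S; apply: fn_mul_zero => Q'; rewrite mulr0.
- move=> g1 g2 S1 S2.
  rewrite (fn_mulDr _ _ (wfun_row_bounded (k := k) (Q := Q) (w := w))).
  exact: linear_span_add.
move=> d e' /generators_wfun[l [Q' [w' [adm' ->]]]].
rewrite (fn_mulZr _ _ (wfun_row_bounded (k := k) (Q := Q) (w := w))).
apply: linear_span_scale; have [h [i [j [fQ Qj Qh ew]]]] := adm.
rewrite (wfun_mul _ _ _ _ Qh ew); apply: linear_span_scale; apply: admissible_span.
have [h' [i' [j' [fQ' Qj' Qh' ew']]]] := adm'.
exists (isom_comp h h'), i', j; split.
- by rewrite finite_setU; split=> //; exact: isometry_act_finite.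
- by left.
- by right; rewrite isometry_actE; exists (act_tile h' (proto p i')) => //; exact: act_tile_comp.
- by rewrite ew' isom_compE.
Qed.

Lemma span_star f : span f -> span (fn_star f).
Proof.
apply: (linear_span_ind (K := fun f => span (fn_star f))).
- rewrite (_ : fn_star _ = fn_zero); first exact: linear_span_zero.
  by apply/funext => P; apply/funext => S; rewrite /fn_star conjc0.
- move=> {}f g Sf Sg; rewrite (_ : fn_star _ = fn_add (fn_star f) (fn_star g)).
    exact: linear_span_add.
  by apply/funext => P; apply/funext => S; rewrite /fn_star /fn_add; exact: rmorphD.
move=> c {}f /generators_wfun[k [Q [w [adm ->]]]].
rewrite (_ : fn_star _ = fn_scale (conjc c) (fn_star (wfun k Q w))); last first.
  by apply/funext => P; apply/funext => S; rewrite /fn_star /fn_scale; exact: rmorphM.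
apply: linear_span_scale; have [h [i [j [fQ Qj Qh ew]]]] := adm.
rewrite (wfun_star _ Qh Qj ew); apply: linear_span_scale; apply: admissible_span.
exists (isom_inv h), j, i; split=> //.
- exact: isometry_act_finite.
- by rewrite isometry_actE; exists (act_tile h (proto p i)) => //; exact: act_tileK.
- by rewrite isometry_actE; exists (proto p j).
Qed.

End Generators.

(** * The complex modulus as a real number *)

Section Modulus.
Context {R : realType}.
Implicit Types (x y : R[i]).

Definition cabs (x : R[i]) : R := Num.sqrt (complex.Re x ^+ 2 + complex.Im x ^+ 2).

Lemma cabsE x : `|x| = (cabs x)%:C%C.
Proof. exact: normc_def. Qed.

Lemma cabs_ge0 x : 0 <= cabs x.
Proof. exact: sqrtr_ge0. Qed.

Lemma cabs_triangle x y : cabs (x + y) <= cabs x + cabs y.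
Proof. by rewrite -lecR rmorphD/= -!cabsE ler_normD. Qed.

Lemma cabsM x y : cabs (x * y) = cabs x * cabs y.
Proof. by apply: complexI; rewrite rmorphM/= -!cabsE normrM. Qed.

Lemma cabsN x : cabs (- x) = cabs x.
Proof. by apply: complexI; rewrite -!cabsE normrN. Qed.

Lemma cabsB x y : cabs (x - y) = cabs (y - x).
Proof. by rewrite -cabsN opprB. Qed.

Lemma cabs0 : cabs 0 = 0.
Proof. by apply: complexI; rewrite -!cabsE normr0. Qed.

Lemma cabs1 : cabs 1 = 1.
Proof. by apply: complexI; rewrite -!cabsE normr1. Qed.

Lemma cabs_conj x : cabs (conjc x) = cabs x.
Proof. by apply: complexI; rewrite -!cabsE normcJ. Qed.

Lemma cabs_real (r : R) : cabs r%:C%C = `|r|.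
Proof. by rewrite /cabs/= expr0n/= addr0 sqrtr_sqr. Qed.

Lemma cabs_sum (X : Type) (s : seq X) (F : X -> R[i]) :
  cabs (\sum_(i <- s) F i) <= \sum_(i <- s) cabs (F i).
Proof.
elim/big_rec2: _ => [|i y1 y2 _ h]; first by rewrite cabs0.
by apply: le_trans (cabs_triangle _ _) _; rewrite lerD2l.
Qed.

Lemma sqr_cabs x : cabs x ^+ 2 = complex.Re x ^+ 2 + complex.Im x ^+ 2.
Proof. by rewrite sqr_sqrtr// addr_ge0 ?sqr_ge0. Qed.

Lemma mul_conjc x : conjc x * x = (cabs x ^+ 2)%:C%C.
Proof. by rewrite mulrC -sqr_normc cabsE -rmorphXn. Qed.

Lemma cabs_ez (a : R) : cabs (ez a) = 1.
Proof. by rewrite /cabs/= cos2Dsin2 sqrtr1. Qed.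

Lemma cabs_ezX (a : R) (k : int) : cabs (ez a ^ k) = 1.
Proof. by apply: complexI; rewrite -!cabsE ez_normX. Qed.

End Modulus.

(** * Compactly supported functions *)

Section CompactSupport.
Context {R : realType} {T : set (@tile R)} {n : nat} {p : 'I_n -> set 'cV[R]_2}.
Context {std : standing T p}.
Local Notation plane := 'cV[R]_2.
Local Notation tile := (@tile R).
Local Notation fn := (set tile -> set tile -> R[i]).
Local Notation dh := (discrete_hull T).
Local Notation al := (central_angle p).
Local Notation nrm := (nrm (p := p)).
Local Notation ndisp := (ndisp (p := p)).
Local Notation pclose := (pclose (p := p)).
Local Notation span := (linear_span (generators T p)).
Local Notation wfun := (wfun (T := T) (p := p)).
Local Notation on f := (fun q : Rpunc_space T => f (sval q).1 (sval q).2 : R[i]^o).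
Local Notation supp f := [set q : Rpunc_space T | f (sval q).1 (sval q).2 != 0].
Implicit Types (t u : tile) (P Q S : set tile) (f g : fn) (w : plane).

Lemma continuous_pclose f : continuous (on f) <->
  forall (q : Rpunc_space T) (e : R), 0 < e -> exists2 d, 0 < d &
    forall q' : Rpunc_space T, pclose d (sval q) (sval q') -> cabs (on f q - on f q') < e.
Proof.
split=> [cf q e e0|h q].
  have /cvgrPdist_lt/(_ e%:C%C) := cf q; rewrite ltcR => /(_ e0) /nbhs_pclose[d d0 dP].
  by exists d => // q' /dP/=; rewrite cabsE ltcR.
have FF : Filter (nbhs q) by exact: nbhs_filter.
(* Here [e] is a positive element of [R[i]], hence real; its real part is the tolerance. *)
apply: (proj2 (@cvgrPdist_lt _ _ _ (nbhs q) FF (on f) (on f q))) => e; rewrite ltcE/= =>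
  /andP[/eqP ie re].
have [d d0 dP] := h q _ re; apply/nbhs_pclose; exists d => // q' /dP.
by rewrite /= cabsE ltcE/= ie eqxx.
Qed.

Lemma Cc_zero : Cc T (@fn_zero R).
Proof.
split=> //; first by apply/continuous_pclose => q e e0; exists 1 => // q' _; rewrite subrr cabs0.
rewrite (_ : [set q | _] = set0); first by rewrite closure0; exact: compact0.
by rewrite -subset0 => q /=; rewrite eqxx.
Qed.

Lemma Cc_add f g : Cc T f -> Cc T g -> Cc T (fn_add f g).
Proof.
move=> [f0 cf kf] [g0 cg kg]; split.
- by move=> P S h; rewrite /fn_add f0// g0// addr0.
- apply/continuous_pclose => q e e0; have e20 : 0 < e / 2 by rewrite divr_gt0.
  have [d d0 dP] := (continuous_pclose f).1 cf q _ e20.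
  have [d' d'0 d'P] := (continuous_pclose g).1 cg q _ e20.
  have m0 : 0 < Num.min d d' by rewrite lt_min d0.
  exists (Num.min d d') => // q' qq'.
  have /dP h1 : pclose d (sval q) (sval q') by apply: pclose_le qq' => //; rewrite ge_min lexx.
  have /d'P h2 : pclose d' (sval q) (sval q').
    by apply: pclose_le qq' => //; rewrite ge_min lexx orbT.
  rewrite /fn_add opprD addrACA; apply: le_lt_trans (cabs_triangle _ _) _.
  by rewrite [e]splitr ltrD.
apply: (subclosed_compact _ (compactU kf kg)); first exact: closed_closure.
rewrite -closureU; apply: closure_subset => q; rewrite /fn_add /=.
have [->|] := eqVneq (f (sval q).1 (sval q).2) 0; last by left.
by rewrite add0r; right.
Qed.

Lemma Cc_scale c f : Cc T f -> Cc T (fn_scale c f).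
Proof.
move=> [f0 cf kf]; split.
- by move=> P S h; rewrite /fn_scale f0// mulr0.
- apply/continuous_pclose => q e e0.
  have c1 : 0 < cabs c + 1 by rewrite ltr_wpDl// cabs_ge0.
  have [|d d0 dP] := (continuous_pclose f).1 cf q (e / (cabs c + 1)); first by rewrite divr_gt0.
  exists d => // q' /dP; rewrite /fn_scale -mulrBr cabsM ltr_pdivlMr// => h.
  by apply: le_lt_trans h; rewrite mulrC ler_wpM2l ?cabs_ge0// lerDl.
apply: (subclosed_compact _ kf); first exact: closed_closure.
by apply: closure_subset => q; rewrite /fn_scale /= mulf_eq0 negb_or => /andP[].
Qed.

Lemma finite_bounded Q : finite_set Q -> (forall t, Q t -> exists r : R, tile_support t `<=`
  eball 0 r) ->
  exists2 d : R, 0 < d & forall t, Q t -> tile_support t `<=` eball 0 d^-1.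
Proof.
move=> fQ /= bQ; have /choice[r rP] : forall t, exists r : R, Q t -> tile_support t `<=` eball 0 r.
  by move=> t; have [/bQ[r h]|nQ] := pselect (Q t); [exists r|exists 0].
have [s Qs] := (finite_seqP Q).1 fQ.
have m0 : 0 < 1 + \sum_(t <- s) `|r t| by rewrite ltr_pwDl// sumr_ge0.
exists (1 + \sum_(t <- s) `|r t|)^-1; first by rewrite invr_gt0.
move=> t Qt; rewrite invrK; apply: subset_trans (rP t Qt) (eball_subset _).
have ts : t \in s by rewrite Qs in Qt.
rewrite (big_rem t)//= addrCA; apply: le_trans (ler_norm _) _.
by rewrite lerDl addr_ge0// sumr_ge0.
Qed.

Lemma ez_lipschitz (a b : R) : cabs (ez a - ez b) <= frobenius (rotation a - rotation b).
Proof.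
rewrite frobenius_rotationB /cabs/= -[leLHS]mul1r ler_wpM2r ?sqrtr_ge0//.
by rewrite -[leLHS]sqrtr1 ler_wsqrtr// ler1n.
Qed.

(** Nonnegative powers are Lipschitz since the values have modulus 1; negative powers are their
    conjugates. *)
Lemma ezX_continuous (k : int) (a e : R) : 0 < e -> exists2 d : R, 0 < d &
  forall b, frobenius (rotation a - rotation b) < d -> cabs (ez a ^ k - ez b ^ k) < e.
Proof.
move=> e0; have nat_case m : exists2 d : R, 0 < d &
    forall b, frobenius (rotation a - rotation b) < d -> cabs (ez a ^+ m - ez b ^+ m) < e.
  have h b : cabs (ez a ^+ m - ez b ^+ m) <= m%:R * frobenius (rotation a - rotation b).
    elim: m => [|m IH]; first by rewrite !expr0 subrr cabs0 mul0r.
    rewrite !exprS -[ez a * _](subrK (ez a * ez b ^+ m)) -mulrBr -addrA -mulrBl.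
    apply: le_trans (cabs_triangle _ _) _; rewrite !cabsM cabs_ez mul1r -natr1 mulrDl mul1r.
    apply: lerD => //; rewrite [cabs (_ ^+ m)](cabs_ezX b m) mulr1; exact: ez_lipschitz.
  exists (e / (m%:R + 1)); first by rewrite divr_gt0// ltr_wpDl.
  move=> b; rewrite ltr_pdivlMr ?ltr_wpDl// => hb; apply: le_lt_trans (h b) _.
  by apply: le_lt_trans hb; rewrite mulrC ler_wpM2l ?frobenius_ge0// lerDl.
case: k => m; first exact: nat_case.
have [d d0 dP] := nat_case m.+1; exists d => // b /dP.
by rewrite NegzE -!ez_conjX -!exprnP -rmorphB cabs_conj.
Qed.

Lemma wfun_Cc k Q w : admissible (p := p) Q w -> Cc T (wfun k Q w).
Proof.
move=> [h [i [j [fQ Qj Qh ew]]]].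
split.
- by move=> P S nR; rewrite /wfun; case: asboolP => // -[].
- apply/continuous_pclose => q e e0.
  (* If some tile of [Q] is unbounded, [Q] lies in no tiling and the function is zero. Otherwise
     agreement on a ball containing [Q] decides membership in [Wset]. *)
  have [bQ|nbQ] := pselect (forall t, Q t -> exists r : R, tile_support t `<=` eball 0 r); last
    first.
    have W0 (q' : Rpunc_space T) : ~ Wset (T := T) (p := p) Q w ((sval q').1, (sval q').2).
      move=> [PS QP _]; apply: nbQ => t /QP /= Pt; have [hP _] := Rpunc_dh1 PS.
      have [_ + _ _] := nrm_tiling (p := p) hP => /(_ _ Pt)[[r hr] _ _].
      by exists r.
    exists 1 => // q' _; rewrite /wfun; case: asboolP => [/W0//|_].
    by case: asboolP => [/W0//|_]; rewrite subrr cabs0.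
  have [d d0 dP] := finite_bounded fQ bQ.
  have [d' d'0 d'P] := ezX_continuous k (al (sval q).1) e0.
  have m0 : 0 < Num.min d d' by rewrite lt_min d0.
  have mE (r r' : R) : 0 < r -> 0 < r' -> r <= r' -> r'^-1 <= r^-1.
    by move=> r0 r'0; rewrite lef_pV2.
  exists (Num.min d d') => // -[[P' S'] R'] /=; case: q d'P => -[P S] R0 /= d'P.
  move=> [[ag an] en]; rewrite /= in ag an en.
  have QQ : Q `<=` nrm P <-> Q `<=` nrm P'.
    have md : d^-1 <= (Num.min d d')^-1 by apply: mE => //; rewrite ge_min lexx.
    split=> QP t Qt; apply/(ag t); try exact: QP.
      by apply: subset_trans (dP _ Qt) (eball_subset md).
    by apply: subset_trans (dP _ Qt) (eball_subset md).
  have WW : Wset (T := T) (p := p) Q w (P, S) <-> Wset (T := T) (p := p) Q w (P', S').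
    by split=> -[R1 /= QP e1]; split=> //=; try exact/QQ; rewrite -?en// en.
  rewrite /wfun; case: asboolP => [/WW W|nW].
    case: asboolP => // _; apply: d'P; apply: lt_le_trans an _.
    by rewrite ge_min lexx orbT.
  by case: asboolP => [/WW//|_]; rewrite subrr cabs0.
have kw := @compact_ndisp R T n p std w.
apply: (subclosed_compact _ kw); first exact: closed_closure.
have /closure_id -> := @closed_ndisp R T n p std w.
apply: closure_subset => -[[P S] R0] /=; rewrite /wfun.
by case: asboolP => [[]//|_]; rewrite eqxx.
Qed.

Lemma span_Cc : span `<=` Cc T.
Proof.
apply: linear_span_ind; [exact: Cc_zero|exact: Cc_add|].
by move=> c f /generators_wfun[k [Q [w [adm ->]]]]; apply: Cc_scale; exact: wfun_Cc.
Qed.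

(** The length of the displacement equals that of the normalised one, which is locally constant,
    hence bounded on a compact set. *)
Lemma Cc_row_bounded f : Cc T f -> exists M, row_bounded (T := T) M f.
Proof.
move=> [f0 cf kf].
have [|M [_ hM]] := (compact_near_coveringP _).1 kf R +oo%R
    (fun M q => frobenius (displacement (sval q)) < M) _.
  move=> q _; exists ([set q' | pclose 1 (sval q) (sval q')], [set M | frobenius (displacement
    (sval q)) < M]) => /=.
    split; first by apply/nbhs_pclose; exists 1.
    by exists (frobenius (displacement (sval q))); split=> //; exact: num_real.
  move=> [q' M] /= [[_ e] h]; rewrite -(ndispK (p := p)) frobenius_rotation -e.
  by rewrite -(frobenius_rotation (al (sval q).1)) ndispK.
exists (M + 1) => P S fPS; have PS : Rpunc T (P, S).
  by apply: contrapT => /f0 e; rewrite e eqxx in fPS.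
split=> //; have := hM (M + 1); rewrite ltrDl ltr01 => /(_ isT (exist _ (P, S) PS)); apply.
exact: subset_closure.
Qed.

Lemma Cc_bounded f : Cc T f -> exists2 B : R, 0 < B & forall P S, cabs (f P S) <= B.
Proof.
move=> [f0 cf kf].
have [|M [_ hM]] := (compact_near_coveringP _).1 kf R +oo%R
    (fun M q => cabs (f (sval q).1 (sval q).2) < M) _.
  move=> q _; have [d d0 dP] := (continuous_pclose f).1 cf q 1 ltr01.
  exists ([set q' | pclose d (sval q) (sval q')], [set M | cabs (f (sval q).1 (sval q).2) + 1 <
    M]) => /=.
    split; first by apply/nbhs_pclose; exists d.
    by exists (cabs (f (sval q).1 (sval q).2) + 1); split=> //; exact: num_real.
  move=> [q' M] /= [/dP h1 h2]; apply: le_lt_trans h2.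
  rewrite -[X in cabs X <= _](subrK (f (sval q).1 (sval q).2)).
  apply: le_trans (cabs_triangle _ _) _; rewrite addrC lerD2l cabsB; exact: ltW.
have B0 : 0 < `|M| + 1 by rewrite ltr_wpDl.
exists (`|M| + 1) => // P S; have [->|fPS] := eqVneq (f P S) 0; first by rewrite cabs0 ltW.
have PS : Rpunc T (P, S) by apply: contrapT => /f0 e; rewrite e eqxx in fPS.
apply: ltW; have := hM (`|M| + 1); rewrite (le_lt_trans (ler_norm M)) ?ltrDl// => /(_ isT
  (exist _ (P, S) PS)); apply.
exact: subset_closure.
Qed.

Lemma Cc_uniformly_continuous f (e : R) : Cc T f -> 0 < e -> exists2 d, 0 < d &
  forall P S P' S', Rpunc T (P, S) -> Rpunc T (P', S') -> pclose d (P, S) (P', S') ->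
    cabs (f P S - f P' S') < e.
Proof.
move=> [f0 cf kf] e0; have e20 : 0 < e / 2 by rewrite divr_gt0.
have [|d /= d0 hd] := (compact_near_coveringP _).1 kf R (0^'+)
    (fun d q => forall q' : Rpunc_space T, pclose d (sval q) (sval q') -> cabs (on f q - on f
      q') < e) _.
  move=> q _; have [d d0 dP] := (continuous_pclose f).1 cf q _ e20.
  have d20 : 0 < d / 2 by rewrite divr_gt0.
  exists ([set q' | pclose (d / 2) (sval q) (sval q')], [set d' | 0 < d' < d / 2]) => /=.
    split; first by apply/nbhs_pclose; exists (d / 2).
    exists (d / 2) => //= d' /=; rewrite sub0r normrN => h d'0.
    by rewrite d'0 (le_lt_trans (ler_norm _) h).
  move=> [q' d'] /= [qq' /andP[d'0 d'd]] q'' q'q''.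
  have h1 : cabs (on f q - on f q') < e / 2.
    by apply: dP; apply: pclose_le qq' => //; lra.
  have h2 : cabs (on f q - on f q'') < e / 2.
    apply: dP; rewrite [d]splitr; apply: pclose_trans qq' _ => //.
    by apply: pclose_le q'q'' => //; exact: ltW.
  rewrite -[X in cabs X](subrKA (on f q)) [e]splitr.
  by apply: le_lt_trans (cabs_triangle _ _) _; rewrite cabsB ltrD.
(* The covering argument controls pairs whose first point is in the support; symmetry and the value
   zero outside give the rest. *)
have {}hd : forall q q' : Rpunc_space T, pclose (d / 2) (sval q) (sval q') ->
    f (sval q).1 (sval q).2 != 0 -> cabs (on f q - on f q') < e.
  move=> q q' qq' fq; have := hd (d / 2); rewrite /= sub0r normrN gtr0_norm ?divr_gt0//.
  rewrite ltr_pdivrMr// ltr_pMr// ltr1n => /(_ isT) /(_ isT) /(_ q); apply => //.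
  exact: subset_closure.
exists (d / 2); first by rewrite divr_gt0.
move=> P S P' S' PS P'S' c; pose q : Rpunc_space T := exist _ _ PS; pose q' : Rpunc_space T :=
  exist _ _ P'S'.
have [f1|f1] := eqVneq (f P S) 0; last exact: (hd q q').
have [f2|f2] := eqVneq (f P' S') 0; first by rewrite f1 f2 subrr cabs0.
by rewrite cabsB; apply: (hd q' q) => //; exact: pclose_sym.
Qed.

End CompactSupport.

(** * The reduced norm *)

Section ReducedNorm.
Context {R : realType} {T : set (@tile R)} {n : nat} {p : 'I_n -> set 'cV[R]_2}.
Context {std : standing T p}.
Local Notation tile := (@tile R).
Local Notation fn := (set tile -> set tile -> R[i]).
Local Notation vec := (set tile -> R[i]).
Local Notation dh := (discrete_hull T).
Local Notation row_bounded := (row_bounded (T := T)).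
Implicit Types (P Q S : set tile) (f g : fn) (xi eta : vec) (s : seq (set tile)) (M N : R).

Definition sqn s xi : R := \sum_(P <- s) cabs (xi P) ^+ 2.

Definition form s f xi eta : R[i] :=
  \sum_(P <- s) \sum_(S <- s) conjc (eta P) * (f P S * xi S).

Definition in_class T0 s : Prop := uniq s /\ forall P, P \in s -> Rpunc T (T0, P).

(* By scaling [xi] and [eta], this says that the compressions of [f] to finite
   subsets of the equivalence classes have operator norm at most [M]. *)
Definition norm_bound f M : Prop := forall T0 s xi eta, dh T0 -> in_class T0 s ->
  cabs (form s f xi eta) <= M * ((sqn s xi + sqn s eta) / 2).

Lemma sqn_ge0 s xi : 0 <= sqn s xi.
Proof. by apply: sumr_ge0 => P _; exact: sqr_ge0. Qed.

Lemma norm_bound_le f M N : M <= N -> norm_bound f M -> norm_bound f N.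
Proof.
move=> MN fM T0 s xi eta d c; apply: le_trans (fM _ _ _ _ d c) _.
by rewrite ler_wpM2r// divr_ge0// addr_ge0 ?sqn_ge0.
Qed.

Lemma norm_bound0 M : 0 <= M -> norm_bound (@fn_zero R) M.
Proof.
move=> M0 T0 s xi eta _ _; rewrite /form big1; last first.
  by move=> P _; rewrite big1// => S _; rewrite mul0r mulr0.
by rewrite cabs0 mulr_ge0// divr_ge0// addr_ge0 ?sqn_ge0.
Qed.

Lemma norm_bound_add f g M N : norm_bound f M -> norm_bound g N ->
  norm_bound (fn_add f g) (M + N).
Proof.
move=> fM gN T0 s xi eta d c.
have -> : form s (fn_add f g) xi eta = form s f xi eta + form s g xi eta.
  rewrite /form -big_split; apply: eq_bigr => P _; rewrite -big_split/=.
  by apply: eq_bigr => S _; rewrite mulrDl mulrDr.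
apply: le_trans (cabs_triangle _ _) _; rewrite mulrDl.
by apply: lerD; [exact: fM d c | exact: gN d c].
Qed.

Lemma norm_bound_scale c f M : norm_bound f M -> norm_bound (fn_scale c f) (cabs c * M).
Proof.
move=> fM T0 s xi eta d ic.
have -> : form s (fn_scale c f) xi eta = c * form s f xi eta.
  rewrite /form mulr_sumr; apply: eq_bigr => P _; rewrite mulr_sumr.
  by apply: eq_bigr => S _; rewrite /fn_scale; ring.
by rewrite cabsM -mulrA ler_wpM2l ?cabs_ge0//; exact: fM d ic.
Qed.

Lemma norm_bound_opp f M : norm_bound f M -> norm_bound (fn_scale (-1) f) M.
Proof.
move=> fM; have E : cabs (-1 : R[i]) * M = M by rewrite cabsN cabs1 mul1r.
by rewrite -E; exact: norm_bound_scale.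
Qed.

(** The adjoint exchanges [xi] and [eta], and the bound is symmetric in them. *)
Lemma norm_bound_star f M : norm_bound f M -> norm_bound (fn_star f) M.
Proof.
move=> fM T0 s xi eta d c.
have -> : form s (fn_star f) xi eta = conjc (form s f eta xi).
  rewrite /form exchange_big rmorph_sum; apply: eq_bigr => P _ /=; rewrite rmorph_sum.
  apply: eq_bigr => S _ /=; rewrite !rmorphM/= /fn_star conjcK; ring.
by rewrite cabs_conj addrC; exact: fM d c.
Qed.

Lemma formE s f xi eta :
  form s f xi eta = \sum_(P <- s) conjc (eta P) * (\sum_(S <- s) f P S * xi S).
Proof. by apply: eq_bigr => P _; rewrite mulr_sumr. Qed.

Lemma sqn_scale s (c : R) xi : sqn s (fun P => c%:C%C * xi P) = c ^+ 2 * sqn s xi.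
Proof.
rewrite /sqn mulr_sumr; apply: eq_bigr => P _.
by rewrite cabsM cabs_real exprMn real_normK// num_real.
Qed.

Lemma form_sqn s f xi :
  form s f xi (fun P => \sum_(S <- s) f P S * xi S) =
  (sqn s (fun P => \sum_(S <- s) f P S * xi S))%:C%C.
Proof. by rewrite formE /sqn rmorph_sum; apply: eq_bigr => P _; rewrite mul_conjc. Qed.

(** The form is tested against the image of [xi] divided by [M], the scaling at which the two
    squares on the right balance. *)
Lemma norm_bound_sqn f M T0 s xi : norm_bound f M -> 0 < M -> dh T0 -> in_class T0 s ->
  sqn s (fun P => \sum_(S <- s) f P S * xi S) <= M ^+ 2 * sqn s xi.
Proof.
move=> fM M0 d c; set eta := fun P => _; set X := sqn s eta.
have X0 : 0 <= X := sqn_ge0 _ _.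
have := fM T0 s xi (fun P => (M^-1)%:C%C * eta P) d c.
have -> : form s f xi (fun P => (M^-1)%:C%C * eta P) = (M^-1)%:C%C * form s f xi eta.
  rewrite !formE mulr_sumr; apply: eq_bigr => P _.
  by rewrite rmorphM/= oppr0 -[Complex _ _]/(_%:C%C) mulrA.
rewrite form_sqn -/X cabsM !cabs_real sqn_scale -/X.
rewrite !ger0_norm// ?invr_ge0 ?(ltW M0)// => h.
have M1 : M * M^-1 = 1 by rewrite divff// gt_eqF.
move: h; rewrite -(@ler_pM2l _ (2 * M)) ?mulr_gt0//.
have -> : 2 * M * (M^-1 * X) = 2 * X * (M * M^-1) by ring.
have -> : 2 * M * (M * ((sqn s xi + M^-1 ^+ 2 * X) / 2)) =
  M ^+ 2 * sqn s xi + (M * M^-1) ^+ 2 * X by field; rewrite gt_eqF.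
rewrite M1; lra.
Qed.

Lemma sqn_norm_bound f M : 0 < M -> (forall T0 s xi, dh T0 -> in_class T0 s ->
    sqn s (fun P => \sum_(S <- s) f P S * xi S) <= M ^+ 2 * sqn s xi) ->
  norm_bound f M.
Proof.
move=> M0 h T0 s xi eta d c; have := h T0 s xi d c.
set phi := fun P => _; move=> hphi.
rewrite formE -/phi; apply: le_trans (cabs_sum _ _) _.
have hM : M * sqn s eta + M^-1 * sqn s phi <= M * (sqn s xi + sqn s eta).
  rewrite mulrDr addrC lerD2r.
  rewrite -(@ler_pM2l _ M)// mulrA divff ?gt_eqF// mul1r mulrA -expr2; exact: hphi.
rewrite mulrA ler_pdivlMr//; apply: le_trans hM.
rewrite /sqn !mulr_sumr mulr_suml -big_split/=; apply: ler_sum => P _.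
(* AM-GM: [2 a b <= M a^2 + b^2 / M] *)
rewrite cabsM cabs_conj -/(phi P); set a := cabs _; set b := cabs _.
have M1 : M * M^-1 = 1 by rewrite divff// gt_eqF.
rewrite -(@ler_pM2l _ M)//.
rewrite (_ : M * (M * a ^+ 2 + M^-1 * b ^+ 2) = M ^+ 2 * a ^+ 2 + (M * M^-1) * b ^+ 2); last by
  ring.
rewrite M1; have : 0 <= (M * a - b) ^+ 2 by exact: sqr_ge0.
nra.
Qed.

(* Schur test: the rows and, by symmetry, the columns have boundedly many nonzero entries. *)
Lemma norm_bound_schur M : exists2 K : R, 0 < K & forall f B, row_bounded M f ->
  0 <= B -> (forall P S, cabs (f P S) <= B) -> norm_bound f (B * K).
Proof.
have [N0 NP] := row_count (T := T) M; exists (N0%:R + 1); first by rewrite ltr_wpDl.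
have rowsum f B P s : row_bounded M f -> 0 <= B -> (forall P S, cabs (f P S) <= B) ->
    uniq s -> \sum_(S <- s) cabs (f P S) <= B * (N0%:R + 1).
  move=> fM B0 fB us; rewrite (bigID (fun S => f P S != 0))/= [X in _ + X]big1; last first.
    by move=> S; rewrite negbK => /eqP ->; rewrite cabs0.
  rewrite addr0 -big_filter; apply: (@le_trans _ _ (\sum_(S <- [seq S <- s | f P S != 0]) B)).
    exact: ler_sum.
  rewrite big_const_seq count_predT iter_addr addr0 -[X in X <= _]mulr_natr ler_wpM2l//.
  apply: (@le_trans _ _ N0%:R); last by rewrite lerDl.
  rewrite ler_nat; apply: (NP P); first exact: filter_uniq.
  by move=> S; rewrite mem_filter => /andP[/fM].
move=> f B fM B0 fB T0 s xi eta d [us sc].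
have col P : \sum_(S <- s) cabs (f S P) <= B * (N0%:R + 1).
  have := rowsum (fn_star f) B P s (row_bounded_star fM) B0 _ us.
  rewrite (eq_bigr (fun S => cabs (f S P))); last by move=> S _; rewrite /fn_star cabs_conj.
  by apply=> S S'; rewrite /fn_star cabs_conj.
set K := B * _ in rowsum col *.
apply: le_trans (cabs_sum _ _) _.
apply: (@le_trans _ _ (\sum_(P <- s) \sum_(S <- s) cabs (f P S) * ((cabs (xi S) ^+ 2 + cabs
  (eta P) ^+ 2) / 2))).
  apply: ler_sum => P _; apply: le_trans (cabs_sum _ _) _; apply: ler_sum => S _.
  rewrite !cabsM cabs_conj mulrCA ler_wpM2l ?cabs_ge0//.
  by have := sqr_ge0 (cabs (xi S) - cabs (eta P)); nra.
rewrite -(@ler_pM2r _ 2)// mulrA divfK// big_distrl/=.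
rewrite (eq_bigr (fun P => \sum_(S <- s) cabs (f P S) * cabs (xi S) ^+ 2 +
   \sum_(S <- s) cabs (f P S) * cabs (eta P) ^+ 2)); last first.
  by move=> P _; rewrite big_distrl/= -big_split; apply: eq_bigr => S _ /=; field.
rewrite big_split/= mulrDr lerD//.
  rewrite exchange_big/= /sqn mulr_sumr; apply: ler_sum => S _.
  by rewrite -mulr_suml ler_wpM2r ?sqr_ge0.
rewrite /sqn mulr_sumr; apply: ler_sum => S _.
by rewrite -mulr_suml ler_wpM2r ?sqr_ge0// (rowsum f).
Qed.

(** A sum along a row that starts in [s] runs entirely within this list, so the compression to it
    computes the full convolution there. *)
Definition saturate M s := undup (s ++ flatten [seq rowseq (T := T) M P | P <- s]).

Lemma saturate_in_class M T0 s : in_class T0 s -> in_class T0 (saturate M s).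
Proof.
move=> [us sc]; split; first exact: undup_uniq.
move=> P; rewrite mem_undup mem_cat => /orP[/sc//|/flattenP[_ /mapP[Q Qs ->]]].
by move=> /rowseqP[QP _]; have [] := Rpunc_trans (sc _ Qs) QP.
Qed.

Lemma saturate_sub M s : {subset s <= saturate M s}.
Proof. by move=> P Ps; rewrite mem_undup mem_cat Ps. Qed.

Lemma saturate_row M f s P S : row_bounded M f -> P \in s -> f P S != 0 -> S \in saturate M s.
Proof.
move=> fM Ps fPS; rewrite mem_undup mem_cat; apply/orP; right.
by apply/flattenP; exists (rowseq (T := T) M P); [exact: map_f|apply/rowseqP/fM].
Qed.

Definition cut s xi : vec := fun P => if P \in s then xi P else 0.

Lemma sum_cut (C : nmodType) s s' (F : set tile -> C) : uniq s -> uniq s' ->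
  {subset s <= s'} -> \sum_(P <- s') (if P \in s then F P else 0) = \sum_(P <- s) F P.
Proof.
move=> us us' ss'; rewrite -big_mkcond/= -big_filter; apply: perm_big.
apply: uniq_perm => //; first exact: filter_uniq.
by move=> P; rewrite mem_filter; apply/andP/idP => [[]//|Ps]; split=> //; exact: ss'.
Qed.

Lemma sqn_cut s s' xi : uniq s -> uniq s' -> {subset s <= s'} -> sqn s' (cut s xi) = sqn s xi.
Proof.
move=> us us' ss'; rewrite /sqn -(sum_cut _ us us' ss').
by apply: eq_bigr => P _; rewrite /cut; case: ifP => // _; rewrite cabs0 expr0n.
Qed.

(** Vectors on [s] are extended by zero to the saturation, which contains every intermediate point.
    Dividing [zeta] by [N] gives a vector no longer than [xi], to which the bound for [f]
    applies. *)
Lemma norm_bound_mul B f g M N : row_bounded B f -> 0 < M -> 0 < N ->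
  norm_bound f M -> norm_bound g N -> norm_bound (fn_mul T f g) (M * N).
Proof.
move=> fB M0 N0 fM gN T0 s xi eta d c; have [us sc] := c.
set s' := saturate B s; have c' : in_class T0 s' := saturate_in_class B c.
have [us' _] := c'; have ss' : {subset s <= s'} := @saturate_sub B s.
pose xi' := cut s xi; pose eta' := cut s eta.
pose zeta Q : R[i] := \sum_(S <- s') g Q S * xi' S.
have -> : form s (fn_mul T f g) xi eta =
    N%:C%C * form s' f (fun Q => (N^-1)%:C%C * zeta Q) eta'.
  rewrite !formE mulr_sumr -(sum_cut _ us us' ss'); apply: eq_bigr => P _.
  rewrite /eta' /cut; case: ifP => [Ps|_]; last by rewrite conjc0 mul0r mulr0.
  rewrite mulrCA; congr (_ * _).
  rewrite [X in _ = _ * X](eq_bigr (fun Q => (N^-1)%:C%C * (f P Q * zeta Q))); last by move=> Q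
    _; rewrite mulrCA.
  rewrite -mulr_sumr [RHS]mulrA -rmorphM divff ?gt_eqF// rmorph1 mul1r.
  transitivity (\sum_(S <- s) \sum_(Q <- s') f P Q * (g Q S * xi S)).
    apply: eq_bigr => S _; rewrite /fn_mul.
    have -> : \sum_(Q \in eq_class T P) (f P Q * g Q S) = \sum_(Q <- s') f P Q * g Q S.
      apply: fsum_seq => //.
        move=> Q Qs'; have [PT0 _] := Rpunc_sym (sc _ Ps).
        by have [] := Rpunc_trans PT0 (c'.2 _ Qs').
      by move=> Q _; rewrite mulf_eq0 negb_or => /andP[fPQ _]; exact: saturate_row fPQ.
    by rewrite mulr_suml; apply: eq_bigr => Q _; rewrite mulrA.
  rewrite exchange_big/=; apply: eq_bigr => Q _; rewrite -mulr_sumr; congr (_ * _).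
  rewrite /zeta -(sum_cut _ us us' ss'); apply: eq_bigr => S _.
  by rewrite /xi' /cut; case: ifP => // _; rewrite mulr0.
rewrite cabsM cabs_real gtr0_norm// [M * N]mulrC -mulrA ler_pM2l//.
apply: le_trans (fM _ _ _ _ d c') _; rewrite ler_pM2l// ler_pM2r ?invr_gt0//.
rewrite sqn_cut// lerD2r sqn_scale.
have := norm_bound_sqn xi' gN N0 d c'; rewrite sqn_cut// -/zeta.
by move=> h; rewrite exprVn mulrC ler_pdivrMr ?exprn_gt0// mulrC.
Qed.

Lemma l2norm_le T0 xi M : 0 <= M ->
  (l2norm T T0 xi <= M%:E)%E <-> forall s, in_class T0 s -> sqn s xi <= M ^+ 2.
Proof.
move=> M0; rewrite /l2norm (_ : M%:E = sqrte (M ^+ 2)%:E); last by rewrite /= sqrtr_sqr ger0_norm.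
rewrite lee_sqrt ?lee_fin ?sqr_ge0//; split=> [h s [us sc]|h].
  rewrite -lee_fin; apply: le_trans h; apply: ereal_sup_ubound.
  exists [set` s] => /=; first by split; [exact: finite_seq|move=> P /sc].
  rewrite fsumEFin; last exact: finite_seq.
  by rewrite -fsbig_seq//; congr EFin; apply: eq_bigr => P _; rewrite sqr_cabs.
apply: ge_ereal_sup => _ [A [fA AT] <-].
rewrite fsumEFin// lee_fin fsbig_finite//=.
rewrite (eq_bigr (fun P => cabs (xi P) ^+ 2)); last by move=> P _; rewrite sqr_cabs.
apply: h; split; first exact: finmap.fset_uniq.
by move=> P; rewrite in_fset_set ?inE// => /AT.
Qed.

Lemma induced_repE f T0 s xi P : in_class T0 s ->
  (forall S, f P S * xi S != 0 -> S \in s) ->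
  induced_rep T T0 f xi P = \sum_(S <- s) f P S * xi S.
Proof. by move=> [us sc] h; apply: fsum_seq => // S _; exact: h. Qed.

(** On a finite set the image of any vector depends only on its values on the saturation.
    Conversely, a vector on a finite set extends by zero to a square summable one. *)
Lemma reduced_norm_le B f M : row_bounded B f -> 0 < M ->
  (reduced_norm T f <= M%:E)%E <-> norm_bound f M.
Proof.
move=> fB M0; have ML : 0 <= M by exact: ltW.
split=> [fM|fM]; last first.
  apply: ge_ereal_sup => _ [T0 d <-]; apply: ge_ereal_sup => _ [xi /= xi1 <-].
  apply/l2norm_le => // s c; have [us sc] := c.
  set s' := saturate B s; have c' : in_class T0 s' := saturate_in_class B c.
  have [us' _] := c'; have ss' : {subset s <= s'} := @saturate_sub B s.
  have e1 : sqn s' xi <= 1.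
    by have /l2norm_le/(_ s' c') := xi1; rewrite expr1n; apply.
  apply: (@le_trans _ _ (sqn s' (fun P => \sum_(S <- s') f P S * xi S))).
    rewrite -(sqn_cut _ us us' ss'); apply: ler_sum => P _; rewrite /cut.
    case: ifP => [Ps|_]; last by rewrite cabs0 expr0n sqr_ge0.
    rewrite (induced_repE c')//.
    by move=> S; rewrite mulf_eq0 negb_or => /andP[h _]; exact: saturate_row h.
  apply: le_trans (norm_bound_sqn xi fM M0 d c') _.
  by rewrite ler_piMr// sqr_ge0.
apply: sqn_norm_bound => // T0 s xi d c; have [us sc] := c.
have sub : {subset s <= s} by [].
have bnd xi1 : sqn s xi1 <= 1 -> sqn s (fun P => \sum_(S <- s) f P S * xi1 S) <= M ^+ 2.
  move=> h1; have l1 : (l2norm T T0 (cut s xi1) <= 1)%E.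
    apply/l2norm_le => // s1 [us1 _]; rewrite expr1n; apply: le_trans h1.
    rewrite /sqn -[leRHS](sum_cut _ us (undup_uniq (s ++ s1))); last first.
      by move=> P Ps; rewrite mem_undup mem_cat Ps.
    rewrite -(sum_cut _ us1 (undup_uniq (s ++ s1))); last first.
      by move=> P Ps; rewrite mem_undup mem_cat Ps orbT.
    apply: ler_sum => P _; rewrite /cut; case: (P \in s1); case: (P \in s) => //.
      by rewrite cabs0 expr0n.
    exact: sqr_ge0.
  have l2 : (l2norm T T0 (induced_rep T T0 f (cut s xi1)) <= M%:E)%E.
    apply: le_trans fM; apply: le_trans (_ : (induced_rep_norm T T0 f <= _)%E).
      by apply: ereal_sup_ubound; exists (cut s xi1).
    by apply: ereal_sup_ubound; exists T0.
  have /l2norm_le/(_ s c) := l2; move=> /(_ ML); apply: le_trans.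
  rewrite /sqn le_eqVlt; apply/orP; left; apply/eqP.
  rewrite big_seq [RHS]big_seq; apply: eq_bigr => P Ps; congr (cabs _ ^+ 2).
  rewrite (induced_repE c); last first.
    by move=> S; rewrite /cut; case: ifP => // _; rewrite mulr0 eqxx.
  by rewrite big_seq [RHS]big_seq; apply: eq_bigr => S Ss; rewrite /cut Ss.
(* The bound on unit vectors extends by homogeneity; the zero vector cannot be normalised and is
   treated apart. *)
have [a0|a0] := eqVneq (sqn s xi) 0.
  rewrite a0 mulr0 (_ : sqn _ _ = 0)//; rewrite /sqn big1// => P _.
  rewrite big_seq big1 ?cabs0 ?expr0n// => S Ss.
  have : cabs (xi S) ^+ 2 = 0.
    apply/eqP; move/eqP: a0; rewrite /sqn psumr_eq0; last by move=> *; exact: sqr_ge0.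
    by move=> /allP/(_ _ Ss).
  move=> /eqP; rewrite sqrf_eq0 => /eqP x0; have /normr0_eq0 -> : `|xi S| = 0 by rewrite cabsE x0.
  by rewrite mulr0.
have ap : 0 < sqn s xi by rewrite lt_neqAle eq_sym a0 sqn_ge0.
pose r := (Num.sqrt (sqn s xi))^-1.
have r2 : r ^+ 2 = (sqn s xi)^-1 by rewrite /r exprVn sqr_sqrtr// ltW.
have := bnd (fun P => r%:C%C * xi P); rewrite sqn_scale r2 mulVf// lexx => /(_ isT).
rewrite (_ : (fun P => _) = (fun P => r%:C%C * \sum_(S <- s) f P S * xi S)); last first.
  by apply/funext => P; rewrite mulr_sumr; apply: eq_bigr => S _; rewrite mulrCA.
by rewrite sqn_scale r2 mulrC ler_pdivrMr.
Qed.

(** It keeps the supremum in the reduced norm from being the empty one, which is -∞. *)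
Lemma discrete_hull_nonempty : exists P, dh P.
Proof.
pose i : 'I_n := Ordinal (std_n_gt0 (standing := std)).
have [P hP Pt] := std_full (0, 0) i; exists P; split=> //.
by exists (act_tile (0, 0) (proto p i)) => //; rewrite puncture_act isom_rot mulmx0.
Qed.

Lemma reduced_norm_ge0 f : (0 <= reduced_norm T f)%E.
Proof.
have [P dP] := discrete_hull_nonempty.
apply: (@le_trans _ _ (induced_rep_norm T P f)); last first.
  by apply: ereal_sup_ubound; exists P.
apply: (@le_trans _ _ (l2norm T P (induced_rep T P f (fun=> 0)))); last first.
  apply: ereal_sup_ubound; exists (fun=> 0) => //=.
  apply/l2norm_le => // s _; rewrite /sqn big1 ?expr1n// => S _.
  by rewrite cabs0 expr0n.
exact: sqrte_ge0.
Qed.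

End ReducedNorm.

(** * Approximation by trigonometric polynomials *)

Section TrigonometricApproximation.
Context {R : realType}.
Implicit Types (a b e : R).

(** The de la Vallée-Poussin kernel cos^{2m}((a - b)/2), not normalised. *)
Definition cos_kernel (m : nat) a b : R := ((1 + cos (a - b)) / 2) ^+ m.

(** With z = e^{i(a-b)} the base is (1 + z)^2 / (4 z), and the binomial theorem applies. *)
Lemma cos_kernelE m a b : (cos_kernel m a b)%:C%C =
  4^-1 ^+ m * \sum_(i < m.*2.+1) 'C(m.*2, i)%:R * ez (a - b) ^ (i%:Z - m%:Z).
Proof.
set z := ez (a - b).
have z0 : z != 0 by rewrite -unitfE ez_unit.
have base : ((1 + cos (a - b)) / 2)%:C%C = 4^-1 * (z ^+ 2 + 2 * z + 1) / z.
  have h2 : 2%:R * (cos (a - b))%:C%C = z + z^-1 by rewrite -ez_conj addcJ.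
  have -> : ((1 + cos (a - b)) / 2)%:C%C = (2 + 2%:R * (cos (a - b))%:C%C) / 4 :> R[i].
    by rewrite rmorphM rmorphD rmorph1 fmorphV rmorph_nat; field.
  by rewrite h2; field.
rewrite /cos_kernel rmorphXn /= base -mulrA exprMn; congr (_ * _).
have -> : z ^+ 2 + 2 * z + 1 = (1 + z) ^+ 2 by ring.
rewrite exprMn -exprM mul2n exprDn mulr_suml; apply: eq_bigr => i _.
rewrite expr1n mul1r -mulr_natl -mulrA; congr (_ * _).
by rewrite ezXD -exprnP -exprz_inv -exprnP.
Qed.

Lemma roots_of_unity_sum (N : nat) (l : int) : (`|l| < N)%N -> l != 0 ->
  \sum_(j < N) ez (- (2 * pi * j%:R / N%:R)) ^ l = 0 :> R[i].
Proof.
move=> lN l0; have N0 : (0 < N)%N by exact: leq_ltn_trans lN.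
have NR : N%:R != 0 :> R by rewrite pnatr_eq0 -lt0n.
have ezX (a : R) (k : nat) : ez a ^+ k = ez (k%:R * a).
  elim: k => [|k IH]; first by rewrite mul0r ez0.
  by rewrite exprS IH -ezD -natr1 mulrDl mul1r addrC.
have ez_period (k : nat) : ez (k%:R * (2 * pi)) = 1 :> R[i].
  elim: k => [|k IH]; first by rewrite mul0r ez0.
  rewrite -natr1 mulrDl mul1r ezD IH mul1r /ez mulr_natl.
  by rewrite -[pi *+ 2]add0r cosD2pi sinD2pi cos0 sin0.
pose u : R[i] := ez (- (2 * pi / N%:R)).
have uE (j : nat) : ez (- (2 * pi * j%:R / N%:R)) = u ^+ j.
  by rewrite ezX; congr ez; field.
have ul : u ^ l != 1.
  have lt : (0 < `|l|)%N by rewrite absz_gt0.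
  suff : u ^+ `|l| != 1.
    apply: contraNneq => h; case: (l) h => k; rewrite ?NegzE -?exprnP; first by move=> ->.
    by move=> /(congr1 GRing.inv); rewrite invrK invr1 => ->.
  rewrite /u ezX; set x := _ * _; apply/negP => /eqP[/= hc _].
  (* Half the angle lies strictly between 0 and π, so its sine is nonzero and the root of unity is
     not 1. *)
  pose y := `|l|%:R * pi / N%:R : R.
  have : cos (y *+ 2) = 1.
    by rewrite -hc -cosN; congr cos; rewrite /x /y -mulr_natl; field.
  rewrite mulr2n cosD => h; have : sin y ^+ 2 = 0 by have := cos2Dsin2 y; nra.
  have : 0 < sin y.
    apply: sin_gt0_pi; apply/andP; split.
      by rewrite !mulr_gt0 ?invr_gt0 ?ltr0n// pi_gt0.
    by rewrite ltr_pdivrMr ?ltr0n// mulrC ltr_pM2l ?pi_gt0// ltr_nat.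
  by move=> s0 /eqP; rewrite sqrf_eq0 gt_eqF.
rewrite (eq_bigr (fun j : 'I_N => (u ^ l) ^+ j)); last first.
  by move=> j _; rewrite uE -[u ^+ j]/(u ^ j%:Z) exprzAC.
have := subrX1 (u ^ l) N; rewrite -[X in X - 1](_ : u ^+ N ^ l = _); last first.
  by rewrite -[u ^+ N]/(u ^ N%:Z) exprzAC.
have -> : u ^+ N = 1.
  rewrite /u ezX mulrN ezN (_ : N%:R * (2 * pi / N%:R) = 1%:R * (2 * pi)); last by field.
  by rewrite ez_period invr1.
by rewrite exp1rz subrr => /esym/eqP; rewrite mulf_eq0 subr_eq0 (negbTE ul) => /eqP.
Qed.

(** All frequencies are at most [m] in absolute value, so on [m.+1] equidistant nodes only the
    constant term survives. *)
Lemma cos_kernel_sum m a : \sum_(j < m.+1) cos_kernel m a (2 * pi * j%:R / m.+1%:R) =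
  m.+1%:R * ('C(m.*2, m)%:R / 4 ^+ m).
Proof.
apply: complexI; rewrite rmorph_sum/=.
rewrite (eq_bigr (fun j : 'I_m.+1 => \sum_(i < m.*2.+1) 4^-1 ^+ m * 'C(m.*2, i)%:R *
   ez a ^ (i%:Z - m%:Z) * ez (- (2 * pi * j%:R / m.+1%:R)) ^ (i%:Z - m%:Z))); last first.
  move=> j _; rewrite cos_kernelE mulr_sumr; apply: eq_bigr => i _.
  by rewrite ezD exprzMl ?ez_unit// !mulrA.
rewrite exchange_big/=.
have im : (m < m.*2.+1)%N by rewrite ltnS -addnn leq_addr.
rewrite (bigD1 (Ordinal im))//= [X in _ + X]big1; last first.
  move=> i im'; rewrite -mulr_sumr roots_of_unity_sum ?mulr0//.
    have h : (i <= m + m)%N by rewrite addnn -ltnS.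
    rewrite ltnS; case: (leqP m i) => mi; first by rewrite subzn//= leq_subLR.
    by rewrite -abszN opprB subzn ?(ltnW mi)//= leq_subr.
  rewrite subr_eq0 eqz_nat; apply: contraNneq im' => e; exact/eqP/val_inj.
rewrite subrr addr0 (eq_bigr (fun=> 4^-1 ^+ m * 'C(m.*2, m)%:R)); last first.
  by move=> j _; rewrite !expr0z !mulr1.
rewrite sumr_const card_ord -[LHS]mulr_natl !rmorphM fmorphV rmorphXn !rmorph_nat /=.
by rewrite exprVn [_^-1 * _]mulrC.
Qed.

(** One step multiplies the right side by (2m + 1)/(2m + 2), so it is then at least 1/(2m + 2). *)
Lemma central_binomial m : 1 / (m.*2.+1)%:R <= 'C(m.*2, m)%:R / 4 ^+ m :> R.
Proof.
elim: m => [|m IH]; first by rewrite bin0 expr0.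
have E : ((m.+1).*2.+1 = m.*2.+3)%N by rewrite doubleS.
have rec : m.+1%:R * 'C(m.+1.*2, m.+1)%:R = 2 * (m.*2.+1)%:R * 'C(m.*2, m)%:R :> R.
  have h1 : m.+1%:R * 'C(m.+1.*2, m.+1)%:R = (2 * m.+1%:R) * 'C(m.*2.+1, m)%:R :> R.
    rewrite -natrM doubleS -(mul_bin_diag m.*2.+2 m) natrM; congr (_ * _).
    by rewrite -doubleS -mul2n natrM.
  have h2 : (m.*2.+1)%:R * 'C(m.*2, m)%:R = m.+1%:R * 'C(m.*2.+1, m)%:R :> R.
    by rewrite -!natrM (mul_bin_down m.*2.+1 m) -[in (_ - _)%N]addnn subSn ?leq_addr// addnK.
  by rewrite h1 -[RHS]mulrA h2 mulrA.
have m0 : 0 < m.+1%:R :> R by rewrite ltr0n.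
have d0 : 0 < (m.*2.+1)%:R :> R by rewrite ltr0n.
set c := 'C(m.*2, m)%:R / 4 ^+ m in IH.
have e : 'C(m.+1.*2, m.+1)%:R / 4 ^+ m.+1 = c * (m.*2.+1)%:R / (2 * m.+1%:R) :> R.
  rewrite /c exprS; apply: (mulfI (lt0r_neq0 m0)); rewrite mulrA rec.
  by field; rewrite ?expf_neq0 ?pnatr_eq0 ?gt_eqF.
rewrite e; have h : 1 <= c * (m.*2.+1)%:R by rewrite -ler_pdivrMr.
rewrite ler_pdivlMr ?mulr_gt0//; apply: le_trans h.
rewrite mul1r ler_pdivrMl ?ltr0n// mulr1 -natrM ler_nat E mul2n doubleS; exact: leqnSn.
Qed.

Lemma cos_kernel_ge0 m a b : 0 <= cos_kernel m a b.
Proof. by rewrite exprn_ge0// divr_ge0//; have := cos_geN1 (a - b); lra. Qed.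

Lemma cos_kernel_far m a b e : 0 < e <= 1 -> e <= frobenius (rotation a - rotation b) ->
  cos_kernel m a b <= (1 - e ^+ 2 / 8) ^+ m.
Proof.
move=> /andP[e0 e1] eab; have : e ^+ 2 <= 4 - 4 * cos (a - b).
  apply: (@le_trans _ _ (frobenius (rotation a - rotation b) ^+ 2)).
    by rewrite ler_pXn2r ?nnegrE ?frobenius_ge0// ltW.
  rewrite frobenius_rotationB exprMn !sqr_sqrtr ?addr_ge0 ?sqr_ge0// cosB.
  by have := cos2Dsin2 a; have := cos2Dsin2 b; lra.
move=> h; rewrite /cos_kernel lerXn2r ?nnegrE//; try lra.
by have := cos_geN1 (a - b); lra.
Qed.

(** For h = (1 - q)/3 one has q (1 + h)^2 <= 1, so Bernoulli gives q^m (m h)^2 <= 1. This beats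
    linear growth once m > 3 / (e h^2). *)
Lemma geometric_decay (q e : R) : 0 <= q < 1 -> 0 < e ->
  exists m : nat, q ^+ m * (m.*2.+1)%:R <= e.
Proof.
move=> /andP[q0 q1] e0; pose h := (1 - q) / 3.
have h0 : 0 < h by rewrite divr_gt0// subr_gt0.
have qh : q * (1 + h) ^+ 2 <= 1.
  have -> : q = 1 - 3 * h by rewrite /h; field.
  by nra.
have bern (m : nat) : 1 + m%:R * h <= (1 + h) ^+ m.
  elim: m => [|m IH]; first by rewrite mul0r addr0.
  have hm : 0 <= m%:R * h by rewrite mulr_ge0// ltW.
  rewrite exprS -natr1; apply: (@le_trans _ _ ((1 + h) * (1 + m%:R * h))); first by nra.
  by rewrite ler_wpM2l// addr_ge0// ltW.
pose m := (Num.trunc (3 / (e * h ^+ 2))).+1.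
exists m; have m1 : 1 <= m%:R :> R by rewrite ler1n.
have mh : 3 / (e * h ^+ 2) < m%:R by exact: truncnS_gt.
have eh : 0 < e * h ^+ 2 by apply: mulr_gt0 => //; exact: exprn_gt0.
rewrite ltr_pdivrMr// in mh.
have A : q ^+ m * (m%:R * h) ^+ 2 <= 1.
  have h1 : 0 <= m%:R * h by rewrite mulr_ge0// ltW.
  have h2 : m%:R * h <= (1 + h) ^+ m by apply: le_trans (bern m); rewrite lerDr.
  apply: (@le_trans _ _ (q ^+ m * ((1 + h) ^+ m) ^+ 2)).
    rewrite ler_wpM2l ?exprn_ge0// ler_pXn2r ?nnegrE//; exact: le_trans h2.
  by rewrite -exprM mulnC exprM -exprMn exprn_ile1// mulr_ge0// sqr_ge0.
have -> : (m.*2.+1)%:R = 2 * m%:R + 1 :> R by rewrite -natr1 -mul2n natrM.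
have mp : 0 < m%:R :> R by exact: lt_le_trans m1.
have X0 : 0 <= q ^+ m by rewrite exprn_ge0.
move: A mh X0 => A mh X0; set X := q ^+ m in A X0 *; set M := m%:R in A mh m1 mp *.
apply: (@le_trans _ _ (X * (3 * M))); first by rewrite ler_wpM2l//; lra.
apply: (@le_trans _ _ (X * (M * (e * h ^+ 2) * M))).
  by rewrite ler_wpM2l// ler_pM2r// ltW.
have -> : X * (M * (e * h ^+ 2) * M) = e * (X * (M * h) ^+ 2) by ring.
by rewrite ler_piMr// ltW.
Qed.

(* Quadrature of the kernel at equidistant points. A point near which no value
   of [F] is known is given the value 0; its kernel is then small at every [x]. *)
Lemma trig_approx (X : Type) (ang : X -> R) (F : X -> R[i]) (B d e : R) :
  0 < d -> 0 < e -> (forall x, cabs (F x) <= B) ->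
  (forall x y, frobenius (rotation (ang x) - rotation (ang y)) < d -> cabs (F x - F y) <= e) ->
  exists (N : nat) (c : nat -> R[i]) (k : nat -> int), forall x,
    cabs (F x - \sum_(i < N) c i * ez (ang x) ^ k i) <= e *+ 2.
Proof.
move=> d0 e0 FB FU; pose t := Num.min (d / 2) 1.
have t0 : 0 < t by rewrite lt_min divr_gt0/=.
have t1 : t <= 1 by rewrite ge_min lexx orbT.
have td : t + t <= d by rewrite [leRHS]splitr lerD// ge_min lexx.
have t2 : 0 < t ^+ 2 <= 1 by rewrite exprn_gt0// expr_le1// ltW.
have q01 : 0 <= 1 - t ^+ 2 / 8 < 1 by apply/andP; split; lra.
have [x0|X0] := pselect (exists x : X, True); last first.
  by exists 0%N, (fun=> 0), (fun=> 0) => x; case: X0; exists x.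
have B0 : 0 <= B by case: x0 => x _; apply: le_trans (FB x); exact: cabs_ge0.
have eB : 0 < e / (2 * B + 1) by rewrite divr_gt0// ltr_wpDl// mulr_ge0.
have [m hm] := geometric_decay q01 eB.
pose th (j : nat) : R := 2 * pi * j%:R / m.+1%:R.
have /choice[v vP] : forall j : nat, exists v, cabs v <= B /\
    forall x, frobenius (rotation (ang x) - rotation (th j)) < t -> cabs (F x - v) <= e.
  move=> j; have [[y hy]|ny] := pselect (exists y, frobenius (rotation (ang y) - rotation (th
    j)) < t).
    exists (F y); split=> // x hx; apply: FU; apply: le_lt_trans (rotation_triangle _ (th j) _) _.
    by apply: lt_le_trans td; rewrite [X in _ + X]frobeniusB ltrD.
  by exists 0; split; [rewrite cabs0|move=> x hx; case: ny; exists x].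
pose W : R := m.+1%:R * ('C(m.*2, m)%:R / 4 ^+ m).
have Wm : m.+1%:R / (m.*2.+1)%:R <= W.
  by rewrite /W ler_pM2l ?ltr0n//; have := central_binomial m; rewrite div1r.
have W0 : 0 < W by apply: lt_le_trans Wm; rewrite divr_gt0// ltr0n.
pose c (i : nat) : R[i] := W^-1%:C%C * \sum_(j < m.+1)
   v j * (4^-1 ^+ m * 'C(m.*2, i)%:R * ez (- th j) ^ (i%:Z - m%:Z)).
exists m.*2.+1, c, (fun i => i%:Z - m%:Z) => x.
have -> : \sum_(i < m.*2.+1) c i * ez (ang x) ^ (i%:Z - m%:Z) =
    W^-1%:C%C * \sum_(j < m.+1) (cos_kernel m (ang x) (th j))%:C%C * v j.
  rewrite (eq_bigr (fun i : 'I_m.*2.+1 => W^-1%:C%C * \sum_(j < m.+1) v j *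
    (4^-1 ^+ m * 'C(m.*2, i)%:R * ez (ang x - th j) ^ (i%:Z - m%:Z)))); last first.
    move=> i _; rewrite /c -mulrA mulr_suml; congr (_ * _); apply: eq_bigr => j _.
    by rewrite ezD exprzMl ?ez_unit//; ring.
  rewrite -mulr_sumr exchange_big; congr (_ * _); apply: eq_bigr => j _ /=.
  rewrite cos_kernelE -mulr_sumr mulrC; congr (_ * _); rewrite mulr_sumr.
  by apply: eq_bigr => i _; rewrite mulrA.
have FE : F x = W^-1%:C%C * \sum_(j < m.+1) (cos_kernel m (ang x) (th j))%:C%C * F x.
  rewrite -mulr_suml -rmorph_sum/= (cos_kernel_sum m (ang x)) -/W mulrA -rmorphM/=.
  by rewrite mulVf ?gt_eqF// mul1r.
rewrite {1}FE -mulrBr -sumrB cabsM cabs_real ger0_norm ?invr_ge0 ?(ltW W0)//.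
rewrite ler_pdivrMl//; apply: le_trans (cabs_sum _ _) _.
pose Q : R := (1 - t ^+ 2 / 8) ^+ m.
have Q0 : 0 <= Q by rewrite exprn_ge0//; case/andP: q01.
apply: (@le_trans _ _ (\sum_(j < m.+1) (cos_kernel m (ang x) (th j) * e + Q * (2 * B)))).
  apply: ler_sum => j _; rewrite -mulrBr cabsM cabs_real ger0_norm ?cos_kernel_ge0//.
  have [vB vF] := vP j.
  have [near|far] := ltP (frobenius (rotation (ang x) - rotation (th j))) t.
    apply: (@le_trans _ _ (cos_kernel m (ang x) (th j) * e)).
      by rewrite ler_wpM2l ?cos_kernel_ge0// vF.
    by rewrite lerDl !mulr_ge0.
  apply: (@le_trans _ _ (Q * (2 * B))); last first.
    by rewrite lerDr mulr_ge0 ?cos_kernel_ge0// ltW.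
  apply: ler_pM; rewrite ?cos_kernel_ge0 ?cabs_ge0//.
    by apply: cos_kernel_far => //; rewrite t0.
  by apply: le_trans (cabs_triangle _ _) _; rewrite cabsN mulr_natl mulr2n lerD.
rewrite big_split/= -mulr_suml (cos_kernel_sum m (ang x)) -/W mulr2n mulrDr lerD2l.
rewrite sumr_const card_ord -[leLHS]mulr_natr.
apply: (@le_trans _ _ (m.+1%:R / (m.*2.+1)%:R * e)); last by rewrite ler_wpM2r// ltW.
have D0 : 0 < (m.*2.+1)%:R :> R by rewrite ltr0n.
rewrite mulrC -[leRHS]mulrA ler_wpM2l// ler_pdivlMl// mulrC.
have B1 : 0 < 2 * B + 1 by rewrite ltr_wpDl// mulr_ge0.
have h : Q * (m.*2.+1)%:R * (2 * B + 1) <= e by rewrite -ler_pdivlMr.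
apply: le_trans h; rewrite mulrAC ler_wpM2l ?mulr_ge0 ?(ltW D0)//; lra.
Qed.

End TrigonometricApproximation.

(** * Density *)

Section Density.
Context {R : realType} {T : set (@tile R)} {n : nat} {p : 'I_n -> set 'cV[R]_2}.
Context {std : standing T p}.
Local Notation plane := 'cV[R]_2.
Local Notation tile := (@tile R).
Local Notation fn := (set tile -> set tile -> R[i]).
Local Notation dh := (discrete_hull T).
Local Notation al := (central_angle p).
Local Notation nrm := (nrm (p := p)).
Local Notation ndisp := (ndisp (p := p)).
Local Notation pclose := (pclose (p := p)).
Local Notation Wset := (Wset (T := T) (p := p)).
Local Notation wfun := (wfun (T := T) (p := p)).
Local Notation span := (linear_span (generators T p)).
Local Notation norm_bound := (norm_bound (T := T)).
Implicit Types (t u : tile) (P Q S : set tile) (f g : fn) (q : set tile * set tile) (r M : R).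

(* The part of a pair that rotations do not change, as seen from the ball of
   radius [r]. *)
Definition code r q : set tile * plane := (hits r (nrm q.1), ndisp q).

Definition codes r M := [set code r q | q in [set q | Rpunc T q /\ frobenius (displacement q) < M]].

Lemma codes_finite r M : M <= r -> finite_set (codes r M).
Proof.
move=> Mr; have [D D0 DP] := nrm_outradius; pose rho := r + 2 * D.
apply: (@sub_finite_set _ _ (\bigcup_(A in [set patch_in_ball (nrm P) 0 rho | P in dh])
  ((fun u => (hits r A, puncture u)) @` A))); last first.
  apply: bigcup_finite; first exact: nrm_patches_finite.
  by move=> _ [P [hP _] <-]; apply/finite_image/nrm_patch_finite.
move=> _ [[P S] [PS dM] <-]; have dP := Rpunc_dh1 PS; have [hP _] := dP.
exists (patch_in_ball (nrm P) 0 rho); first by exists P.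
have inball t y : nrm P t -> tile_support t y -> frobenius y < r ->
    patch_in_ball (nrm P) 0 rho t.
  move=> Pt ty yr; split=> // z tz; rewrite /eball/= subr0 /rho.
  have h1 := DP _ _ hP Pt _ tz; have h2 := DP _ _ hP Pt _ ty.
  rewrite /eball/= in h1 h2.
  have -> : z = (z - puncture t) + (- (y - puncture t) + y) by rewrite opprB !subrK.
  apply: le_lt_trans (frobenius_triangle _ _) _.
  have := frobenius_triangle (- (y - puncture t)) y; rewrite frobeniusN; lra.
have [u Pu eu] := nrm_ndisp PS.
exists u.
  apply: (inball u (puncture u)) => //; first exact: nrm_puncture_support hP Pu.
  by rewrite eu /ndisp frobenius_rotation; exact: lt_le_trans Mr.
rewrite /code /= eu; congr pair; apply/seteqP; split=> t [].
  by move=> [Pt _] h; split.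
move=> Pt [y [ty yr]]; split; last by exists y.
by apply: (inball t y) => //; move: yr; rewrite /eball/= subr0.
Qed.

Lemma code_Wset r q0 q : Rpunc T q0 -> Rpunc T q ->
  Wset (code r q0).1 (code r q0).2 q <-> code r q = code r q0.
Proof.
case: q0 q => [P0 S0] [P S] PS0 PS /=.
have [[hP0 _] [hP _]] := (Rpunc_dh1 PS0, Rpunc_dh1 PS).
split=> [[_ /= PP e]|[eP e]].
  rewrite /code/= e; congr pair; apply/esym.
  exact: hits_tiling (nrm_tiling hP0) (nrm_tiling hP) PP.
by split=> //=; rewrite -eP => t [].
Qed.

Lemma code_pclose r d q q' : 0 < d -> d^-1 <= r -> Rpunc T q -> Rpunc T q' -> code r q = code r
  q' ->
  frobenius (rotation (al q.1) - rotation (al q'.1)) < d -> pclose d q q'.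
Proof.
case: q q' => [P S] [P' S'] d0 dr /= PS PS' [eP e] h; split=> //; split=> //= t td.
have [[hP _] [hP' _]] := (Rpunc_dh1 PS, Rpunc_dh1 PS').
have hit (Q : set tile) : hull T Q -> nrm Q t -> tile_support t `&` eball 0 r !=set0.
  move=> hQ Qt; exists (puncture t); have ts : tile_support t (puncture t) by exact:
    nrm_puncture_support hQ Qt.
  by split=> //; exact: (eball_subset dr (td _ ts)).
split=> Pt.
  have : hits r (nrm P) t by split=> //; exact: hit Pt.
  by rewrite eP => -[].
have : hits r (nrm P') t by split=> //; exact: hit Pt.
by rewrite -eP => -[].
Qed.

Lemma code_span r M k q : 0 < M <= r -> Rpunc T q -> frobenius (displacement q) < M ->
  span (wfun k (code r q).1 (code r q).2).
Proof.
case: q => [P S] /andP[M0 Mr] /= PS dM; have dP := Rpunc_dh1 PS; have [hP _] := dP.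
have [i Pi] := nrm_central dP; have [u Pu eu] := nrm_ndisp PS.
have su : tile_support u (puncture u) by exact: nrm_puncture_support hP Pu.
have si : tile_support (proto p i) 0 by exact: nrm_puncture_support hP Pi.
apply: (@wfun_span _ _ _ _ std k _ _ u i) => //.
- have [D D0 DP] := nrm_outradius.
  apply: sub_finite_set (nrm_patch_finite (r + 2 * D) hP) => t [Pt [y [ty yr]]]; split=> // z tz.
  have h1 := DP _ _ hP Pt _ tz; have h2 := DP _ _ hP Pt _ ty.
  rewrite /eball/= subr0 in yr; rewrite /eball/= in h1 h2; rewrite /eball/= subr0.
  have -> : z = (z - puncture t) + (- (y - puncture t) + y) by rewrite opprB !subrK.
  apply: le_lt_trans (frobenius_triangle _ _) _.
  have := frobenius_triangle (- (y - puncture t)) y; rewrite frobeniusN; lra.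
- by split=> //; exists 0; split=> //; apply: eball_center; exact: lt_le_trans Mr.
- split=> //; exists (puncture u); split=> //; rewrite /eball/= subr0 eu /ndisp frobenius_rotation.
  exact: lt_le_trans Mr.
Qed.

Lemma span_dense f e : Cc T f -> 0 < e -> exists2 g, span g & norm_bound (fn_sub f g) e.
Proof.
move=> Cf e0; have [M1 fM1] := Cc_row_bounded Cf; pose M := Num.max M1 1.
have fM : row_bounded (T := T) M f by apply: row_bounded_le fM1; rewrite le_max lexx.
have M0 : 0 < M by rewrite lt_max ltr01 orbT.
have [K K0 KP] := norm_bound_schur (T := T) M.
have [B B0 fB] := Cc_bounded Cf.
pose e' := e / (2 * K); have e'0 : 0 < e' by rewrite divr_gt0 ?mulr_gt0.
have [d d0 dP] := Cc_uniformly_continuous Cf e'0.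
pose r := Num.max M d^-1.
have Mr : M <= r by rewrite le_max lexx.
have dr : d^-1 <= r by rewrite le_max lexx orbT.
have /choice[G GP] : forall c : set tile * plane, exists Nck : nat * (nat -> R[i]) * (nat -> int),
    forall q, Rpunc T q -> code r q = c ->
    cabs (f q.1 q.2 - \sum_(i < Nck.1.1) Nck.1.2 i * ez (al q.1) ^ Nck.2 i) <= e' *+ 2.
  move=> c; have [||N [co [k h]]] := @trig_approx R {q | Rpunc T q /\ code r q = c}
      (fun x => al (sval x).1) (fun x => f (sval x).1 (sval x).2) B d e' d0 e'0.
  - by move=> q; exact: fB.
  - move=> [[P S] [/= PS cq]] [[P' S'] [/= PS' cq']] h; apply/ltW/dP => //.
    by apply: (@code_pclose r) => //; rewrite cq.
  by exists (N, co, k) => q Rq cq; exact: (h (exist _ q (conj Rq cq))).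
have fin : finite_set (codes r M) by exact: codes_finite.
pose cs := finmap.enum_fset (fset_set (codes r M)).
have csP c : c \in cs <-> codes r M c by rewrite /cs in_fset_set// inE.
have ucs : uniq cs by exact: finmap.fset_uniq.
pose term c : fn := fun P S => if c \in cs then
  \sum_(i < (G c).1.1) (G c).1.2 i * wfun ((G c).2 i) c.1 c.2 P S else 0.
pose g : fn := fun P S => \sum_(c <- cs) term c P S.
exists g.
  apply: linear_span_sum => c; rewrite /term.
  case: (boolP (c \in cs)) => [|_]; last exact: linear_span_zero.
  move=> /csP[q [Rq qM] qc].
  have cspan k : span (wfun k c.1 c.2).
    by rewrite -qc; apply: (@code_span r M) => //; rewrite M0.
  rewrite (_ : (fun _ => _) = (fun P S => \sum_(i <- index_enum 'I_(G c).1.1)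
    fn_scale ((G c).1.2 i) (wfun ((G c).2 i) c.1 c.2) P S)) //.
  apply: linear_span_sum => i; exact: linear_span_scale.
have g0 P S : ~ prow (T := T) M P S -> g P S = 0.
  move=> nR; rewrite /g big_seq big1// => c cc; rewrite /term cc big1// => i _.
  have /csP[[P0 S0] [R0 qM] qc] := cc.
  rewrite /wfun; case: asboolP => [W|_]; last by rewrite mulr0.
  case: nR; have [PS _ e1] := W; split=> //.
  rewrite -(ndispK (p := p) (P, S)) frobenius_rotation e1 -qc /= /ndisp frobenius_rotation.
  exact: qM.
have fgM : row_bounded (T := T) M (fn_sub f g).
  move=> P S; rewrite /fn_sub /fn_add /fn_scale; have [//|nR] := pselect (prow (T := T) M P S).
  have [->|/fM//] := eqVneq (f P S) 0.
  by rewrite g0// mulr0 addr0 eqxx.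
have -> : e = e' *+ 2 * K by rewrite /e' -mulr_natl; field; rewrite gt_eqF.
apply: KP => //; first by rewrite mulrn_wge0// ltW.
move=> P S; rewrite /fn_sub /fn_add /fn_scale mulN1r.
have [PSM|nR] := pselect (prow (T := T) M P S); last first.
  have -> : f P S = 0 by apply: contrapT => /eqP/fM.
  by rewrite g0// subr0 cabs0 mulrn_wge0// ltW.
have [PS dM] := PSM; pose c0 := code r (P, S).
have c0c : c0 \in cs by apply/csP; exists (P, S).
rewrite (_ : g P S = \sum_(i < (G c0).1.1) (G c0).1.2 i * ez (al P) ^ (G c0).2 i).
  exact: (GP c0 (P, S)).
rewrite /g (bigD1_seq c0)//= [X in _ + X]big_seq_cond [X in _ + X]big1 ?addr0; last first.
  move=> c /andP[cc cc0]; rewrite /term cc big1// => i _.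
  have /csP[q [Rq _] qc] := cc; rewrite /wfun.
  case: asboolP => [W|_]; last by rewrite mulr0.
  have h : code r (P, S) = code r q by apply: (code_Wset r Rq PS).1; rewrite qc.
  by case/eqP: cc0; rewrite -qc.
rewrite /term c0c; apply: eq_bigr => i _; congr (_ * _); rewrite /wfun.
by case: asboolP => // -[]; exact: (code_Wset r PS PS).2.
Qed.

End Density.

(** * The completed algebra *)

Section Completion.
Context {R : realType} {T : set (@tile R)} {n : nat} {p : 'I_n -> set 'cV[R]_2}.
Context {std : standing T p}.
Local Notation tile := (@tile R).
Local Notation fn := (set tile -> set tile -> R[i]).
Local Notation norm_bound := (norm_bound (T := T)).
Local Notation span := (linear_span (generators T p)).
Local Notation rdist := (reduced_dist T).
Implicit Types (f g : fn) (u v w h : nat -> fn) (e : R).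

Definition row_finite_fn f : Prop := exists M, row_bounded (T := T) M f.

Definition small h : Prop := forall e, 0 < e -> exists N : nat, forall k : nat,
  (N <= k)%N -> norm_bound (h k) e.

Lemma row_finite_add f g : row_finite_fn f -> row_finite_fn g -> row_finite_fn (fn_add f g).
Proof. by move=> [M fM] [M' gM]; eexists; exact: row_bounded_add fM gM. Qed.

Lemma row_finite_scale c f : row_finite_fn f -> row_finite_fn (fn_scale c f).
Proof. by move=> [M fM]; exists M; exact: row_bounded_scale. Qed.

Lemma row_finite_sub f g : row_finite_fn f -> row_finite_fn g -> row_finite_fn (fn_sub f g).
Proof. by move=> ff gg; apply: row_finite_add => //; exact: row_finite_scale. Qed.

Lemma row_finite_mul f g : row_finite_fn f -> row_finite_fn g -> row_finite_fn (fn_mul T f g).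
Proof. by move=> [M fM] [M' gM]; eexists; exact: row_bounded_mul fM gM. Qed.

Lemma row_finite_star f : row_finite_fn f -> row_finite_fn (fn_star f).
Proof. by move=> [M fM]; exists M; exact: row_bounded_star. Qed.

Lemma Cc_row_finite f : Cc T f -> row_finite_fn f.
Proof. exact: Cc_row_bounded. Qed.

Lemma Cc_norm_bound f : Cc T f -> exists2 K : R, 0 < K & norm_bound f K.
Proof.
move=> Cf; have [M fM] := Cc_row_bounded Cf; have [B B0 fB] := Cc_bounded Cf.
have [K K0 KP] := norm_bound_schur (T := T) M.
by exists (B * K); [rewrite mulr_gt0|exact: KP fM (ltW B0) fB].
Qed.

Lemma small_add h h' : small h -> small h' -> small (fun k => fn_add (h k) (h' k)).
Proof.
move=> sh sh' e e0; have e20 : 0 < e / 2 by rewrite divr_gt0.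
have [N NP] := sh _ e20; have [N' NP'] := sh' _ e20; exists (maxn N N') => k.
by rewrite geq_max => /andP[/NP h1 /NP' h2]; rewrite [e]splitr; exact: norm_bound_add.
Qed.

Lemma small_opp h : small h -> small (fun k => fn_scale (-1) (h k)).
Proof.
move=> sh e /sh[N NP]; exists N => k /NP hk; exact: norm_bound_opp.
Qed.

Lemma small_ext h h' : (forall k, h k = h' k) -> small h -> small h'.
Proof. by move=> hh' sh e /sh[N NP]; exists N => k; rewrite -hh'; exact: NP. Qed.

Lemma small_zero f : small (fun=> fn_sub f f).
Proof.
move=> e e0; exists 0%N => k _; rewrite (_ : fn_sub f f = fn_zero).
  by apply: norm_bound0; exact: ltW.
by apply/funext => P; apply/funext => S; rewrite /fn_sub /fn_add /fn_scale mulN1r subrr.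
Qed.

Lemma cvg0_reduced_norm h : (forall k, row_finite_fn (h k)) ->
  (reduced_norm T (h k) @[k --> \oo] --> 0%E) <-> small h.
Proof.
move=> rh; split=> [h0 e e0|sh].
  have /h0 : nbhs (0 : \bar R)%E [set y | (y < e%:E)%E] by exact: (@nbhs_open_ereal_lt _ 0
    (fun=> e)).
  move=> [N _ NP]; exists N => k /NP /= /ltW; have [M hM] := rh k.
  by move=> /(reduced_norm_le hM e0).
have le k e : 0 < e -> norm_bound (h k) e -> (reduced_norm T (h k) <= e%:E)%E.
  by move=> e0; have [M hM] := rh k; move=> /(reduced_norm_le hM e0).
apply/fine_cvgP; split.
  have [N NP] := sh 1 ltr01; exists N => // k /NP /(le _ _ ltr01) h1.
  rewrite ge0_fin_numE ?reduced_norm_ge0//; exact: le_lt_trans h1 (ltry _).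
apply/cvgrPdist_le => e e0; have [N NP] := sh _ e0; exists N => // k /NP /(le _ _ e0) h1.
rewrite sub0r normrN ger0_norm /=; last by apply: fine_ge0; exact: reduced_norm_ge0.
have fin : reduced_norm T (h k) \is a fin_num.
  rewrite ge0_fin_numE ?reduced_norm_ge0//; exact: le_lt_trans h1 (ltry _).
by rewrite -lee_fin fineK.
Qed.

Lemma same_limitP u v : (forall k, row_finite_fn (u k)) -> (forall k, row_finite_fn (v k)) ->
  same_limit rdist u v <-> small (fun k => fn_sub (u k) (v k)).
Proof. by move=> ru rv; apply: cvg0_reduced_norm => k; exact: row_finite_sub. Qed.

Lemma cauchy_seqP u : cauchy_seq (Cc T) rdist u <-> (forall k, Cc T (u k)) /\
  forall e, 0 < e -> exists N : nat, forall k l : nat, (N <= k)%N -> (N <= l)%N ->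
    norm_bound (fn_sub (u k) (u l)) e.
Proof.
split=> -[Cu uc]; split=> // e e0.
  have [N NP] := uc _ e0; exists N => k l kN lN.
  have [M hM] := row_finite_sub (Cc_row_finite (Cu k)) (Cc_row_finite (Cu l)).
  by apply/(reduced_norm_le hM e0)/ltW/NP.
have e20 : 0 < e / 2 by rewrite divr_gt0.
have [N NP] := uc _ e20; exists N => k l kN lN.
have [M hM] := row_finite_sub (Cc_row_finite (Cu k)) (Cc_row_finite (Cu l)).
apply: (@le_lt_trans _ _ (e / 2)%:E); first by apply/(reduced_norm_le hM e20)/NP.
by rewrite lte_fin ltr_pdivrMr// ltr_pMr// ltr1n.
Qed.

Lemma cauchy_seq_cst f : Cc T f -> cauchy_seq (Cc T) rdist (fun=> f).
Proof.
move=> Cf; apply/cauchy_seqP; split=> // e e0; have [N NP] := small_zero f e0.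
by exists N => k l kN _; exact: NP kN.
Qed.

Lemma Cstar_ofP f v : Cc T f ->
  Cstar_of T f v <-> cauchy_seq (Cc T) rdist v /\ small (fun k => fn_sub f (v k)).
Proof.
move=> Cf; have rf := Cc_row_finite Cf.
split=> -[cv h]; split=> //; have rv k : row_finite_fn (v k) by apply: Cc_row_finite; case: cv.
  by apply/(@same_limitP (fun=> f) v).
by apply/(@same_limitP (fun=> f) v).
Qed.

Lemma fn_sub_trans f g (f' : fn) : fn_sub f g = fn_add (fn_sub f f') (fn_sub f' g).
Proof.
by apply/funext => P; apply/funext => S; rewrite /fn_sub /fn_add /fn_scale; ring.
Qed.

Lemma Cstar_lift2 (op : fn -> fn -> fn) f g : Cc T f -> Cc T g -> Cc T (op f g) ->
  (forall f g, row_finite_fn f -> row_finite_fn g -> row_finite_fn (op f g)) ->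
  (forall u v, (forall k, Cc T (u k)) -> (forall k, Cc T (v k)) ->
    small (fun k => fn_sub f (u k)) -> small (fun k => fn_sub g (v k)) ->
    small (fun k => fn_sub (op f g) (op (u k) (v k)))) ->
  completion_lift2 (Cc T) rdist op (Cstar_of T f) (Cstar_of T g) = Cstar_of T (op f g).
Proof.
move=> Cf Cg Cfg rop cop; apply/seteqP; split=> w.
  move=> [cw [u [v [/(Cstar_ofP _ Cf)[cu su] /(Cstar_ofP _ Cg)[cv sv] h]]]].
  have Cu : forall k, Cc T (u k) by case: cu.
  have Cv : forall k, Cc T (v k) by case: cv.
  have Cw : forall k, Cc T (w k) by case: cw.
  apply/(Cstar_ofP _ Cfg); split=> //.
  have sw : small (fun k => fn_sub (op (u k) (v k)) (w k)).
    by apply/same_limitP => // k; [apply: rop|]; exact: Cc_row_finite.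
  have := small_add (cop _ _ Cu Cv su sv) sw; apply: small_ext => k.
  by rewrite -fn_sub_trans.
move=> /(Cstar_ofP _ Cfg)[cw sw]; split=> //; exists (fun=> f), (fun=> g); split.
- by apply/(Cstar_ofP _ Cf); split; [exact: cauchy_seq_cst|exact: small_zero].
- by apply/(Cstar_ofP _ Cg); split; [exact: cauchy_seq_cst|exact: small_zero].
- have Cw : forall k, Cc T (w k) by case: cw.
  by apply/(@same_limitP (fun=> op f g) w) => // k; exact: Cc_row_finite.
Qed.

Lemma Cstar_lift1 (op : fn -> fn) f : Cc T f -> Cc T (op f) ->
  (forall f, row_finite_fn f -> row_finite_fn (op f)) ->
  (forall u, (forall k, Cc T (u k)) ->
    small (fun k => fn_sub f (u k)) -> small (fun k => fn_sub (op f) (op (u k)))) ->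
  completion_lift1 (Cc T) rdist op (Cstar_of T f) = Cstar_of T (op f).
Proof.
move=> Cf Cof rop cop; apply/seteqP; split=> w.
  move=> [cw [u /(Cstar_ofP _ Cf)[cu su] h]].
  have Cu : forall k, Cc T (u k) by case: cu.
  have Cw : forall k, Cc T (w k) by case: cw.
  apply/(Cstar_ofP _ Cof); split=> //.
  have sw : small (fun k => fn_sub (op (u k)) (w k)).
    by apply/same_limitP => // k; [apply: rop|]; exact: Cc_row_finite.
  have := small_add (cop _ Cu su) sw; apply: small_ext => k.
  by rewrite -fn_sub_trans.
move=> /(Cstar_ofP _ Cof)[cw sw]; split=> //; exists (fun=> f).
  by apply/(Cstar_ofP _ Cf); split; [exact: cauchy_seq_cst|exact: small_zero].
have Cw : forall k, Cc T (w k) by case: cw.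
by apply/(@same_limitP (fun=> op f) w) => // k; exact: Cc_row_finite.
Qed.

Lemma Cstar_add_of f g : Cc T f -> Cc T g ->
  Cstar_add T (Cstar_of T f) (Cstar_of T g) = Cstar_of T (fn_add f g).
Proof.
move=> Cf Cg; apply: Cstar_lift2 => //; [exact: Cc_add|exact: row_finite_add|].
move=> u v _ _ su sv; have := small_add su sv; apply: small_ext => k.
by apply/funext => P; apply/funext => S; rewrite /fn_sub /fn_add /fn_scale; ring.
Qed.

Lemma Cstar_scale_of c f : Cc T f -> Cstar_scale T c (Cstar_of T f) = Cstar_of T (fn_scale c f).
Proof.
move=> Cf; apply: Cstar_lift1 => //; [exact: Cc_scale|exact: row_finite_scale|].
move=> u _ su e e0; have c0 : 0 < cabs c + 1 by rewrite ltr_wpDl// cabs_ge0.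
have [|N NP] := su (e / (cabs c + 1)); first by rewrite divr_gt0.
exists N => k /NP h.
rewrite (_ : fn_sub _ _ = fn_scale c (fn_sub f (u k))); last first.
  by apply/funext => P; apply/funext => S; rewrite /fn_sub /fn_add /fn_scale; ring.
apply: norm_bound_le (norm_bound_scale c h).
by rewrite mulrA ler_pdivrMr// mulrC ler_wpM2l ?(ltW e0)// lerDl.
Qed.

Lemma Cstar_star_of f : Cc T f -> Cc T (fn_star f) ->
  Cstar_star T (Cstar_of T f) = Cstar_of T (fn_star f).
Proof.
move=> Cf Csf; apply: Cstar_lift1 => //; first exact: row_finite_star.
move=> u _ su e /su[N NP]; exists N => k /NP h.
rewrite (_ : fn_sub _ _ = fn_star (fn_sub f (u k))); first exact: norm_bound_star.
apply/funext => P; apply/funext => S; rewrite /fn_sub /fn_add /fn_scale /fn_star !mulN1r.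
by rewrite -[X in _ - X]mulr1 mulr1; apply/esym; exact: rmorphB.
Qed.

Lemma Cstar_mul_of f g : Cc T f -> Cc T g -> Cc T (fn_mul T f g) ->
  Cstar_mul T (Cstar_of T f) (Cstar_of T g) = Cstar_of T (fn_mul T f g).
Proof.
move=> Cf Cg Cfg; apply: Cstar_lift2 => //; first exact: row_finite_mul.
move=> u v Cu Cv su sv e e0.
have [A A0 fA] := Cc_norm_bound Cf; have [B B0 gB] := Cc_norm_bound Cg.
pose d := Num.min 1 (e / (A + B + 1)).
have AB : 0 < A + B + 1 by rewrite !addr_gt0.
have d0 : 0 < d by rewrite lt_min ltr01 divr_gt0.
have d1 : d <= 1 by rewrite ge_min lexx.
have dAB : d * (A + B + 1) <= e by rewrite -ler_pdivlMr// ge_min lexx orbT.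
have [N NP] := su _ d0; have [N' NP'] := sv _ d0; exists (maxn N N') => k.
rewrite geq_max => /andP[/NP hu /NP' hv].
have [M1 fM] := Cc_row_finite Cf.
have [M2 uM] := Cc_row_finite (Cu k).
have [M3 sM] := row_finite_sub (Cc_row_finite Cf) (Cc_row_finite (Cu k)).
(* [f g - u v = (f - u) g + f (g - v) - (f - u) (g - v)] *)
rewrite (_ : fn_sub _ _ = fn_add (fn_mul T (fn_sub f (u k)) g) (fn_add (fn_mul T f (fn_sub g (v k)))
    (fn_scale (-1) (fn_mul T (fn_sub f (u k)) (fn_sub g (v k)))))); last first.
  rewrite /fn_sub !(fn_mulDr _ _ fM).
  rewrite !(fn_mulDl _ fM (row_bounded_scale (c := -1) uM)).
  rewrite !(fn_mulZl _ _ uM) !(fn_mulDr _ _ fM) !(fn_mulDr _ _ uM) !(fn_mulZr _ _ fM)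
    !(fn_mulZr _ _ uM).
  apply/funext => P; apply/funext => S; rewrite /fn_add /fn_scale; ring.
apply: (norm_bound_le (M := d * B + (A * d + d * d))); last first.
  apply: norm_bound_add; first exact: norm_bound_mul sM d0 B0 hu gB.
  apply: norm_bound_add; first exact: norm_bound_mul fM A0 d0 fA hv.
  by apply: norm_bound_opp; exact: (norm_bound_mul sM d0 d0 hu hv).
apply: le_trans dAB; rewrite !mulrDr mulr1.
have : d * d <= d by rewrite ler_piMr// ltW.
rewrite [A * d]mulrC; lra.
Qed.

Lemma Cstar_of_Cstar f : Cc T f -> Cstar T (Cstar_of T f).
Proof. by move=> Cf; exists (fun=> f) => //; exact: cauchy_seq_cst. Qed.

Lemma span_star_subalgebra : star_subalgebra T (Cstar_of T @` span).
Proof.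
split; first split.
- by move=> _ [f Sf <-]; exact/Cstar_of_Cstar/span_Cc.
- by exists fn_zero => //; exact: linear_span_zero.
- move=> _ _ [f Sf <-] [g Sg <-]; exists (fn_add f g); first exact: linear_span_add.
  by rewrite Cstar_add_of//; exact: span_Cc.
- move=> c _ [f Sf <-]; exists (fn_scale c f); first exact: linear_span_scale.
  by rewrite Cstar_scale_of//; exact: span_Cc.
- move=> _ _ [f Sf <-] [g Sg <-]; exists (fn_mul T f g); first exact: span_mul.
  by rewrite Cstar_mul_of//; apply: span_Cc => //; exact: span_mul.
- move=> _ [f Sf <-]; exists (fn_star f); first exact: span_star.
  by rewrite Cstar_star_of//; apply: span_Cc => //; exact: span_star.
Qed.

Lemma reduced_norm_fin f : Cc T f -> reduced_norm T f \is a fin_num.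
Proof.
move=> Cf; have [K K0 fK] := Cc_norm_bound Cf; have [M fM] := Cc_row_finite Cf.
rewrite ge0_fin_numE ?reduced_norm_ge0//.
by apply: (@le_lt_trans _ _ K%:E); [exact/(reduced_norm_le fM K0)|exact: ltry].
Qed.

Lemma fine_reduced_norm_le f g e : Cc T f -> Cc T g -> 0 < e -> norm_bound (fn_sub f g) e ->
  fine (reduced_norm T f) <= fine (reduced_norm T g) + e.
Proof.
move=> Cf Cg e0 fg; apply/ler_addgt0Pr => d d0.
have r0 : 0 <= fine (reduced_norm T g) by apply: fine_ge0; exact: reduced_norm_ge0.
have gd0 : 0 < fine (reduced_norm T g) + d by rewrite ltr_wpDl.
have [M gM] := Cc_row_finite Cg; have [M' fM] := Cc_row_finite Cf.
have gd : norm_bound g (fine (reduced_norm T g) + d).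
  apply/(reduced_norm_le gM gd0); rewrite EFinD fineK ?reduced_norm_fin//.
  by rewrite leeDl// lee_fin ltW.
have := norm_bound_add fg gd.
rewrite (_ : fn_add _ g = f); last first.
  by apply/funext => P; apply/funext => S; rewrite /fn_sub /fn_add /fn_scale; ring.
have s0 : 0 < e + (fine (reduced_norm T g) + d) by rewrite addr_gt0.
move=> /(reduced_norm_le fM s0); rewrite -[X in (X <= _)%E]fineK ?reduced_norm_fin// lee_fin; lra.
Qed.

Lemma reduced_norm_cvg w : cauchy_seq (Cc T) rdist w ->
  exists r : \bar R, reduced_norm T (w k) @[k --> \oo] --> r.
Proof.
move=> /cauchy_seqP[Cw cw].
pose x (k : nat) : R := fine (reduced_norm T (w k)).
have : cvg (x @ \oo).
  apply/cauchy_cvgP/cauchy_ballP => e e0.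
  have e20 : 0 < e / 2 by rewrite divr_gt0.
  have [N NP] := cw _ e20.
  exists (x @` [set k | (N <= k)%N], x @` [set k | (N <= k)%N]) => /=.
    by split; exists N => // k kN; exists k.
  move=> [_ _] /= [[k kN <-] [l lN <-]]; rewrite /ball/=.
  have h1 := fine_reduced_norm_le (Cw k) (Cw l) e20 (NP _ _ kN lN).
  have h2 := fine_reduced_norm_le (Cw l) (Cw k) e20 (NP _ _ lN kN).
  rewrite ltr_norml /x; apply/andP; split; lra.
move=> /cvg_ex[r xr]; exists r%:E; apply/fine_cvgP; split; last exact: xr.
by exists 0%N => // k _; exact: reduced_norm_fin.
Qed.

Lemma span_dense_Cstar : dense_in_Cstar T (Cstar_of T @` span).
Proof.
move=> _ [u cu ->] e e0; have /cauchy_seqP[Cu ucau] := cu.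
pose d := e / 8; have d0 : 0 < d by rewrite divr_gt0.
have [N NP] := ucau _ d0.
have [g Sg fg] := span_dense (Cu N) d0; have Cg : Cc T g by exact: span_Cc.
exists (Cstar_of T g); first by exists g.
rewrite Cstar_scale_of//; set g' := fn_scale (-1) g; have Cg' : Cc T g' by exact: Cc_scale.
set X := Cstar_add T _ _.
have ru k : row_finite_fn (u k) by exact: Cc_row_finite.
have lim_lt w r : X w -> reduced_norm T (w k) @[k --> \oo] --> r -> (r < e%:E)%E.
  move=> [cw [u' [v [[cu' lu'] /(Cstar_ofP _ Cg')[cv sv] lw]]]] wr.
  have Cw : forall k, Cc T (w k) by case: cw.
  have Cu' : forall k, Cc T (u' k) by case: cu'.
  have Cv : forall k, Cc T (v k) by case: cv.
  have rw k : row_finite_fn (w k) by exact: Cc_row_finite.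
  have su' : small (fun k => fn_sub (u k) (u' k)).
    by apply/same_limitP => // k; exact: Cc_row_finite.
  have sw : small (fun k => fn_sub (fn_add (u' k) (v k)) (w k)).
    by apply/same_limitP => // k; apply: row_finite_add; exact: Cc_row_finite.
  have [N1 N1P] := small_opp su' d0; have [N2 N2P] := small_opp sw d0.
  have [N3 N3P] := small_opp sv d0.
  apply: (@le_lt_trans _ _ (d + (d + (d + (d + d))))%:E); last by rewrite lte_fin /d; lra.
  have b0 : 0 < d + (d + (d + (d + d))) by rewrite !addr_gt0.
  apply: (closed_cvg (fun y => (y <= (d + (d + (d + (d + d))))%:E)%E) _ _ _ wr).
    exact: closed_ereal_ge_ereal.
  exists (maxn N (maxn N1 (maxn N2 N3))) => // k; rewrite /= !geq_max.
  move=> /and4P[kN /N1P h1 /N2P h2 /N3P h3].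
  have [M wM] := rw k; apply/(reduced_norm_le wM b0).
  rewrite (_ : w k = fn_add (fn_sub (u k) (u N)) (fn_add (fn_sub (u N) g)
    (fn_add (fn_scale (-1) (fn_sub (u k) (u' k))) (fn_add
      (fn_scale (-1) (fn_sub (fn_add (u' k) (v k)) (w k)))
      (fn_scale (-1) (fn_sub g' (v k))))))); last first.
    by apply/funext => P; apply/funext => S; rewrite /g' /fn_sub /fn_add /fn_scale; ring.
  apply: norm_bound_add; first exact: NP.
  by apply: norm_bound_add => //; apply: norm_bound_add => //; exact: norm_bound_add.
have cw : cauchy_seq (Cc T) rdist (fun k => fn_add (u k) g').
  apply/cauchy_seqP; split=> [k|e1 /ucau[N1 N1P]]; first exact: Cc_add.
  exists N1 => k l kN lN.
  rewrite (_ : fn_sub _ _ = fn_sub (u k) (u l)); first exact: N1P.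
  by apply/funext => P; apply/funext => S; rewrite /fn_sub /fn_add /fn_scale; ring.
have Xw : X (fun k => fn_add (u k) g').
  split=> //; exists u, (fun=> g'); split.
  - by split=> //; apply/same_limitP => // e1 e10; exists 0%N => k _; have [N1] := small_zero
    (u k) e10; exact.
  - by apply/(Cstar_ofP _ Cg'); split; [exact: cauchy_seq_cst|exact: small_zero].
  - apply/same_limitP => [k|k|]; try by apply: row_finite_add => //; exact: Cc_row_finite.
    move=> e1 e10; exists 0%N => k _.
    by have [N1] := small_zero (fn_add (u k) g') e10; exact.
have [r wr] := reduced_norm_cvg cw.
rewrite /Cstar_norm /completion_norm; case: xgetP => [s _ [w Xw' ws]|/(_ r)].
  exact: lim_lt Xw' ws.
by case; exists (fun k => fn_add (u k) g').
Qed.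

End Completion.

Theorem proposition3p3 (R : realType) (T : set (@tile R)) (n : nat)
    (p : 'I_n -> set 'cV[R]_2)
    (T_tiling : is_tiling T)
    (n_gt0 : (0 < n)%N)
    (p_polygon : forall i, closed_polygon (p i))
    (p_puncture : forall i, interior (p i) 0)
    (p_symmetry : trivial_symmetry p)
    (p_inequivalent : inequivalent_prototiles p)
    (p_prototiles : prototiles_of T p)
    (T_full : full_isometry_group T p)
    (T_flc : finite_local_complexity T)
    (T_aperiodic : strongly_aperiodic T) :
  let S := linear_span (generators T p) in
  [/\ S `<=` Cc T,
      star_subalgebra T (Cstar_of T @` S) &
      dense_in_Cstar T (Cstar_of T @` S)].
Proof.
have std : standing T p by split.
by split; [exact: span_Cc | exact: span_star_subalgebra | exact: span_dense_Cstar].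
Qed.
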